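(* Let $G$ be a locally compact group. Let $\mathcal Z$ be a neighbourhood basis of $e\in G$ contained in a fixed compact set, let $\nu:G\to[0,\infty)$ be bounded on compact sets and satisfy $\inf_{V\in\mathcal Z}\sup_{r\in V}\nu(r)=1$. Let $\mathcal R$ be a non-empty class of strongly continuous representations of $G$ on Banach spaces, such that, for $U\in\mathcal R$, $\|U_r\|\le\nu(r)$, for all $r\in G$. Let $\mathcal X$ be a class of Banach spaces, and suppose that $\mathcal R$ contains the class $\mathcal R'$, consisting of all strongly continuous representations $U$ of $G$ in spaces from $\mathcal X$, such that $\|U_r\|\le\nu(r)$, for all $r\in G$. Then the map which sends $U\in\mathcal R'$ to $U^{\mathcal R}$ is a bijection between $\mathcal R'$ and the non-degenerate contractive representations of $(\mathbb K\rtimes_{\mathrm{triv}}G)^{\mathcal R}$ in the Banach spaces from $\mathcal X$. This map preserves the set of closed invariant subspaces, as well as the Banach space of bounded intertwining operators between two elements of $\mathcal R'$. If all elements from $\mathcal R$ are unitary strongly continuous representations, then this bijection lets unitary strongly continuous representations of $G$ in $\mathcal R'$ correspond to involutive representations of the $C^*$-algebra $(\mathbb C\rtimes_{\mathrm{triv}}G)^{\mathcal R}$.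
   Context: $\mathbb K$ is the scalar field, $\mathbb R$ or $\mathbb C$. Locally compact groups are Hausdorff. A neighbourhood of a point is a set having it as interior point; ''$\mathcal Z$ contained in a fixed compact set'' means all elements of $\mathcal Z$ are subsets of one compact set. A representation of $G$ on a Banach space $X$ is a homomorphism $r\mapsto U_r$ into the invertible elements of $B(X)$. A representation of an algebra $B$ on $X$ is an algebra homomorphism $T:B\to B(X)$; it is non-degenerate if $\mathrm{span}\{T(b)x\}$ is dense in $X$, and contractive if $\|T\|\le1$. For a non-empty class $\mathcal R$ of strongly continuous representations of $G$ on Banach spaces with $\|U_r\|\le\nu(r)$ for all $U\in\mathcal R$, $r\in G$, where $\nu$ is bounded on compact sets, define on $C_c(G)$ (scalar-valued functions with the usual convolution) the algebra seminorm $\sigma^{\mathcal R}(f)=\sup_{U\in\mathcal R}\|\int_Gf(s)U_s\,ds\|$, where $ds$ is a left Haar measure and the integral is taken pointwise: $x\mapsto\int_Gf(s)U_sx\,ds$. The Banach algebra $(\mathbb K\rtimes_{\mathrm{triv}}G)^{\mathcal R}$ is the completion of $C_c(G)/\ker\sigma^{\mathcal R}$ in the norm induced by $\sigma^{\mathcal R}$, and $q^{\mathcal R}:C_c(G)\to(\mathbb K\rtimes_{\mathrm{triv}}G)^{\mathcal R}$ is the canonical map. For $U\in\mathcal R$, $U^{\mathcal R}$ is the contractive representation of $(\mathbb K\rtimes_{\mathrm{triv}}G)^{\mathcal R}$ on the space of $U$ determined by $U^{\mathcal R}(q^{\mathcal R}(f))=\int_Gf(s)U_s\,ds$ for $f\in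 C_c(G)$. If $\mathbb K=\mathbb C$ and all elements of $\mathcal R$ are unitary representations on Hilbert spaces, then $\sigma^{\mathcal R}$ is a $C^*$-seminorm for the involution $f^*(s)=\Delta(s^{-1})\overline{f(s^{-1})}$ ($\Delta$ the modular function) and the completion is a $C^*$-algebra. A bounded intertwining operator between two representations is a bounded operator commuting with the two actions. *)

(* Defs.v *)
From HB Require Import structures.
From mathcomp Require Import all_boot all_order all_algebra.
From mathcomp Require Import complex.
From mathcomp Require Import all_classical all_reals all_analysis.

Set Implicit Arguments.
Unset Strict Implicit.
Unset Printing Implicit Defensive.

Import Order.TTheory GRing.Theory Num.Theory.
Import numFieldNormedType.Exports.

Local Open Scope classical_set_scope.
Local Open Scope ring_scope.

Variant scalars := RealScalars | ComplexScalars.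

Definition scalar_field (R : realType) (k : scalars) : numFieldType :=
  match k with RealScalars => R | ComplexScalars => R[i] end.

Definition scalar_of_real (R : realType) (k : scalars) : R -> scalar_field R k :=
  match k return R -> scalar_field R k with
  | RealScalars => fun x => x
  | ComplexScalars => fun x => (x +i* 0)%C
  end.

Definition scalar_Re (R : realType) (k : scalars) : scalar_field R k -> R :=
  match k return scalar_field R k -> R with
  | RealScalars => fun z => z
  | ComplexScalars => fun z => complex.Re z
  end.

Definition scalar_conj (R : realType) (k : scalars)
    : scalar_field R k -> scalar_field R k :=
  match k return scalar_field R k -> scalar_field R k with
  | RealScalars => fun z => z
  | ComplexScalars => fun z => conjc z
  end.

(* The library norm `|x| takes its values in the scalar field; this is the
   same number as an element of R. *)
Definition rnorm (R : realType) (k : scalars)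
    (X : normedModType (scalar_field R k)) (x : X) : R := scalar_Re `|x|.

(* Classes of Banach spaces and of representations are Prop-valued predicates:
   they are too large for [set], hence for [set_bij]. *)
Definition class_bij (S T : Type) (P : S -> Prop) (Q : T -> Prop) (F : S -> T) :=
  [/\ forall x, P x -> Q (F x),
      forall x y, P x -> P y -> F x = F y -> x = y
    & forall y, Q y -> exists2 x, P x & F x = y].

(* The [PointedTopological] requirement (a group is inhabited anyway) is what
   the library asks for when it builds a generated sigma-algebra. *)
HB.mixin Record isTopologicalGroup G of PointedTopological G & Group G := {
  mulg_continuous : continuous (fun z : G * G => (z.1 * z.2)%g);
  invg_continuous : continuous (fun x : G => (x^-1)%g)
}.

#[short(type="topGroupType")]
HB.structure Definition TopologicalGroup :=
  { G of PointedTopological G & Group G & isTopologicalGroup G }.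

Notation borel G := (g_sigma_algebraType (@open G)).

Section haar.
Context {R : realType} {G : topGroupType}.
Variable mu : {measure set (borel G) -> \bar R}.

Definition radon_measure :=
  [/\ forall K : set G, compact K -> (mu K < +oo)%E,
      forall B : set (borel G), measurable B ->
        mu B = ereal_inf [set mu V | V in [set V : set G | open V /\ B `<=` V]]
    & forall V : set G, open V ->
        mu V = ereal_sup [set mu K | K in [set K : set G | compact K /\ K `<=` V]]].

Definition left_haar_measure :=
  [/\ radon_measure, mu [set: G] != 0%E
    & forall (r : G) (B : set (borel G)), measurable B ->
        mu [set (r * s)%g | s in B] = mu B].

(* With this convention, mu(B r) = Delta(r) mu(B), the involution of C_c(G) is
   f^*(s) = Delta(s^-1) conj(f(s^-1)). *)
Definition modular_function (Delta : G -> R) :=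
  forall r : G, 0 < Delta r /\
    forall B : set (borel G), measurable B ->
      mu [set (s * r)%g | s in B] = ((Delta r)%:E * mu B)%E.

End haar.

Section bochner.
Context {R : realType} {k : scalars} {G : topGroupType}.
Variable mu : {measure set (borel G) -> \bar R}.
Context {X : normedModType (scalar_field R k)}.

(* The list s stands for the simple function sum_(p <- s) 1_(p.1) p.2. *)
Definition simple_value (s : seq (set (borel G) * X)) (x : G) : X :=
  \sum_(p <- s) (\1_(p.1) x : scalar_field R k) *: p.2.

Definition simple_integral (s : seq (set (borel G) * X)) : X :=
  \sum_(p <- s) scalar_of_real k (fine (mu p.1)) *: p.2.

(* y is the integral of g when simple functions approximating g in L^1(mu)
   have integrals approximating y. *)
Definition is_bochner_integral (g : G -> X) (y : X) :=
  forall e : R, 0 < e -> exists s : seq (set (borel G) * X),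
    [/\ forall p, p \in s -> measurable p.1 /\ (mu p.1 < +oo)%E,
        measurable_fun [set: borel G] (fun x => rnorm (g x - simple_value s x)),
        (\int[mu]_x (rnorm (g x - simple_value s x))%:E < e%:E)%E
      & rnorm (y - simple_integral s) < e].

Definition bochner_integral (g : G -> X) : X := xget 0 (is_bochner_integral g).

End bochner.

Section compactly_supported.
Context {R : realType} {k : scalars} {G : topGroupType}.
Local Notation K := (scalar_field R k).

Definition Cc : set (G -> K) :=
  [set f | continuous f /\ compact (closure [set s | f s != 0])].

Definition convolution (mu : {measure set (borel G) -> \bar R}) (f g : G -> K)
  : G -> K :=
  fun s => @bochner_integral R k G mu K^o (fun r => f r * g (r^-1 * s)%g).

Definition Cc_star (Delta : G -> R) (f : G -> K) : G -> K :=
  fun s => scalar_of_real k (Delta (s^-1)%g) * scalar_conj (f (s^-1)%g).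

End compactly_supported.

(* The Banach space is part of the data, so that a class of representations
   on varying spaces is a predicate on families. *)
Record operator_family (R : realType) (k : scalars) (I : Type) :=
  OperatorFamily {
    space : completeNormedModType (scalar_field R k);
    op : I -> space -> space
  }.

Arguments op {R k I} o i x : rename.

Section operators.
Context {R : realType} {k : scalars}.
Local Notation K := (scalar_field R k).

Definition bounded_operator (X Y : normedModType K) (T : X -> Y) :=
  linear T /\ continuous T.

Definition opnorm (X Y : normedModType K) (T : X -> Y) : R :=
  sup [set rnorm (T x) | x in [set x | rnorm x <= 1]].

Definition linear_subspace (X : normedModType K) : set (set X) :=
  [set L | L 0 /\ forall (c : K) x y, L x -> L y -> L (c *: x + y)].

Definition lspan (X : normedModType K) (S : set X) : set X :=
  smallest (@linear_subspace X) S.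

Definition closed_invariant_subspace (I : Type) (p : operator_family R k I)
    : set (set (space p)) :=
  [set L | [/\ linear_subspace L, closed L & forall i x, L x -> L (op p i x)]].

Definition bounded_intertwiner (I : Type) (p p' : operator_family R k I)
    : set (space p -> space p') :=
  [set T | bounded_operator T /\ forall i x, T (op p i x) = op p' i (T x)].

(* [ip] is an inner product inducing the norm of X; for X complete, its
   existence means that X is a Hilbert space. *)
Definition inner_product (X : normedModType K) (ip : X -> X -> K) :=
  [/\ forall (c : K) x y z, ip (c *: x + y) z = c * ip x z + ip y z,
      forall x y, ip y x = scalar_conj (ip x y)
    & forall x, ip x x = `|x| ^+ 2].

End operators.

Arguments closed_invariant_subspace {R k I} p _.
Arguments bounded_intertwiner {R k I} p p' _.

Section group_representations.
Context {R : realType} {k : scalars} {G : topGroupType}.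
Local Notation K := (scalar_field R k).
Implicit Type p : operator_family R k G.

Definition group_representation p :=
  [/\ forall r, bounded_operator (op p r),
      op p 1%g = id
    & forall r s, op p (r * s)%g = op p r \o op p s].

Definition strongly_continuous p :=
  forall x : space p, continuous (fun r : G => op p r x).

Definition bounded_by (nu : G -> R) p :=
  forall r, opnorm (op p r) <= nu r.

Definition representations_in (XX : completeNormedModType K -> Prop)
    (nu : G -> R) p : Prop :=
  [/\ XX (space p), group_representation p, strongly_continuous p
    & bounded_by nu p].

Definition unitary p :=
  exists2 ip : space p -> space p -> K, inner_product ip &
    forall r x y, ip (op p r x) (op p r y) = ip x y.

Definition integrated (mu : {measure set (borel G) -> \bar R}) p (f : G -> K)
    : space p -> space p :=
  fun x => bochner_integral mu (fun s => f s *: op p s x).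

Arguments integrated mu p f x : clear implicits.

Definition crossed_seminorm (mu : {measure set (borel G) -> \bar R})
    (RR : operator_family R k G -> Prop) (f : G -> K) : R :=
  sup [set r | exists2 p, RR p & r = opnorm (integrated mu p f)].

End group_representations.

Arguments integrated {R k G} mu p f x.

Record banach_algebra (R : realType) (k : scalars) := BanachAlgebra {
  carrier :> completeNormedModType (scalar_field R k);
  amul : carrier -> carrier -> carrier;
  amulA : associative amul;
  amul_linear_l : forall b, linear (fun a => amul a b);
  amul_linear_r : forall a, linear (amul a);
  amul_norm : forall a b, rnorm (amul a b) <= rnorm a * rnorm b
}.

(* A completion of C_c(G) / ker sigma, where sigma is [crossed_seminorm]: a
   Banach algebra together with an algebra homomorphism q from C_c(G) that has
   dense range and carries sigma to the norm, so that q induces an isometric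
   embedding of the quotient with dense range.  The values of q outside C_c(G)
   are irrelevant. *)
Record crossed_product (R : realType) (k : scalars) (G : topGroupType)
    (mu : {measure set (borel G) -> \bar R}) (RR : operator_family R k G -> Prop)
  := CrossedProduct {
  cp_algebra :> banach_algebra R k;
  cp_map : (G -> scalar_field R k) -> cp_algebra;
  cp_map_linear : forall (c : scalar_field R k) f g, Cc f -> Cc g ->
    cp_map (fun s => c * f s + g s) = c *: cp_map f + cp_map g;
  cp_map_mul : forall f g, Cc f -> Cc g ->
    cp_map (convolution mu f g) = amul (cp_map f) (cp_map g);
  cp_map_norm : forall f, Cc f -> rnorm (cp_map f) = crossed_seminorm mu RR f;
  cp_map_dense : dense [set cp_map f | f in Cc]
}.

Section algebra_representations.
Context {R : realType} {k : scalars} {A : banach_algebra R k}.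
Local Notation K := (scalar_field R k).
Implicit Type p : operator_family R k A.

Definition algebra_representation p :=
  [/\ forall a, bounded_operator (op p a),
      forall (c : K) (a b : A) (x : space p),
        op p (c *: a + b) x = c *: op p a x + op p b x
    & forall a b : A, op p (amul a b) = op p a \o op p b].

Definition contractive p := forall a : A, opnorm (op p a) <= rnorm a.

Definition nondegenerate p :=
  dense (lspan [set y : space p | exists (a : A) x, y = op p a x]).

Definition involutive_representation (star : A -> A) p :=
  exists2 ip : space p -> space p -> K, inner_product ip &
    forall a x y, ip (op p a x) y = ip x (op p (star a) y).

Definition nondegenerate_contractive_in (XX : completeNormedModType K -> Prop)
    p : Prop :=
  [/\ XX (space p), algebra_representation p, contractive p
    & nondegenerate p].

Definition nondegenerate_involutive_in (XX : completeNormedModType K -> Prop)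
    (star : A -> A) p : Prop :=
  [/\ XX (space p), algebra_representation p, nondegenerate p
    & involutive_representation star p].

End algebra_representations.

Section crossed_product_constructions.
Context {R : realType} {k : scalars} {G : topGroupType}.
Context {mu : {measure set (borel G) -> \bar R}}.
Context {RR : operator_family R k G -> Prop}.
Variable A : crossed_product mu RR.

(* The representation U^RR of A on the space of U; the default value of [xget]
   is irrelevant for U in RR, where exactly one T qualifies. *)
Definition crossed_rep (p : operator_family R k G) : operator_family R k A :=
  @OperatorFamily R k A (space p)
    (xget (fun _ _ => 0) [set T : A -> space p -> space p |
      [/\ algebra_representation (OperatorFamily T),
          contractive (OperatorFamily T)
        & forall f, Cc f -> T (cp_map A f) = integrated mu p f]]).

(* The continuous extension to A of the involution of C_c(G); it exists and is
   unique when RR consists of unitary representations. *)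
Definition cp_star (Delta : G -> R) : A -> A :=
  xget (fun _ => 0) [set star : A -> A | continuous star /\
    forall f, Cc f -> star (cp_map A f) = cp_map A (Cc_star Delta f)].

End crossed_product_constructions.

Arguments cp_star {R k G mu RR} A Delta _.

(* Main.v *)
From HB Require Import structures.
Require Import Defs.
From mathcomp Require Import all_boot all_order all_algebra.
From mathcomp Require Import complex.
From mathcomp Require Import all_classical all_reals all_analysis.
From mathcomp Require Import measurable_realfun ring lra.

(** Integrating a representation [U] of [G] against functions gives a
    representation of the convolution algebra [Cc].  It is bounded for the norm
    of the crossed product [A], since [U] takes part in the supremum that
    defines this norm; hence it extends to [A] ([crossed_rep_spec_exists]).  The
    actions of [G] and of [A] are limits of each other.  The operator of a
    function is an integral of the [U_s].  Conversely [U_r x] is the limit of the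
    operators of [translate r h] at [x], when [h] runs through probability
    densities that concentrate at the identity ([crossed_rep_orbit]).
    Injectivity, and the equality of the closed invariant subspaces and of the
    bounded intertwiners of both actions, follow.

    Surjectivity is [disintegration].  Let [T] be a non-degenerate contractive
    representation of [A].  The group has to act by sending [T (q f) x] to
    [T (q (translate r f)) x].  This is well defined and bounded by [nu r] on
    sums of such vectors because left translation commutes with convolution on
    the right: if [h] is a probability density near the identity, then the
    shifted sum is close to [T (q (translate r h))] applied to the sum itself,
    and the norm of [q (translate r h)] is at most [nu r] times that of [q h],
    which exceeds 1 by as little as desired, like [nu] near the identity
    ([act_shift_bound]).

    In the unitary case, inversion carries the Haar measure [ds] to
    [Delta (s^-1) ds] ([haar_inversion]), so that the adjoint of the operator of
    [f] is the operator of [Cc_star Delta f]; the involution of [Cc] is thus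
    isometric and extends to [A].  Conversely, an involutive representation is
    automatically contractive ([involutive_contractive]), because [1 - t a^* a]
    has a self-adjoint square root when [t |a|^2 < 1].  It therefore comes from a
    representation in [RR], which is unitary.

    The functions to be integrated are all continuous with compact support.  For
    them the Bochner integral is within [e mu(C)] of each Riemann sum over a
    tagged partition of [C] on whose sets the function varies by at most [e]
    ([bochner_integral_approx]).  Linearity, the behaviour under bounded maps and
    translations, and Fubini's theorem are then properties of finite sums. *)

Set Implicit Arguments.
Unset Strict Implicit.
Unset Printing Implicit Defensive.

Import Order.TTheory GRing.Theory Num.Theory.
Import numFieldNormedType.Exports.

Local Open Scope classical_set_scope.
Local Open Scope ring_scope.

Local Notation space := Defs.space.
Local Notation nondegenerate := Defs.nondegenerate.

(** * Scalars and real-valued norms *)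

Section scalars.
Context {R : realType} {k : scalars}.
Local Notation K := (scalar_field R k).
Local Notation "a %:K" := (scalar_of_real k a) (at level 2, format "a %:K").
Local Notation Re := (@scalar_Re R k).
Local Notation cj := (@scalar_conj R k).

Lemma of_real_is_additive : {morph (@scalar_of_real R k) : x y / x - y}.
Proof. by case: k => x y //=; apply/eqP; rewrite eq_complex /= subrr !eqxx. Qed.
Lemma of_real_is_monoid : monoid_morphism (@scalar_of_real R k).
Proof.
by case: k; split=> //= x y; apply/eqP; rewrite eq_complex /= !mulr0 !mul0r ?subr0 ?addr0 !eqxx.
Qed.
HB.instance Definition _ := GRing.isZmodMorphism.Build R K (@scalar_of_real R k) of_real_is_additive.
HB.instance Definition _ := GRing.isMonoidMorphism.Build R K (@scalar_of_real R k) of_real_is_monoid.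

Lemma Re_is_additive : {morph (@scalar_Re R k) : x y / x - y}.
Proof. by case: k => //= -[a b] [c d]. Qed.
HB.instance Definition _ := GRing.isZmodMorphism.Build K R (@scalar_Re R k) Re_is_additive.

Lemma conj_is_additive : {morph (@scalar_conj R k) : x y / x - y}.
Proof. by case: k => //= x y; rewrite rmorphB. Qed.
Lemma conj_is_monoid : monoid_morphism (@scalar_conj R k).
Proof. by case: k => //=; split=> [|x y]; rewrite ?rmorph1 ?rmorphM. Qed.
HB.instance Definition _ := GRing.isZmodMorphism.Build K K (@scalar_conj R k) conj_is_additive.
HB.instance Definition _ := GRing.isMonoidMorphism.Build K K (@scalar_conj R k) conj_is_monoid.

Lemma scalar_conjK : involutive cj.
Proof. by case: k => //= -[a b] /=; rewrite opprK. Qed.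

Lemma Re_of_real (a : R) : Re a%:K = a. Proof. by case: k. Qed.
Lemma conj_of_real (a : R) : cj a%:K = a%:K.
Proof. by case: k => //=; rewrite oppr0. Qed.
(** A positive complex number is real, so norms can be compared in [R]. *)
Lemma ge0_of_real (z : K) : 0 <= z -> z = (Re z)%:K.
Proof. by case: k z => //= -[a b]; rewrite lecE /= => /andP[/eqP-> _]. Qed.
Lemma ler_of_real (a b : R) : (a%:K <= b%:K) = (a <= b).
Proof. by case: k => //=; rewrite lecE /= eqxx. Qed.
Lemma ltr_of_real (a b : R) : (a%:K < b%:K) = (a < b).
Proof. by case: k => //=; rewrite ltcE /= eqxx. Qed.
Lemma norm_of_real (a : R) : `|a%:K| = `|a|%:K.
Proof.
case: k => //; apply: etrans (normc_def _) _.
by rewrite /= expr0n /= addr0 sqrtr_sqr.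
Qed.
Lemma norm_conj (z : K) : `|cj z| = `|z|.
Proof.
case: k z => // -[a b]; apply: etrans (normc_def _) _; apply/esym.
by apply: etrans (normc_def _) _; rewrite /= sqrrN.
Qed.
Lemma Re_le_norm (z : K) : `|Re z| <= Re `|z|.
Proof.
case: k z => // -[a b].
have -> : `|(a +i* b)%C| = (Num.sqrt (a ^+ 2 + b ^+ 2))%:C%C by exact: normc_def.
rewrite /=.
by rewrite -sqrtr_sqr ler_wsqrtr // lerDl sqr_ge0.
Qed.
Lemma mulr_of_real_Re (a : R) z : Re (a%:K * z) = a * Re z.
Proof. by case: k z => //= -[b c] /=; rewrite mul0r subr0. Qed.
Lemma mul_conj (z : K) : z * cj z = `|z| ^+ 2.
Proof.
case: k z => [z|[a b]] /=; first by rewrite -expr2 real_normK// num_real.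
rewrite sqr_normc //.
Qed.

Section rnorm.
Context {X : normedModType K}.
Implicit Types x y z : X.

Lemma norm_rnorm x : `|x| = (rnorm x)%:K.
Proof. exact: ge0_of_real. Qed.
Lemma rnorm_ge0 x : 0 <= rnorm x.
Proof. by rewrite -ler_of_real -norm_rnorm rmorph0 normr_ge0. Qed.
Lemma rnorm0 : rnorm (0 : X) = 0.
Proof. by rewrite /rnorm normr0 raddf0. Qed.
Lemma rnorm0_eq0 x : rnorm x = 0 -> x = 0.
Proof. by move=> h; apply/normr0_eq0; rewrite norm_rnorm h rmorph0. Qed.
Lemma rnormN x : rnorm (- x) = rnorm x.
Proof. by rewrite /rnorm normrN. Qed.
Lemma rdistC x y : rnorm (x - y) = rnorm (y - x).
Proof. by rewrite -rnormN opprB. Qed.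
Lemma rnormD x y : rnorm (x + y) <= rnorm x + rnorm y.
Proof. by rewrite -ler_of_real rmorphD /= -!norm_rnorm ler_normD. Qed.
Lemma rdist_triangle z x y : rnorm (x - y) <= rnorm (x - z) + rnorm (z - y).
Proof. by have := rnormD (x - z) (z - y); rewrite addrA subrK. Qed.
Lemma rnorm_tri x y : rnorm x <= rnorm (x - y) + rnorm y.
Proof. by have := rnormD (x - y) y; rewrite subrK. Qed.
Lemma rnormZr (a : R) x : rnorm (a%:K *: x) = `|a| * rnorm x.
Proof. by rewrite {1}/rnorm normrZ norm_of_real mulr_of_real_Re. Qed.
Lemma rnormZ_ge0 (a : R) x : 0 <= a -> rnorm (a%:K *: x) = a * rnorm x.
Proof. by move=> ?; rewrite rnormZr ger0_norm. Qed.
Lemma rnormZ (c : K) x : rnorm (c *: x) = rnorm (c : K^o) * rnorm x.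
Proof. by rewrite {1}/rnorm normrZ (ge0_of_real (normr_ge0 c)) mulr_of_real_Re. Qed.
Lemma rnorm_sum I (s : seq I) (F : I -> X) :
  rnorm (\sum_(i <- s) F i) <= \sum_(i <- s) rnorm (F i).
Proof.
elim: s => [|i s ih]; first by rewrite !big_nil rnorm0.
by rewrite !big_cons (le_trans (rnormD _ _))// lerD2l.
Qed.

(** The free constant [C] absorbs the multiples of [e] that estimates leave. *)
Lemma rnorm_eps_eq x y (C : R) : (forall e, 0 < e -> rnorm (x - y) <= C * e) -> x = y.
Proof.
move=> h; apply/eqP; rewrite -subr_eq0; apply/eqP/rnorm0_eq0/eqP.
rewrite eq_le rnorm_ge0 andbT; apply/ler_addgt0Pr => e e0; rewrite add0r.
have C0 : 0 < `|C| + 1 by rewrite ltr_pwDr.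
apply: (le_trans (h (e / (`|C| + 1)) _)); first by rewrite divr_gt0.
rewrite mulrCA ger_pMr// ler_pdivrMr// mul1r.
by rewrite (le_trans (ler_norm _))// lerDl.
Qed.

Lemma nbhs_rnormP x (P : set X) :
  nbhs x P <-> exists2 e : R, 0 < e & forall y, rnorm (y - x) < e -> P y.
Proof.
split.
  move=> /nbhs_normP[e /= e0 he]; exists (Re e).
    by rewrite -ltr_of_real rmorph0 -ge0_of_real// ltW.
  move=> y hy; apply: he => /=; rewrite distrC norm_rnorm.
  by rewrite (ge0_of_real (ltW e0)) ltr_of_real.
move=> [e e0 he]; apply/nbhs_normP; exists e%:K => /=.
  by rewrite -(rmorph0 (@scalar_of_real R k)) /= ltr_of_real.
move=> y; rewrite /= -opprB normrN norm_rnorm ltr_of_real; exact: he.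
Qed.

Lemma closure_rnormP (L : set X) x :
  closure L x <-> forall e : R, 0 < e -> exists2 y, L y & rnorm (y - x) < e.
Proof.
split=> [h e e0|h P /nbhs_rnormP[e e0 he]].
  have /h[y [Ly /= hy]] : nbhs x [set y | rnorm (y - x) < e].
    by apply/nbhs_rnormP; exists e.
  by exists y.
by have [y Ly hy] := h _ e0; exists y; split=> //; apply: he.
Qed.

Lemma closed_rnorm (L : set X) x (C : R) : closed L ->
  (forall e : R, 0 < e -> exists2 y, L y & rnorm (y - x) <= C * e) -> L x.
Proof.
move=> cL h; apply: cL; apply/closure_rnormP => e e0.
have C0 : 0 < `|C| + 1 by rewrite ltr_pwDr.
have e1 : 0 < e / (`|C| + 1) by rewrite divr_gt0.
have [y Ly hy] := h _ e1; exists y => //.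
apply: (le_lt_trans hy); rewrite mulrCA -[ltRHS]mulr1 ltr_pM2l//.
rewrite ltr_pdivrMr// mul1r (le_lt_trans (ler_norm _))//.
by rewrite ltrDl.
Qed.

Lemma dense_rnormP (D : set X) :
  dense D <-> forall x (e : R), 0 < e -> exists2 y, D y & rnorm (y - x) < e.
Proof.
split=> [dD x e e0|h O [x Ox] oO].
  have nb : nbhs x [set y | rnorm (y - x) < e] by apply/nbhs_rnormP; exists e.
  have [|y [/interior_subset/= hy Dy]] := dD _ _ (open_interior [set y : X | rnorm (y - x) < e]).
    by exists x; exact: nb.
  by exists y.
have /nbhs_rnormP[e e0 he] := open_nbhs_nbhs (conj oO Ox).
by have [y Dy hy] := h x e e0; exists y; split=> //; apply: he.
Qed.

End rnorm.

Lemma rnorm_of_real (a : R) : rnorm (a%:K : K^o) = `|a|.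
Proof. by rewrite /rnorm norm_of_real Re_of_real. Qed.
Lemma rnorm_conj (c : K) : rnorm (cj c : K^o) = rnorm (c : K^o).
Proof. by rewrite /rnorm norm_conj. Qed.

Lemma continuous_rnormP (T : topologicalType) (X : normedModType K) (g : T -> X) :
  continuous g <-> forall t (e : R), 0 < e -> nbhs t [set s | rnorm (g s - g t) < e].
Proof.
split=> h t.
  move=> e e0; apply: (h t [set y | rnorm (y - g t) < e]).
  by apply/nbhs_rnormP; exists e.
move=> P /nbhs_rnormP[e e0 he]; apply: filterS (h t e e0) => s /=; exact: he.
Qed.
End scalars.
Arguments rnorm_eps_eq {R k X x y} C.
Arguments closed_rnorm {R k X L x} C.
Notation "a %:K" := (scalar_of_real _ a) (at level 2, format "a %:K").

(** * Completeness, extension by continuity, bounded operators *)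

Section completeness.
Context {R : realType} {k : scalars}.
Local Notation K := (scalar_field R k).

(** Cauchy completeness with sets of candidates indexed by their precision, which
    suits limits of Riemann sums and extensions by continuity.  Being a predicate
    on normed spaces, it applies to the scalar field as well as to Banach
    spaces. *)
Definition family_complete (X : normedModType K) :=
  forall (S : R -> set X) (C : R), 0 <= C ->
    (forall e, 0 < e -> S e !=set0) ->
    (forall e e' a b, 0 < e -> 0 < e' -> S e a -> S e' b -> rnorm (a - b) <= C * (e + e')) ->
  exists y, forall e a, 0 < e -> S e a -> rnorm (a - y) <= C * e.

(** A crude rate [D] for some approximations gives the sharp rate [C] for all of
    them. *)
Lemma family_complete_weaken (X : normedModType K) (S : R -> set X) (C D : R) y :
  0 <= C -> 0 <= D ->
  (forall e, 0 < e -> S e !=set0) ->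
  (forall e e' a b, 0 < e -> 0 < e' -> S e a -> S e' b -> rnorm (a - b) <= C * (e + e')) ->
  (forall e, 0 < e -> exists2 b, S e b & rnorm (b - y) <= D * e) ->
  forall e a, 0 < e -> S e a -> rnorm (a - y) <= C * e.
Proof.
move=> C0 D0 Sn Sc hy e a e0 Sa; apply/ler_addgt0Pr => d d0.
have CD : 0 < C + D + 1 by rewrite ltr_pwDr// addr_ge0.
have e1 : 0 < d / (C + D + 1) by rewrite divr_gt0.
have [b Sb hb] := hy _ e1.
apply: (le_trans (rdist_triangle b _ _)).
apply: (le_trans (lerD (Sc _ _ _ _ e0 e1 Sa Sb) hb)).
rewrite mulrDr -addrA lerD2l -mulrDl mulrCA ger_pMr// ler_pdivrMr// mul1r.
by rewrite lerDl.
Qed.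

Lemma banach_family_complete (X : completeNormedModType K) : family_complete X.
Proof.
move=> S C C0 Sn Sc.
pose ee (n : nat) : R := n.+1%:R^-1.
have ee0 n : 0 < ee n by rewrite invr_gt0.
pose u n := xget 0 (S (ee n)).
have uS n : S (ee n) (u n) by have [x Sx] := Sn _ (ee0 n); apply: (xgetI 0 Sx).
have small d : 0 < d -> exists N, forall n, (N <= n)%N -> ee n < d.
  by move=> d0; have [N _ hN] := near_infty_natSinv_lt (PosNum d0); exists N.
have uc : cauchy (u @ \oo).
  apply/cauchyP => /= e e0.
  have e0' : 0 < scalar_Re e by rewrite -(@ltr_of_real R k) rmorph0 -ge0_of_real// ltW.
  have CC : 0 < (C + 1) * 2 by rewrite mulr_gt0// ltr_pwDr.
  have [N hN] := small (scalar_Re e / ((C + 1) * 2)) (divr_gt0 e0' CC).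
  exists (u N); exists N => // n /= Nn.
  rewrite -ball_normE /= norm_rnorm (ge0_of_real (ltW e0)) ltr_of_real.
  apply: (le_lt_trans (Sc _ _ _ _ (ee0 _) (ee0 _) (uS _) (uS _))).
  have := hN _ (leqnn N); have := hN _ Nn.
  rewrite !ltr_pdivlMr// => h1 h2.
  have := ee0 n; have := ee0 N; nra.
have /cauchy_cvg/cvg_ex[/= y hy] := uc.
exists y; apply: (@family_complete_weaken X S C (C * 2 + 1)) => //.
  by rewrite addr_ge0// mulr_ge0.
move=> e e0.
have : nbhs y [set z | rnorm (z - y) < e] by apply/nbhs_rnormP; exists e.
move=> /hy[N1 _ h1]; have [N2 h2] := small e e0.
have [b Sb] := Sn _ e0; exists b => //.
pose n := maxn N1 N2.
have := h1 n (leq_maxl _ _) => /= hu.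
apply: (le_trans (rdist_triangle (u n) _ _)).
have := Sc _ _ _ _ e0 (ee0 n) Sb (uS n).
have h3 := h2 n (leq_maxr _ _); have h4 := ee0 n => h5.
have : C * (e + ee n) <= C * (e + e) by rewrite ler_wpM2l// lerD2l ltW.
lra.
Qed.

End completeness.

Section extension.
Context {R : realType} {k : scalars}.
Local Notation K := (scalar_field R k).

Lemma Im_le_norm (z : scalar_field R ComplexScalars) :
  `|complex.Im (z : R[i])| <= scalar_Re `|z|.
Proof.
case: z => a b.
have -> : `|(a +i* b)%C| = (Num.sqrt (a ^+ 2 + b ^+ 2))%:C%C by exact: normc_def.
by rewrite /= -sqrtr_sqr ler_wsqrtr // lerDr sqr_ge0.
Qed.

Lemma norm_le_Re_Im (z : scalar_field R ComplexScalars) :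
  scalar_Re `|z| <= `|scalar_Re z| + `|complex.Im (z : R[i])|.
Proof.
case: z => a b.
have -> : `|(a +i* b)%C| = (Num.sqrt (a ^+ 2 + b ^+ 2))%:C%C by exact: normc_def.
rewrite /= -[leRHS]ger0_norm ?addr_ge0// -sqrtr_sqr ler_wsqrtr// sqrrD.
by rewrite !real_normK ?num_real// lerD2r lerDl mulrn_wge0// mulr_ge0.
Qed.

(** Real and imaginary parts converge separately.  This doubles the constant,
    which [family_complete_weaken] repairs. *)
Lemma scalar_family_complete : family_complete (K^o : normedModType K).
Proof.
move=> S C C0 Sn Sc.
have real_limit (f : K -> R) : (forall a b, `|f a - f b| <= rnorm (a - b : K^o)) ->
    exists y, forall e a, 0 < e -> S e a -> `|f a - y| <= C * e.
  move=> hf.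
  have [||y hy] := @banach_family_complete R RealScalars R (fun e => f @` S e) C C0.
  - by move=> e /Sn[a Sa]; exists (f a), a.
  - move=> e e' _ _ e0 e0' [a Sa <-] [b Sb <-].
    by apply: le_trans (Sc _ _ _ _ e0 e0' Sa Sb); exact: hf.
  by exists y => e a e0 Sa; apply: hy => //; exists a.
have [|y hy] := real_limit (@scalar_Re R k).
  by move=> a b; rewrite -raddfB; exact: Re_le_norm.
have [z hz] : exists z : K, forall e a, 0 < e -> S e a -> rnorm (a - z : K^o) <= C * e + C * e.
  move: S Sn Sc real_limit y hy; rewrite /rnorm; case: k => S Sn Sc real_limit y hy.
    exists y => e a e0 Sa; apply: (le_trans (hy _ _ e0 Sa)).
    by rewrite lerDl mulr_ge0// ltW.
  have [|w hw] := real_limit (@complex.Im R).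
    by move=> a b; rewrite -raddfB; exact: Im_le_norm.
  exists (y +i* w)%C => e a e0 Sa.
  have := lerD (hy _ _ e0 Sa) (hw _ _ e0 Sa).
  apply: le_trans; apply: (le_trans (norm_le_Re_Im _)).
  by rewrite !raddfB.
exists z; apply: (@family_complete_weaken R k _ S C (C + C)) => //; first exact: addr_ge0.
by move=> e e0; have [b Sb] := Sn e e0; exists b; rewrite // mulrDl; exact: hz.
Qed.

(** Extension by continuity from a dense range.  The map [i] need not be
    injective, as the Lipschitz bound makes [j] constant on its fibres. *)
Lemma lipschitz_extension (I : Type) (D : set I) (E X : normedModType K)
    (i : I -> E) (j : I -> X) (C : R) :
  family_complete X -> 0 <= C -> dense [set i d | d in D] ->
  (forall d d', D d -> D d' -> rnorm (j d - j d') <= C * rnorm (i d - i d')) ->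
  exists2 T : E -> X, (forall d, D d -> T (i d) = j d)
    & forall a b, rnorm (T a - T b) <= C * rnorm (a - b).
Proof.
move=> cX C0 /dense_rnormP dD hj.
pose S a (e : R) : set X := [set j d | d in [set d | D d /\ rnorm (i d - a) <= e]].
have lim a : exists y, forall e x, 0 < e -> S a e x -> rnorm (x - y) <= C * e.
  apply: cX => //.
    move=> e e0; have [_ [d Dd <-] hd] := dD a e e0.
    by exists (j d), d => //; split => //; exact: ltW.
  move=> e e' _ _ e0 e0' [d [Dd hd] <-] [d' [Dd' hd'] <-].
  apply: (le_trans (hj _ _ Dd Dd')); rewrite ler_wpM2l//.
  by rewrite (le_trans (rdist_triangle a _ _))// lerD// rdistC.
have [T hT] := choice lim.
exists T.
  move=> d Dd; apply/esym/(rnorm_eps_eq C) => e e0; apply: hT => //.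
  by exists d => //; split=> //; rewrite subrr rnorm0 ltW.
move=> a b; apply/ler_addgt0Pr => t t0.
have C4 : 0 < 4 * C + 1 by rewrite ltr_pwDr// mulr_ge0.
pose e := t / (4 * C + 1).
have e0 : 0 < e by rewrite divr_gt0.
have [_ [d Dd <-] hd] := dD a e e0.
have [_ [d' Dd' <-] hd'] := dD b e e0.
have h1 := hT a e (j d) e0 (ex_intro2 _ _ d (conj Dd (ltW hd)) erefl).
have h2 := hT b e (j d') e0 (ex_intro2 _ _ d' (conj Dd' (ltW hd')) erefl).
have h3 : rnorm (i d - i d') <= e + (rnorm (a - b) + e).
  apply: (le_trans (rdist_triangle a _ _)); apply: lerD; first exact: ltW.
  by apply: (le_trans (rdist_triangle b _ _)); rewrite lerD2l rdistC ltW.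
have h4 := le_trans (hj _ _ Dd Dd') (ler_wpM2l C0 h3).
have h5 : rnorm (T a - T b) <= C * e + (C * (e + (rnorm (a - b) + e)) + C * e).
  apply: (le_trans (rdist_triangle (j d) _ _)); rewrite rdistC lerD//.
  by apply: (le_trans (rdist_triangle (j d') _ _)); rewrite lerD.
have h6 : e * (4 * C + 1) = t by rewrite /e divfK// gt_eqF.
nra.
Qed.

End extension.

Section bounded_operators.
Context {R : realType} {k : scalars}.
Local Notation K := (scalar_field R k).
Context {X Y : normedModType K}.
Implicit Type T : X -> Y.

Lemma linear_map0 T : linear T -> T 0 = 0.
Proof. by move=> h; have := h (-1) 0 0; rewrite !scaleN1r oppr0 addr0 addNr. Qed.
Lemma linear_mapZ T c x : linear T -> T (c *: x) = c *: T x.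
Proof. by move=> h; have := h c x 0; rewrite (linear_map0 h) !addr0. Qed.
Lemma linear_mapD T x y : linear T -> T (x + y) = T x + T y.
Proof. by move=> h; have := h 1 x y; rewrite !scale1r. Qed.
Lemma linear_mapB T x y : linear T -> T (x - y) = T x - T y.
Proof. by move=> h; rewrite linear_mapD// -scaleN1r linear_mapZ// scaleN1r. Qed.
Lemma linear_map_sum I (s : seq I) (F : I -> X) T : linear T ->
  T (\sum_(i <- s) F i) = \sum_(i <- s) T (F i).
Proof.
move=> h; elim: s => [|a s ih]; first by rewrite !big_nil linear_map0.
by rewrite !big_cons linear_mapD// ih.
Qed.

Lemma bounded_operator_bound T : bounded_operator T ->
  exists2 M : R, 0 <= M & forall x, rnorm (T x) <= M * rnorm x.
Proof.
move=> [lT /continuous_rnormP cT]; have /nbhs_rnormP[d d0 hd] := cT 0 1 ltr01.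
exists (2 / d); first by rewrite divr_ge0// ltW.
move=> x; have [->|x0] := eqVneq x 0.
  by rewrite linear_map0// !rnorm0 mulr0.
have nx : 0 < rnorm x.
  by rewrite lt_neqAle rnorm_ge0 andbT; apply: contra_neq x0 => /esym/rnorm0_eq0.
pose c := d / (2 * rnorm x).
have c0 : 0 < c by rewrite divr_gt0// mulr_gt0.
have := hd (c%:K *: x); rewrite /= !subr0 linear_mapZ// linear_map0// subr0.
have c0' := ltW c0; rewrite !rnormZ_ge0// => h.
have : c * rnorm (T x) < 1.
  by apply: h; rewrite /c invfM mulrA mulfVK ?gt_eqF// gtr_pMr// invf_lt1// ltr1n.
rewrite -ltr_pdivlMl// => h2; apply/ltW/(lt_le_trans h2).
by rewrite mulr1 /c invf_div mulrAC.
Qed.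

Lemma bounded_operator_of_bound T (M : R) : linear T ->
  (forall x, rnorm (T x) <= M * rnorm x) -> bounded_operator T.
Proof.
move=> lT hM; split=> //; apply/continuous_rnormP => x e e0; apply/nbhs_rnormP.
have M0 : 0 < `|M| + 1 by rewrite ltr_pwDr.
exists (e / (`|M| + 1)); first by rewrite divr_gt0.
move=> y hy; rewrite /= -linear_mapB//; apply: (le_lt_trans (hM _)).
move: hy; rewrite ltr_pdivlMr//; apply: le_lt_trans.
rewrite mulrC ler_wpM2l ?rnorm_ge0// (le_trans (ler_norm _))//.
by rewrite lerDl.
Qed.

Lemma opnorm_has_sup T : bounded_operator T ->
  has_sup [set rnorm (T x) | x in [set x | rnorm x <= 1]].
Proof.
move=> bT; have [M M0 hM] := bounded_operator_bound bT; split.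
  by exists (rnorm (T 0)), 0 => //=; rewrite rnorm0.
exists M => _ [x /= x1 <-]; apply: (le_trans (hM _)).
by rewrite -[leRHS]mulr1 ler_wpM2l.
Qed.

Lemma opnorm_bound T x : bounded_operator T -> rnorm (T x) <= opnorm T * rnorm x.
Proof.
move=> bT; have [lT _] := bT.
have [->|x0] := eqVneq x 0; first by rewrite linear_map0// !rnorm0 mulr0.
have nx : 0 < rnorm x.
  by rewrite lt_neqAle rnorm_ge0 andbT; apply: contra_neq x0 => /esym/rnorm0_eq0.
rewrite -ler_pdivrMr// mulrC -rnormZ_ge0 ?invr_ge0 ?rnorm_ge0// -linear_mapZ//.
apply: ub_le_sup; first exact: (opnorm_has_sup bT).2.
exists ((rnorm x)^-1%:K *: x) => //=.
by rewrite rnormZ_ge0 ?invr_ge0 ?rnorm_ge0// mulVf// gt_eqF.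
Qed.

Lemma opnorm_le T (M : R) : 0 <= M -> (forall x, rnorm (T x) <= M * rnorm x) ->
  opnorm T <= M.
Proof.
move=> M0 hM; apply: ge_sup.
  by exists (rnorm (T 0)), 0 => //=; rewrite rnorm0.
move=> _ [x /= x1 <-]; apply: (le_trans (hM _)).
by rewrite -[leRHS]mulr1 ler_wpM2l.
Qed.

End bounded_operators.

(** * Riemann sums for the vector-valued integral *)

Section riemann_sums.
Context {R : realType} {k : scalars} {G : topGroupType}.
Variable mu : {measure set (borel G) -> \bar R}.
Local Notation K := (scalar_field R k).
Local Notation borel_set A := (measurable (A : set (borel G))).
Local Notation m A := (fine (mu A)).

Lemma open_borel (A : set G) : open A -> borel_set A.
Proof. by move=> oA; apply: sub_sigma_algebra. Qed.
Lemma closed_borel (A : set G) : closed A -> borel_set A.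
Proof. by move=> cA; rewrite -(setCK A); apply: measurableC; apply: open_borel; exact: closed_openC. Qed.

(** Each set is removed from what remains to be covered, which makes the sets
    disjoint and suits proofs by induction.  The tag [p.2] may lie outside its
    set [p.1]; it controls it through the gauge [N]. *)
Fixpoint tagged_partition (N : G -> set G) (D : set G) (P : seq (set G * G)) : Prop :=
  match P with
  | [::] => D = set0
  | p :: P' => [/\ borel_set p.1, p.1 `<=` D, p.1 `<=` N p.2
                 & tagged_partition N (D `\` p.1) P']
  end.

(** Compactness gives finitely many interiors of sets [N r] that cover [C]; each
    set of the partition is the part of [C] that its interior covers first. *)
Lemma tagged_partition_exists (N : G -> set G) (C : set G) :
  compact C -> borel_set C -> (forall r, C r -> nbhs r (N r)) ->
  exists P, tagged_partition N C P.
Proof.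
move=> cC mC hN.
have [D' _ hD'] : finite_subset_cover C (fun r => (N r)°) C.
  move: cC; rewrite compact_cover; apply; first by move=> i _; exact: open_interior.
  by move=> x Cx; exists x => //; exact: hN.
have {hD'} : forall x, C x -> exists2 r, r \in (finmap.enum_fset D') & (N r)° x.
  by move=> x /hD'[r /= rD' Nx]; exists r.
move: (finmap.enum_fset D') => l {D' cC hN}.
elim: l C mC => [|r l ih] C mC hl.
  by exists [::]; apply/seteqP; split=> // x /hl[].
have mN : borel_set (C `&` (N r)°) by apply: measurableI => //; apply: open_borel; exact: open_interior.
have [|x [Cx nNx]|P hP] := ih (C `\` (C `&` (N r)°)).
- exact: measurableD.
- have [s] := hl x Cx; rewrite inE => /orP[/eqP->|sl] Nx; last by exists s.
  by exfalso; apply: nNx.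
exists ((C `&` (N r)°, r) :: P) => /=; split=> //.
by move=> x [_ /interior_subset].
Qed.


Lemma measure_finite_sub (A B : set G) : borel_set A -> borel_set B -> A `<=` B ->
  (mu B < +oo)%E -> (mu A < +oo)%E.
Proof. by move=> mA mB AB; apply: le_lt_trans; apply: le_measure; rewrite ?inE. Qed.

Lemma fineK_measure (A : set G) : (mu A < +oo)%E -> ((m A)%:E = mu A)%E.
Proof. by move=> h; rewrite fineK// ge0_fin_numE. Qed.

Lemma fine_measure_ge0 (A : set G) : 0 <= m A.
Proof. by rewrite fine_ge0. Qed.

Lemma fine_measureDI (A B : set G) : borel_set A -> borel_set B -> (mu A < +oo)%E ->
  m A = m (A `&` B) + m (A `\` B).
Proof.
move=> mA mB Afin; rewrite (measureDI mu mA mB) fineD 1?addrC//.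
  rewrite ge0_fin_numE//; apply: (@measure_finite_sub _ A) => //; first exact: measurableD.
rewrite ge0_fin_numE//; apply: (@measure_finite_sub _ A) => //; exact: measurableI.
Qed.

Section vector_valued.
Context {X : normedModType K}.
Implicit Type g : G -> X.

Lemma simple_value_cons (p : set (borel G) * X) s (x : G) :
  simple_value (p :: s) x = (\1_(p.1) x : K) *: p.2 + simple_value s x.
Proof. by rewrite /simple_value big_cons. Qed.

(** The first set of the list splits the domain into two parts, on each of which
    it only shifts [g] by a constant. *)
Lemma measurable_dist_simple g (s : seq (set (borel G) * X)) (D : set (borel G)) :
  continuous g -> (forall p, p \in s -> measurable p.1) -> measurable D ->
  measurable_fun D (fun x => rnorm (g x - simple_value s x)).
Proof.
elim: s g D => [|p s ih] g D cg ms mD.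
  apply: (@measurable_funS _ _ _ _ setT) => //.
  apply: (measurability _ (measurable_realfun.RGenOInfty.measurableE R)) => _ [_ [a ->] <-].
  rewrite setTI; apply: open_borel; rewrite openE => x /=.
  rewrite in_itv /= andbT /simple_value big_nil subr0 => ax.
  have e0 : 0 < rnorm (g x) - a by rewrite subr_gt0.
  have := (continuous_rnormP _).1 cg x _ e0; apply: filterS => y /=.
  rewrite in_itv /= andbT /simple_value big_nil subr0 => h.
  have := rnorm_tri (g x) (g y); rewrite rdistC => h2.
  by rewrite -(ltrD2l (rnorm (g y - g x))); apply: lt_le_trans h2; rewrite -ltrBrDr.
have mp : measurable p.1 by apply: ms; rewrite mem_head.
have ms' q : q \in s -> measurable q.1 by move=> qs; apply: ms; rewrite inE qs orbT.
have -> : D = (D `&` p.1) `|` (D `\` p.1) by rewrite setUIDK.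
apply/measurable_funU; [exact: measurableI|exact: measurableD|split].
  apply: (eq_measurable_fun (fun x : borel G => rnorm ((g x - p.2) - simple_value s x))).
    move=> x /set_mem[_ px]; rewrite simple_value_cons indicE mem_set//.
    by rewrite scale1r opprD addrA.
  apply: ih => //; last exact: measurableI.
  move=> x; apply: (@cvgB _ X); [exact: cg|exact: cvg_cst].
apply: (eq_measurable_fun (fun x : borel G => rnorm (g x - simple_value s x))).
  move=> x /set_mem[_ px]; rewrite simple_value_cons indicE memNset//.
  by rewrite scale0r add0r.
by apply: ih => //; exact: measurableD.
Qed.

Lemma measurable_dist_simpleE g (s : seq (set (borel G) * X)) (D : set (borel G)) :
  continuous g -> (forall p, p \in s -> measurable p.1) -> measurable D ->
  measurable_fun D (fun x => (rnorm (g x - simple_value s x))%:E).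
Proof. by move=> *; apply/measurable_EFinP; exact: measurable_dist_simple. Qed.

(** A value [c] constant on [D] is carried along, so that each set of the list
    splits the domain in two and the sets of the list may overlap. *)
Lemma simple_integral_L1 (s : seq (set (borel G) * X)) (D : set (borel G)) (c : X) :
  (forall p, p \in s -> measurable p.1) -> measurable D -> (mu D < +oo)%E ->
  ((rnorm ((m D)%:K *: c + \sum_(p <- s) (m (p.1 `&` D))%:K *: p.2))%:E <=
   \int[mu]_(x in D) (rnorm (c + simple_value s x))%:E)%E.
Proof.
have opp x (s' : seq (set (borel G) * X)) (c' : X) :
    rnorm (c' + simple_value s' x) = rnorm (- c' - simple_value s' x).
  by rewrite -rnormN opprD.
elim: s D c => [|p s ih] D c ms mD Dfin.
  rewrite big_nil addr0 rnormZ_ge0 ?fine_measure_ge0// EFinM fineK_measure//.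
  under eq_integral do rewrite /simple_value big_nil addr0.
  by rewrite integral_cst// muleC.
have mp : measurable p.1 by apply: ms; rewrite mem_head.
have ms' q : q \in s -> measurable q.1 by move=> qs; apply: ms; rewrite inE qs orbT.
have mDp : measurable (D `&` p.1) by exact: measurableI.
have mDp' : measurable (D `\` p.1) by exact: measurableD.
have Dpfin : (mu (D `&` p.1) < +oo)%E by apply: (measure_finite_sub mDp mD).
have Dpfin' : (mu (D `\` p.1) < +oo)%E by apply: (measure_finite_sub mDp' mD).
have -> : (\int[mu]_(x in D) (rnorm (c + simple_value (p :: s) x))%:E =
   \int[mu]_(x in D `&` p.1) (rnorm ((c + p.2) + simple_value s x))%:E +
   \int[mu]_(x in D `\` p.1) (rnorm (c + simple_value s x))%:E)%E.
  rewrite -{1}(setUIDK D p.1) ge0_integral_setU//.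
  - congr (_ + _)%E; apply: eq_integral => x /set_mem[_ px].
      by rewrite simple_value_cons indicE mem_set// scale1r addrA.
    by rewrite simple_value_cons indicE memNset// scale0r add0r.
  - rewrite setUIDK; apply: (eq_measurable_fun (fun x : borel G => (rnorm (- c - simple_value (p :: s) x))%:E)).
      by move=> x _; rewrite opp.
    apply: measurable_dist_simpleE => // x; exact: cvg_cst.
  - by move=> x _; rewrite lee_fin rnorm_ge0.
  - by rewrite disj_set2E setDE setIACA setICr setI0.
apply: le_trans (leeD (ih _ (c + p.2) ms' mDp Dpfin) (ih _ c ms' mDp' Dpfin')).
rewrite -EFinD lee_fin big_cons; apply: le_trans (rnormD _ _).
have msplit q : q \in s ->
   m (q.1 `&` D) = m (q.1 `&` (D `&` p.1)) + m (q.1 `&` (D `\` p.1)).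
  move=> qs; rewrite (@fine_measureDI (q.1 `&` D) p.1)//.
  - by rewrite setIA setIDA.
  - by apply: measurableI => //; exact: ms'.
  - by apply: (@measure_finite_sub _ D) => //; apply: measurableI => //; exact: ms'.
have -> : \sum_(q <- s) (m (q.1 `&` D))%:K *: q.2 =
   \sum_(q <- s) (m (q.1 `&` (D `&` p.1)))%:K *: q.2 +
   \sum_(q <- s) (m (q.1 `&` (D `\` p.1)))%:K *: q.2.
  rewrite -big_split; apply: eq_big_seq => q qs.
  by rewrite msplit// rmorphD scalerDl.
rewrite (@fine_measureDI D p.1)// rmorphD scalerDl scalerDr [p.1 `&` D]setIC.
rewrite le_eqVlt; apply/orP; left; apply/eqP; congr rnorm.
rewrite -!addrA; congr (_ + _); rewrite [LHS]addrCA; congr (_ + _).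
by rewrite [LHS]addrCA.
Qed.

Lemma simple_integral_le (s : seq (set (borel G) * X)) :
  (forall p, p \in s -> measurable p.1 /\ (mu p.1 < +oo)%E) ->
  ((rnorm (simple_integral mu s))%:E <= \int[mu]_x (rnorm (simple_value s x))%:E)%E.
Proof.
move=> hs.
have [D [mD Dfin hD]] : exists D : set (borel G),
    [/\ measurable D, (mu D < +oo)%E & forall p, p \in s -> p.1 `<=` D].
  elim: s hs => [_|p s ih hs]; first by exists set0; split=> //; rewrite measure0 ltry.
  have [|D [mD Dfin hD]] := ih; first by move=> q qs; apply: hs; rewrite inE qs orbT.
  have [mp pfin] := hs p (mem_head _ _).
  exists (p.1 `|` D); split; first exact: measurableU.
    apply: le_lt_trans (measureU2 mu mp mD) _; exact: lte_add_pinfty.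
  move=> q; rewrite inE => /orP[/eqP->|/hD qD] x qx; first by left.
  by right; exact: qD.
have ms p : p \in s -> measurable p.1 by move=> /hs[].
have := @simple_integral_L1 s D 0 ms mD Dfin; rewrite scaler0 add0r.
have -> : \sum_(p <- s) (m (p.1 `&` D))%:K *: p.2 = simple_integral mu s.
  by apply: eq_big_seq => p ps; rewrite (setIidl (hD p ps)).
move/le_trans; apply.
under eq_integral do rewrite add0r.
apply: ge0_subset_integral => //; last by move=> x _; rewrite lee_fin rnorm_ge0.
apply: (eq_measurable_fun (fun x : borel G => (rnorm ((fun=> 0) x - simple_value s x))%:E)).
  by move=> x _; rewrite sub0r rnormN.
by apply: measurable_dist_simpleE => // x; exact: cvg_cst.
Qed.

(** Both the uniqueness of the Bochner integral and the convergence of Riemann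
    sums rest on this comparison. *)
Lemma simple_integral_dist g (s s' : seq (set (borel G) * X)) (e e' : R) :
  continuous g ->
  (forall p, p \in s -> measurable p.1 /\ (mu p.1 < +oo)%E) ->
  (forall p, p \in s' -> measurable p.1 /\ (mu p.1 < +oo)%E) ->
  (\int[mu]_x (rnorm (g x - simple_value s x))%:E <= e%:E)%E ->
  (\int[mu]_x (rnorm (g x - simple_value s' x))%:E <= e'%:E)%E ->
  rnorm (simple_integral mu s - simple_integral mu s') <= e + e'.
Proof.
move=> cg hs hs' he he'.
pose t : seq (set (borel G) * X) := s ++ [seq (p.1, - p.2) | p <- s'].
have tv x : simple_value t x = simple_value s x - simple_value s' x.
  rewrite /simple_value big_cat big_map /=; congr (_ + _).
  by rewrite -sumrN; apply: eq_bigr => p _; rewrite scalerN.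
have ti : simple_integral mu t = simple_integral mu s - simple_integral mu s'.
  rewrite /simple_integral big_cat big_map /=; congr (_ + _).
  by rewrite -sumrN; apply: eq_bigr => p _; rewrite scalerN.
have ht p : p \in t -> measurable p.1 /\ (mu p.1 < +oo)%E.
  by rewrite mem_cat => /orP[/hs//|/mapP[q /hs' hq ->]].
rewrite -lee_fin -ti; apply: le_trans (simple_integral_le ht) _.
have msr (u : seq (set (borel G) * X)) :
    (forall p, p \in u -> measurable p.1 /\ (mu p.1 < +oo)%E) ->
    measurable_fun [set: borel G] (fun x => (rnorm (g x - simple_value u x))%:E).
  by move=> hu; apply: measurable_dist_simpleE => // p /hu[].
rewrite EFinD; apply: le_trans (leeD he he').
rewrite -ge0_integralD//; try by [exact: msr|move=> x _; rewrite lee_fin rnorm_ge0].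
apply: ge0_le_integral => //; first by move=> x _; rewrite lee_fin rnorm_ge0.
- apply: (eq_measurable_fun (fun x : borel G => (rnorm ((fun=> 0) x - simple_value t x))%:E)).
    by move=> x _; rewrite sub0r rnormN.
  apply: measurable_dist_simpleE => //; last by move=> p /ht[].
  by move=> x; exact: cvg_cst.
- by apply: emeasurable_funD; exact: msr.
- move=> x _; rewrite -EFinD lee_fin tv.
  by rewrite (le_trans (rdist_triangle (g x) _ _))// rdistC.
Qed.

Definition riemann_sum (P : seq (set G * G)) g : X := \sum_(p <- P) (m p.1)%:K *: g p.2.

Definition tagged_simple (P : seq (set G * G)) g : seq (set (borel G) * X) :=
  [seq (p.1 : set (borel G), g p.2) | p <- P].

Lemma tagged_simple_integral P g : simple_integral mu (tagged_simple P g) = riemann_sum P g.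
Proof. by rewrite /simple_integral big_map. Qed.

Lemma tagged_simple_value_out g N D P (x : G) :
  tagged_partition N D P -> ~ D x -> simple_value (tagged_simple P g) x = 0.
Proof.
elim: P D => [|p P ih] D /=; first by rewrite /simple_value big_nil.
move=> [_ pD _ hP] Dx; rewrite simple_value_cons indicE memNset; last by move/pD.
by rewrite scale0r add0r; apply: ih hP _ => -[].
Qed.

Lemma tagged_simple_value_in g N D P (x : G) :
  tagged_partition N D P -> D x ->
  exists2 r, N r x & simple_value (tagged_simple P g) x = g r.
Proof.
elim: P D => [|p P ih] D /=; first by move=> ->.
move=> [_ pD pN hP] Dx; rewrite simple_value_cons indicE.
have [px|px] := pselect (p.1 x).
  exists p.2; first exact: pN.
  by rewrite mem_set// scale1r (tagged_simple_value_out g hP) ?addr0// => -[].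
by rewrite memNset// scale0r add0r; exact: (ih _ hP).
Qed.

Lemma tagged_partition_measurable N D P : tagged_partition N D P -> borel_set D ->
  (mu D < +oo)%E -> forall p, p \in P -> borel_set p.1 /\ (mu p.1 < +oo)%E.
Proof.
elim: P D => //= p P ih D [mp pD _ hP] mD Dfin q; rewrite inE => /orP[/eqP->|].
  by split=> //; exact: (measure_finite_sub mp mD).
apply: (ih _ hP); first exact: measurableD.
by apply: (measure_finite_sub _ mD) => //; exact: measurableD.
Qed.

Definition oscillation g (N : G -> set G) (D : set G) (e : R) :=
  forall r x, D x -> N r x -> rnorm (g x - g r) <= e.

Lemma tagged_simple_L1 g N D P e : continuous g -> (forall x, ~ D x -> g x = 0) ->
  borel_set D -> (mu D < +oo)%E -> 0 <= e ->
  tagged_partition N D P -> oscillation g N D e ->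
  (\int[mu]_x (rnorm (g x - simple_value (tagged_simple P g) x))%:E <= (e * m D)%:E)%E.
Proof.
move=> cg g0 mD Dfin e0 hP ho.
have hs p : p \in tagged_simple P g -> measurable p.1.
  by move=> /mapP[q qP ->]; have [] := tagged_partition_measurable hP mD Dfin qP.
have -> : ((e * m D)%:E = \int[mu]_x (e * \1_(D : set (borel G)) x)%:E)%E.
  rewrite EFinM fineK_measure//.
  under eq_integral do rewrite EFinM.
  rewrite ge0_integralZl_EFin//.
    by rewrite integral_indic// setIT.
  by apply/measurable_EFinP; exact: measurable_indic.
apply: ge0_le_integral => //.
- by move=> x _; rewrite lee_fin rnorm_ge0.
- exact: measurable_dist_simpleE.
- by apply/measurable_EFinP; apply: measurable_funM => //; exact: measurable_indic.
move=> x _; rewrite lee_fin indicE; have [Dx|Dx] := pselect (D x).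
  rewrite mem_set// mulr1; have [r Nr ->] := tagged_simple_value_in g hP Dx.
  exact: ho.
by rewrite memNset// mulr0 (tagged_simple_value_out g hP Dx) g0// subr0 rnorm0.
Qed.

Hypothesis cX : family_complete X.
Hypothesis mu_compact : forall C : set G, compact C -> (mu C < +oo)%E.
Hypothesis hG : hausdorff_space G.

Lemma compact_borel (C : set G) : compact C -> borel_set C.
Proof. by move=> cC; apply: closed_borel; exact: compact_closed. Qed.

Lemma oscillation_exists g (C : set G) e : continuous g -> compact C -> 0 < e ->
  exists P, tagged_partition (fun r => [set x | rnorm (g x - g r) <= e]) C P.
Proof.
move=> cg cC e0; apply: tagged_partition_exists => //; first exact: compact_borel.
move=> r _; have := (continuous_rnormP _).1 cg r e e0; apply: filterS => x /=; exact: ltW.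
Qed.

(** The simple functions of Riemann sums converge to [g] in mean, so the sums
    have a limit, and this limit is a Bochner integral of [g].  The integral is
    used below through this estimate only. *)
Theorem bochner_integral_approx g (C : set G) N P e : continuous g -> compact C ->
  (forall x, ~ C x -> g x = 0) -> 0 <= e -> tagged_partition N C P ->
  oscillation g N C e ->
  rnorm (bochner_integral mu g - riemann_sum P g) <= e * m C.
Proof.
move=> cg cC g0 e0 hP ho.
have mC := compact_borel cC; have Cfin := mu_compact cC; have mC0 := fine_measure_ge0 C.
have ms P' N' : tagged_partition N' C P' -> forall p, p \in tagged_simple P' g -> measurable p.1 /\ (mu p.1 < +oo)%E.
  by move=> hP' p /mapP[q qP ->]; exact: (tagged_partition_measurable hP' mC Cfin qP).
pose S (d : R) : set X := [set y | exists2 P', tagged_partition (fun r => [set x | rnorm (g x - g r) <= d]) C P' & y = riemann_sum P' g].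
have [||y hy] := cX (S := S) mC0.
- move=> d d0; have [P' hP'] := oscillation_exists cg cC d0.
  by exists (riemann_sum P' g), P'.
- move=> d d' _ _ d0 d0' [P1 h1 ->] [P2 h2 ->]; rewrite -!tagged_simple_integral mulrC mulrDl.
  apply: (simple_integral_dist cg (ms _ _ h1) (ms _ _ h2)).
    by apply: tagged_simple_L1 h1 _ => //; exact: ltW.
  by apply: tagged_simple_L1 h2 _ => //; exact: ltW.
have yint : is_bochner_integral mu g y.
  move=> d d0; have mC1 : 0 < m C + 1 by rewrite ltr_pwDr.
  have d1 : 0 < d / (m C + 1) by rewrite divr_gt0.
  have [P' hP'] := oscillation_exists cg cC d1.
  have small : d / (m C + 1) * m C < d.
    by rewrite mulrAC ltr_pdivrMr// ltr_pM2l// ltrDl.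
  exists (tagged_simple P' g); split; first exact: ms hP'.
  - by apply: measurable_dist_simple => // p ps; have [] := ms _ _ hP' p ps.
  - apply: le_lt_trans (tagged_simple_L1 cg g0 mC Cfin (ltW d1) hP' _) _ => //.
  - rewrite rdistC tagged_simple_integral; apply: le_lt_trans small.
    by rewrite mulrC; apply: hy => //; exists P'.
have hb : is_bochner_integral mu g (bochner_integral mu g) := xgetI 0 yint.
apply/ler_addgt0Pr => d d0; have d2 : 0 < d / 2 by rewrite divr_gt0.
have [s [hs _ h1 h2]] := hb _ d2.
have := simple_integral_dist cg hs (ms _ _ hP) (ltW h1) (tagged_simple_L1 cg g0 mC Cfin e0 hP ho).
rewrite tagged_simple_integral => h3.
apply: le_trans (rdist_triangle (simple_integral mu s) _ _) _.
apply: le_trans (lerD (ltW h2) h3) _; rewrite addrA -splitr; lra.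
Qed.

End vector_valued.
End riemann_sums.

(** * Integration of compactly supported functions *)

Section support.
Context {R : realType} {k : scalars} {G : topGroupType}.
Local Notation K := (scalar_field R k).

Definition supported (X : normedModType K) (g : G -> X) (C : set G) :=
  [/\ continuous g, compact C & forall x, ~ C x -> g x = 0].

Lemma supported_sub (X : normedModType K) (g : G -> X) C C' :
  supported g C -> compact C' -> C `<=` C' -> supported g C'.
Proof. by move=> [cg _ g0] cC' CC'; split=> // x nC; apply: g0 => /CC'. Qed.

Lemma supportedZ (X : normedModType K) (f : G -> K^o) (u : G -> X) C :
  supported f C -> continuous u -> supported (fun s => f s *: u s) C.
Proof.
move=> [cf cC f0] cu; split=> //; last by move=> x /f0 ->; rewrite scale0r.
by move=> x; apply: cvgZ; [exact: cf|exact: cu].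
Qed.

Lemma supported_scale (X : normedModType K) (c : K) (u : G -> X) C :
  supported u C -> supported (fun s => c *: u s) C.
Proof.
move=> [cu cC u0]; split=> //; last by move=> x /u0 ->; rewrite scaler0.
by move=> x; apply: (@cvgZ _ _ _ _ _ (fun=> c)); [exact: cvg_cst|exact: cu].
Qed.

Lemma supportedD (X : normedModType K) (f u : G -> X) C :
  supported f C -> supported u C -> supported (fun s => f s + u s) C.
Proof.
move=> [cf cC f0] [cu _ u0]; split=> //; last by move=> x Cx; rewrite f0// u0// addr0.
by move=> x; apply: cvgD; [exact: cf|exact: cu].
Qed.

Lemma supported_lip (X Y : normedModType K) (T : X -> Y) (M : R) (g : G -> X) C :
  {morph T : x y / x + y} -> (forall x, rnorm (T x) <= M * rnorm x) ->
  supported g C -> supported (T \o g) C.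
Proof.
move=> TD TM [cg cC g0].
have T0 : T 0 = 0 by apply/rnorm0_eq0/eqP; rewrite eq_le rnorm_ge0 andbT (le_trans (TM _))// rnorm0 mulr0.
have TB x y : T (x - y) = T x - T y.
  by apply/eqP; rewrite eq_sym subr_eq -TD subrK.
split=> //; last by move=> x Cx; rewrite /= g0.
apply/continuous_rnormP => t e e0; have M0 : 0 < `|M| + 1 by rewrite ltr_pwDr.
have := (continuous_rnormP _).1 cg t (e / (`|M| + 1)) (divr_gt0 e0 M0).
apply: filterS => s /=; rewrite -TB ltr_pdivlMr// => h; apply: le_lt_trans (TM _) _.
apply: le_lt_trans h; rewrite mulrC ler_wpM2l ?rnorm_ge0//.
by rewrite (le_trans (ler_norm _))// lerDl.
Qed.

Lemma supported_bounded (X : normedModType K) (g : G -> X) C : supported g C ->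
  exists2 M : R, 0 <= M & forall x, rnorm (g x) <= M.
Proof.
move=> [cg cC g0].
have /compact_near_coveringP := cC.
move=> /(_ R (pinfty_nbhs R) (fun M x => rnorm (g x) <= M)) h.
have [|M [Mr hM]] := h _.
  move=> x Cx; exists ([set y | rnorm (g y - g x) < 1], [set M | 1 + rnorm (g x) < M]) => /=.
    split; first by apply: ((continuous_rnormP _).1 cg).
    by apply: nbhs_pinfty_gt; rewrite num_real.
  move=> [y M] /= [h1 h2]; apply: le_trans (rnorm_tri _ (g x)) _.
  by apply/ltW/(le_lt_trans _ h2); rewrite lerD2r ltW.
have M1 : M < `|M| + 1 by rewrite (le_lt_trans (ler_norm _))// ltrDl.
exists (`|M| + 1); first by rewrite addr_ge0.
move=> x; have [Cx|Cx] := pselect (C x); first exact: hM M1 _ Cx.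
by rewrite g0// rnorm0 addr_ge0.
Qed.

(** The support is a closed subset of the compact set [C]. *)
Lemma supported_Cc (f : G -> K^o) C : supported f C -> hausdorff_space G -> Cc f.
Proof.
move=> [cf cC f0] hG; split=> //; apply: (subclosed_compact _ cC); first exact: closed_closure.
have cl := compact_closed hG cC; rewrite [X in _ `<=` X](closure_id _).1//.
apply: closureS => x /= fx; apply: contrapT => /f0 h; by rewrite h eqxx in fx.
Qed.

Lemma Cc_supported (f : G -> K) : Cc f -> exists C, supported (f : G -> K^o) C.
Proof.
move=> [cf cC]; exists (closure [set s | f s != 0]); split=> // x Cx.
apply: contrapT => fx; apply: Cx; apply: subset_closure => /=.
by apply/eqP => h; apply: fx.
Qed.

Lemma Cc_supported2 (f g : G -> K) : Cc f -> Cc g ->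
  exists2 C, supported (f : G -> K^o) C & supported (g : G -> K^o) C.
Proof.
move=> /Cc_supported[C sf] /Cc_supported[D sg].
have [_ cC _] := sf; have [_ cD _] := sg; have cCD := compactU cC cD.
exists (C `|` D); first exact: supported_sub sf cCD (@subsetUl _ _ _).
exact: supported_sub sg cCD (@subsetUr _ _ _).
Qed.

Lemma Cc_lin (c : K) (f g : G -> K) : hausdorff_space G -> Cc f -> Cc g ->
  Cc (fun s => c * f s + g s).
Proof.
move=> hG Cf Cg; have [C sf sg] := Cc_supported2 Cf Cg.
exact: supported_Cc (supportedD (supported_scale c sf) sg) hG.
Qed.

Lemma CcB (f g : G -> K) : hausdorff_space G -> Cc f -> Cc g ->
  Cc (fun s => f s - g s).
Proof.
move=> hG Cf Cg; have := Cc_lin (-1) hG Cg Cf.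
by congr Cc; apply/funext => s; rewrite mulN1r addrC.
Qed.

End support.

Section integral.
Context {R : realType} {k : scalars} {G : topGroupType}.
Variable mu : {measure set (borel G) -> \bar R}.
Local Notation K := (scalar_field R k).
Local Notation borel_set A := (measurable (A : set (borel G))).
Local Notation m A := (fine (mu A)).
Hypothesis mu_compact : forall C : set G, compact C -> (mu C < +oo)%E.
Hypothesis hG : hausdorff_space G.
Local Notation int g := (bochner_integral mu g).
Local Notation RS := (riemann_sum mu).

Definition gauge (X : normedModType K) (g : G -> X) (e : R) (r : G) : set G :=
  [set x | rnorm (g x - g r) <= e].

Lemma gauge_nbhs (X : normedModType K) (g : G -> X) e r :
  continuous g -> 0 < e -> nbhs r (gauge g e r).
Proof.
move=> cg e0; have := (continuous_rnormP _).1 cg r e e0; apply: filterS => x /=; exact: ltW.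
Qed.

Lemma partition_exists (N : G -> set G) (C : set G) : compact C ->
  (forall r, C r -> nbhs r (N r)) -> exists P, tagged_partition N C P.
Proof. by move=> cC; apply: tagged_partition_exists => //; exact: compact_borel. Qed.

Lemma int_gauge (X : normedModType K) (g : G -> X) C N P e : family_complete X ->
  supported g C -> 0 <= e -> tagged_partition N C P ->
  (forall r, N r `<=` gauge g e r) -> rnorm (int g - RS P g) <= e * m C.
Proof.
move=> cX [cg cC g0] e0 hP hN; apply: (@bochner_integral_approx _ _ _ mu X cX mu_compact hG g C N) => //.
by move=> r x _ /hN.
Qed.

Lemma sum_measure N C P : compact C -> tagged_partition N C P ->
  \sum_(p <- P) m p.1 = m C.
Proof.
move=> cC; have := mu_compact cC; move: (compact_borel hG cC) => {cC}.
elim: P C => [|p P ih] C mC Cfin /=; first by move=> ->; rewrite big_nil measure0.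
move=> [mp pC _ hP]; rewrite big_cons (ih _ _ _ hP).
- by rewrite (fine_measureDI mC mp Cfin) (setIidr pC).
- exact: measurableD.
- by apply: (measure_finite_sub _ mC) => //; exact: measurableD.
Qed.

Lemma riemann_sum_bound (X : normedModType K) (g : G -> X) (M : R) N C P :
  compact C -> tagged_partition N C P -> (forall x, rnorm (g x) <= M) ->
  rnorm (RS P g) <= M * m C.
Proof.
move=> cC hP gM; apply: le_trans (rnorm_sum _ _) _.
rewrite -(sum_measure cC hP) mulr_sumr; apply: ler_sum => p _.
by rewrite rnormZ_ge0 ?fine_measure_ge0// mulrC ler_wpM2r ?fine_measure_ge0.
Qed.

(** Additivity and real homogeneity are enough, because the coefficients of a
    Riemann sum are real.  This covers conjugate-linear maps. *)
Lemma int_semilinear (X Y : normedModType K) (T : X -> Y) (M : R) (g : G -> X) C :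
  family_complete X -> family_complete Y ->
  {morph T : x y / x + y} -> (forall (a : R) x, T (a%:K *: x) = a%:K *: T x) ->
  (forall x, rnorm (T x) <= M * rnorm x) -> supported g C ->
  int (T \o g) = T (int g).
Proof.
move=> cX cY TD TZ TM sg; have [cg cC g0] := sg.
have T0 : T 0 = 0 by apply/rnorm0_eq0/eqP; rewrite eq_le rnorm_ge0 andbT (le_trans (TM _))// rnorm0 mulr0.
have TB x y : T (x - y) = T x - T y.
  by apply/eqP; rewrite eq_sym subr_eq -TD subrK.
have sTg := supported_lip TD TM sg; have [cTg _ _] := sTg.
apply: (rnorm_eps_eq (m C + `|M| * m C)) => e e0.
have [P hP] := partition_exists (N := fun r => gauge g e r `&` gauge (T \o g) e r) cC
  (fun r _ => filterI (gauge_nbhs r cg e0) (gauge_nbhs r cTg e0)).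
have h1 := int_gauge cX sg (ltW e0) hP (fun r => @subIsetl _ _ _).
have h2 := int_gauge cY sTg (ltW e0) hP (fun r => @subIsetr _ _ _).
have TRS : T (RS P g) = RS P (T \o g).
  rewrite /riemann_sum; elim: P {hP h1 h2} => [|p P ih]; first by rewrite !big_nil.
  by rewrite !big_cons TD TZ ih.
apply: le_trans (rdist_triangle (RS P (T \o g)) _ _) _.
rewrite mulrDl [m C * e]mulrC; apply: lerD => //.
rewrite -TRS -TB; apply: le_trans (TM _) _; rewrite rdistC.
apply: le_trans (_ : `|M| * (e * m C) <= _); last by rewrite -mulrA [e * _]mulrC.
apply: le_trans (ler_wpM2r (rnorm_ge0 _) (ler_norm M)) _.
by rewrite ler_wpM2l.
Qed.

Lemma intD (X : normedModType K) (f g : G -> X) C : family_complete X ->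
  supported f C -> supported g C -> int (fun s => f s + g s) = int f + int g.
Proof.
move=> cX sf sg; have [cf cC _] := sf; have [cg _ _] := sg.
have sfg := supportedD sf sg; have [cfg _ _] := sfg.
apply: (rnorm_eps_eq (3 * m C)) => e e0.
have [P hP] := partition_exists
  (N := fun r => gauge f e r `&` (gauge g e r `&` gauge (fun s => f s + g s) e r)) cC
  (fun r _ => filterI (gauge_nbhs r cf e0) (filterI (gauge_nbhs r cg e0) (gauge_nbhs r cfg e0))).
have h1 := int_gauge cX sf (ltW e0) hP (fun r => @subIsetl _ _ _).
have h2 := int_gauge cX sg (ltW e0) hP (fun r x (h : (_ `&` (_ `&` _)) x) => h.2.1).
have h3 := int_gauge cX sfg (ltW e0) hP (fun r x (h : (_ `&` (_ `&` _)) x) => h.2.2).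
have RSD : RS P (fun s => f s + g s) = RS P f + RS P g.
  by rewrite /riemann_sum -big_split; apply: eq_bigr => p _; rewrite scalerDr.
apply: le_trans (rdist_triangle (RS P (fun s => f s + g s)) _ _) _.
rewrite {2}RSD opprD addrACA.
have := rnormD (RS P f - int f) (RS P g - int g).
rewrite (rdistC _ (int f)) (rdistC _ (int g)) => h4; nra.
Qed.

Lemma intZ (X : normedModType K) (c : K) (f : G -> X) C : family_complete X ->
  supported f C -> int (fun s => c *: f s) = c *: int f.
Proof.
move=> cX sf; apply: (@int_semilinear X X (fun x => c *: x) (rnorm (c : K^o)) f C) => //.
- by move=> x y; rewrite scalerDr.
- by move=> a x; rewrite !scalerA mulrC.
- by move=> x; rewrite rnormZ.
Qed.

Lemma int_bound (X : normedModType K) (g : G -> X) C (M : R) : family_complete X ->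
  supported g C -> (forall x, rnorm (g x) <= M) -> rnorm (int g) <= M * m C.
Proof.
move=> cX sg gM; have [cg cC _] := sg; apply/ler_addgt0Pr => d d0.
have mC := fine_measure_ge0 mu C; have mC1 : 0 < m C + 1 by rewrite ltr_pwDr.
have e0 := divr_gt0 d0 mC1.
have [P hP] := partition_exists cC (fun r _ => gauge_nbhs r cg e0).
have h1 := int_gauge cX sg (ltW e0) hP (fun r => @subset_refl _ _).
have h2 := riemann_sum_bound cC hP gM.
have h3 : d / (m C + 1) * m C <= d by rewrite mulrAC ler_pdivrMr// ler_pM2l// lerDl.
have := rnorm_tri (int g) (RS P g); lra.
Qed.

Lemma int_dominated (X : normedModType K) (g : G -> X) (f : G -> R) C (M : R) :
  family_complete X -> supported g C -> supported (fun s => (f s)%:K : K^o) C ->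
  (forall x, rnorm (g x) <= M * f x) ->
  rnorm (int g) <= M * scalar_Re (int (fun s => (f s)%:K : K^o)).
Proof.
move=> cX sg sf gM; have [cg cC _] := sg; have [cf _ _] := sf.
apply/ler_addgt0Pr => d d0.
have mC := fine_measure_ge0 mu C.
have D0 : 0 < (`|M| + 1) * (m C + 1) by rewrite mulr_gt0// ltr_pwDr.
have e0 := divr_gt0 d0 D0; set e := d / _ in e0.
have [P hP] := partition_exists
  (N := fun r => gauge g e r `&` gauge (fun s => (f s)%:K : K^o) e r) cC
  (fun r _ => filterI (gauge_nbhs r cg e0) (gauge_nbhs r cf e0)).
have h1 := int_gauge cX sg (ltW e0) hP (fun r => @subIsetl _ _ _).
have h2 := int_gauge (@scalar_family_complete R k) sf (ltW e0) hP (fun r => @subIsetr _ _ _).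
have h3 : rnorm (RS P g) <= M * scalar_Re (RS P (fun s => (f s)%:K : K^o)).
  apply: le_trans (rnorm_sum _ _) _; rewrite raddf_sum mulr_sumr; apply: ler_sum => p _.
  rewrite /=; have <- : m p.1 * f p.2 = scalar_Re ((m p.1)%:K *: ((f p.2)%:K : K^o)).
    by apply/esym; apply: etrans (mulr_of_real_Re _ _) _; rewrite Re_of_real.
  by rewrite rnormZ_ge0 ?fine_measure_ge0// mulrCA ler_wpM2l ?fine_measure_ge0.
have h4 : `|scalar_Re (RS P (fun s => (f s)%:K : K^o)) - scalar_Re (int (fun s => (f s)%:K : K^o))| <= e * m C.
  by rewrite -raddfB; apply: le_trans (Re_le_norm _) _; rewrite -normrN opprB.
have h5 : rnorm (int g) <= e * m C + M * scalar_Re (RS P (fun s => (f s)%:K : K^o)).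
  by have := rnorm_tri (int g) (RS P g); lra.
apply: le_trans h5 _.
have h6 : M * scalar_Re (RS P (fun s => (f s)%:K : K^o)) - M * scalar_Re (int (fun s => (f s)%:K : K^o)) <= `|M| * (e * m C).
  by rewrite -mulrBr; apply: le_trans (ler_norm _) _; rewrite normrM ler_wpM2l.
have h7 : e * ((`|M| + 1) * (m C + 1)) = d by rewrite /e divfK// gt_eqF.
have := normr_ge0 M; nra.
Qed.

Lemma int_closed (X : normedModType K) (L : set X) (g : G -> X) C : family_complete X ->
  linear_subspace L -> closed L -> supported g C -> (forall x, L (g x)) -> L (int g).
Proof.
move=> cX [L0 hL] cL sg gL; have [cg cC _] := sg.
apply: (closed_rnorm (m C)) => // e e0.
have [P hP] := partition_exists cC (fun r _ => gauge_nbhs r cg e0).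
have h1 := int_gauge cX sg (ltW e0) hP (fun r => @subset_refl _ _).
exists (RS P g); last by rewrite rdistC mulrC.
rewrite /riemann_sum; elim: P {hP h1} => [|p P ih]; first by rewrite big_nil.
by rewrite big_cons; apply: hL.
Qed.

Lemma borel_preimage (psi : G -> G) (A : set G) : continuous psi -> borel_set A ->
  borel_set (psi @^-1` A).
Proof.
move=> cpsi mA; have : measurable_fun [set: borel G] (psi : borel G -> borel G).
  apply: (measurability _ (erefl : @measurable _ (borel G) = <<s @open G >>)).
  move=> _ [B oB <-]; rewrite setTI; apply: open_borel.
  by move: cpsi => /continuousP; apply.
by move=> /(_ measurableT A mA); rewrite setTI.
Qed.

(** Both translations of the group are of this kind.  Such a homeomorphism carries
    tagged partitions to tagged partitions and multiplies Riemann sums by [c]. *)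
Lemma int_homeo (X : normedModType K) (phi psi : G -> G) (c : R) (g : G -> X) C :
  family_complete X -> cancel phi psi -> cancel psi phi -> continuous phi -> continuous psi ->
  (forall A, borel_set A -> m (phi @` A) = c * m A) ->
  supported g C ->
  supported (g \o psi) (phi @` C) /\ int (g \o psi) = c%:K *: int g.
Proof.
move=> cX phiK psiK cphi cpsi hc sg; have [cg cC g0] := sg.
have sgp : supported (g \o psi) (phi @` C).
  split.
  - by move=> x; apply: continuous_comp; [exact: cpsi|exact: cg].
  - by apply: continuous_compact => //; apply: continuous_subspaceT.
  - by move=> x Cx; apply: g0 => Cp; apply: Cx; exists (psi x).
split=> //.
apply: (rnorm_eps_eq (m (phi @` C) + `|c| * m C)) => e e0.
have [P hP] := partition_exists cC (fun r _ => gauge_nbhs r cg e0).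
have h1 := int_gauge cX sg (ltW e0) hP (fun r => @subset_refl _ _).
pose P' := [seq (phi @` p.1, phi p.2) | p <- P].
have hP' : tagged_partition (gauge (g \o psi) e) (phi @` C) P'.
  rewrite /P'; elim: P C hP {cC g0 sg sgp h1 P'} => [|p P ih] C /=.
    by move=> ->; rewrite image_set0.
  move=> [mp pC pN hP]; split.
  - have -> : phi @` p.1 = psi @^-1` p.1.
      apply/seteqP; split=> [_ [x px <-] /=|x px]; first by rewrite phiK.
      by exists (psi x).
    exact: borel_preimage.
  - exact: image_subset.
  - by move=> _ [x px <-]; rewrite /gauge /= !phiK; exact: pN.
  - have -> : phi @` C `\` phi @` p.1 = phi @` (C `\` p.1).
      apply/seteqP; split=> [_ [[x Cx <-] nx]|_ [x [Cx nx] <-]].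
        by exists x => //; split=> // px; apply: nx; exists x.
      by split; [exists x|move=> [y py /(can_inj phiK) yx]; apply: nx; rewrite -yx].
    exact: ih.
have h2 := int_gauge cX sgp (ltW e0) hP' (fun r => @subset_refl _ _).
have RSE : RS P' (g \o psi) = c%:K *: RS P g.
  rewrite /riemann_sum big_map scaler_sumr; apply: eq_big_seq => p pP /=.
  rewrite phiK hc ?rmorphM ?scalerA//.
  by have [] := tagged_partition_measurable hP (compact_borel hG cC) (mu_compact cC) pP.
apply: le_trans (rdist_triangle (RS P' (g \o psi)) _ _) _.
rewrite mulrDl; apply: lerD; first by rewrite mulrC.
by rewrite RSE -scalerBr rnormZr -mulrA ler_wpM2l// mulrC rdistC.
Qed.

Lemma int_linear_map (X Y : normedModType K) (T : X -> Y) (g : G -> X) C :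
  family_complete X -> family_complete Y -> bounded_operator T -> supported g C ->
  int (T \o g) = T (int g).
Proof.
move=> cX cY bT sg; have [M M0 hM] := bounded_operator_bound bT; have [lT _] := bT.
apply: (int_semilinear cX cY _ _ hM sg); first by move=> x y; rewrite linear_mapD.
by move=> a x; rewrite linear_mapZ.
Qed.

End integral.

(** * Functionals on compactly supported functions and Fubini's theorem *)

Section group_topology.
Context {G : topGroupType}.

Lemma continuous_mulg (T : topologicalType) (f g : T -> G) :
  continuous f -> continuous g -> continuous (fun t => (f t * g t)%g).
Proof.
move=> cf cg t; apply: (@cvg_comp _ _ _ (fun t => (f t, g t)) (fun z : G * G => (z.1 * z.2)%g) _ (nbhs (f t, g t))).
  by apply: cvg_pair; [exact: cf|exact: cg].
exact: (@mulg_continuous G (f t, g t)).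
Qed.

Lemma continuous_invg (T : topologicalType) (f : T -> G) :
  continuous f -> continuous (fun t => (f t)^-1%g).
Proof.
by move=> cf t; apply: (@continuous_comp _ _ _ f (fun x => x^-1%g)); [exact: cf|exact: invg_continuous].
Qed.

Lemma continuous_lmul (r : G) : continuous (fun s => (r * s)%g).
Proof. by apply: continuous_mulg => x; [exact: cvg_cst|exact: cvg_id]. Qed.
Lemma continuous_rmul (r : G) : continuous (fun s => (s * r)%g).
Proof. by apply: continuous_mulg => x; [exact: cvg_id|exact: cvg_cst]. Qed.

Definition mulset (A B : set G) : set G := (fun z : G * G => (z.1 * z.2)%g) @` (A `*` B).

Lemma compact_mulset A B : compact A -> compact B -> compact (mulset A B).
Proof.
move=> cA cB; apply: continuous_compact; last exact: compact_setX.
by apply: continuous_subspaceT => z; exact: mulg_continuous.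
Qed.

Lemma compact_invg (A : set G) : compact A -> compact ((fun x => x^-1%g) @` A).
Proof.
move=> cA; apply: continuous_compact => //.
by apply: continuous_subspaceT => z; exact: invg_continuous.
Qed.

Lemma compact_nbhs (x : G) : locally_compact [set: G] ->
  exists2 C, compact C & nbhs x C.
Proof.
move=> /(_ x Logic.I)[C Cx [cC _]]; exists C => //.
have : nbhs x [set y | [set: G] y -> C y] by exact: Cx.
by apply: filterS => y /=; apply.
Qed.

End group_topology.

Section functionals.
Context {R : realType} {k : scalars} {G : topGroupType}.
Variable mu : {measure set (borel G) -> \bar R}.
Local Notation K := (scalar_field R k).
Local Notation borel_set A := (measurable (A : set (borel G))).
Local Notation m A := (fine (mu A)).
Hypothesis mu_compact : forall C : set G, compact C -> (mu C < +oo)%E.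
Hypothesis hG : hausdorff_space G.
Hypothesis lcG : locally_compact [set: G].
Local Notation int g := (bochner_integral mu g).
Local Notation RS := (riemann_sum mu).

(** The vector-valued Radon measures on [G].  Integration, the map into the
    crossed product, and the integrated form of a representation applied to a
    vector are of this kind, so that one Fubini theorem serves for all. *)
Definition Cc_functional (Y : normedModType K) (J : (G -> K) -> Y) :=
  (forall (c : K) f g, Cc f -> Cc g -> J (fun s => c * f s + g s) = c *: J f + J g) /\
  (forall C, compact C -> exists2 M : R, 0 <= M & forall (f : G -> K^o) e,
     supported f C -> (forall s, rnorm (f s) <= e) -> rnorm (J f) <= M * e).

Section functional.
Context {Y : normedModType K}.
Variable J : (G -> K) -> Y.
Hypothesis hJ : Cc_functional J.

Lemma Cc0 : Cc (fun _ : G => 0 : K).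
Proof.
apply: (@supported_Cc R k G _ set0) => //; split=> // [x|]; first exact: cvg_cst.
exact: compact0.
Qed.

Lemma functional0 : J (fun=> 0) = 0.
Proof.
have := hJ.1 (-1) _ _ Cc0 Cc0; rewrite scaleN1r addNr.
by rewrite (_ : (fun _ : G => -1 * 0 + 0 : K) = fun=> 0)//; apply/funext => s; rewrite mulr0 addr0.
Qed.

Lemma functionalB f g : Cc f -> Cc g -> J (fun s => f s - g s) = J f - J g.
Proof.
move=> Cf Cg; have := hJ.1 (-1) _ _ Cg Cf; rewrite scaleN1r addrC => <-.
by congr J; apply/funext => s; rewrite mulN1r addrC.
Qed.

Lemma functional_dist (C : set G) : compact C -> exists2 M : R, 0 <= M & forall (f g : G -> K^o) e,
  supported f C -> supported g C -> (forall s, rnorm (f s - g s) <= e) ->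
  rnorm (J f - J g) <= M * e.
Proof.
move=> cC; have [M M0 hM] := hJ.2 C cC; exists M => // f g e sf sg he.
rewrite -(functionalB (supported_Cc sf hG) (supported_Cc sg hG)).
apply: hM => //; have [cf _ f0] := sf; have [cg _ g0] := sg; split=> //.
  by move=> x; apply: (@cvgB _ K^o); [exact: cf|exact: cg].
by move=> x Cx; rewrite f0// g0// subrr.
Qed.

(** Compactness of [C] makes continuity in the first variable uniform in the
    second. *)
Lemma tube_lemma (Z : normedModType K) (F : G -> G -> Z) (C : set G) (r0 : G) e :
  continuous (fun z : G * G => F z.1 z.2) -> compact C -> 0 < e ->
  nbhs r0 [set r | forall s, C s -> rnorm (F r s - F r0 s) <= e].
Proof.
move=> /continuous_rnormP cF /compact_near_coveringP /(_ G (nbhs r0) (fun r s => rnorm (F r s - F r0 s) <= e)) h e0.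
apply: (h _) => x Cx; have [[A B] /= [Ar Bx] hAB] := cF (r0, x) (e / 2) (divr_gt0 e0 (ltr0Sn _ 1)).
exists (B, A) => //= -[s r] /= [Bs Ar'].
have /= h1 := hAB (r, s) (conj Ar' Bs).
have /= h2 := hAB (r0, s) (conj (nbhs_singleton Ar) Bs).
apply: le_trans (rdist_triangle (F r0 x) _ _) _.
by rewrite [leRHS]splitr (rdistC _ (F r0 s)) lerD// ltW.
Qed.

Lemma functional_near (F : G -> G -> K^o) (C V : set G) (r0 : G) :
  continuous (fun z : G * G => F z.1 z.2) -> compact C -> nbhs r0 V ->
  (forall r, V r -> supported (F r) C) ->
  forall e, 0 < e -> nbhs r0 [set r | rnorm (J (F r) - J (F r0)) < e].
Proof.
move=> cF cC V0 sF e e0; have [M M0 hM] := functional_dist cC.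
have M1 : 0 < M + 1 by rewrite ltr_pwDr.
have near_r0 : Filter (nbhs r0) := nbhs_filter r0.
have := @filterI _ _ near_r0 _ _ V0 (tube_lemma r0 cF cC (divr_gt0 e0 M1)).
apply: (@filterS _ _ near_r0) => r [Vr hr] /=.
apply: (@le_lt_trans _ _ (M * (e / (M + 1)))).
  apply: hM; [exact: sF|by apply: sF; exact: (nbhs_singleton V0)|move=> s].
  have [Cs|Cs] := pselect (C s); first exact: hr.
  have [_ _ z1] := sF _ Vr; have [_ _ z2] := sF _ (nbhs_singleton V0).
  by rewrite z1// z2// subrr rnorm0 divr_ge0// ltW.
by rewrite mulrCA gtr_pMr// ltr_pdivrMr// mul1r ltrDl.
Qed.

End functional.

Lemma int_functional : Cc_functional (fun f : G -> K => int (f : G -> K^o) : K^o).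
Proof.
split.
  move=> c f g Cf Cg; have [C sf sg] := Cc_supported2 Cf Cg.
  rewrite -(intZ mu_compact hG c (@scalar_family_complete R k) sf).
  exact: (intD mu_compact hG (@scalar_family_complete R k) (supported_scale c sf) sg).
move=> C cC; exists (m C); first exact: fine_measure_ge0.
move=> f e sf he; rewrite mulrC.
exact: (int_bound mu_compact hG (@scalar_family_complete R k) sf he).
Qed.

Lemma continuous_slices (Z : normedModType K) (F : G -> G -> Z) : continuous (fun z : G * G => F z.1 z.2) ->
  (forall r, continuous (F r)) /\ (forall s, continuous (F^~ s)).
Proof.
move=> cF; split=> [r s|s r].
  apply: (@cvg_comp _ _ _ (fun s => (r, s)) (fun z : G * G => F z.1 z.2) _ (nbhs (r, s))).
    by apply: cvg_pair; [exact: cvg_cst|exact: cvg_id].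
  exact: (cF (r, s)).
apply: (@cvg_comp _ _ _ (fun r => (r, s)) (fun z : G * G => F z.1 z.2) _ (nbhs (r, s))).
  by apply: cvg_pair; [exact: cvg_id|exact: cvg_cst].
exact: (cF (r, s)).
Qed.

Lemma supported_functional (Y : normedModType K) (J : (G -> K) -> Y) (F : G -> G -> K^o) (C D : set G) :
  Cc_functional J ->
  continuous (fun z : G * G => F z.1 z.2) -> compact C -> compact D ->
  (forall r s, ~ (C r /\ D s) -> F r s = 0) ->
  supported (fun r => J (F r)) C.
Proof.
move=> hJ cF cC cD F0; split=> //.
  apply/continuous_rnormP => r e e0; apply: (functional_near hJ cF cD (@filterT _ (nbhs r) _)) => // r' _.
  by split=> //; [exact: (continuous_slices cF).1|move=> s Ds; apply: F0 => -[]].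
move=> r Cr; rewrite (_ : F r = fun=> 0) ?functional0//.
by apply/funext => s; apply: F0 => -[].
Qed.

Lemma continuous_swap (Z : normedModType K) (F : G -> G -> Z) :
  continuous (fun z : G * G => F z.1 z.2) -> continuous (fun z : G * G => F z.2 z.1).
Proof.
move=> cF z; apply: (@cvg_comp _ _ _ (fun z : G * G => (z.2, z.1)) (fun z : G * G => F z.1 z.2) _ (nbhs (z.2, z.1))).
  by apply: cvg_pair; [exact: cvg_snd|exact: cvg_fst].
exact: (cF (z.2, z.1)).
Qed.

Lemma supported_int (F : G -> G -> K^o) (C D : set G) :
  continuous (fun z : G * G => F z.1 z.2) -> compact C -> compact D ->
  (forall r s, ~ (C r /\ D s) -> F r s = 0) ->
  supported (fun s => int (fun r => F r s) : K^o) D.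
Proof.
move=> cF cC cD F0.
apply: (supported_functional (F := fun s r => F r s) int_functional (continuous_swap cF) cD cC).
by move=> r s h; apply: F0 => -[? ?]; apply: h.
Qed.

(** Functionals commute with integrals: [int (F ^~ s)] is uniformly in [s]
    close to a Riemann sum, to which linearity applies. *)
Theorem fubini (Y : normedModType K) (J : (G -> K) -> Y) (F : G -> G -> K^o) (C D : set G) :
  family_complete Y -> Cc_functional J ->
  continuous (fun z : G * G => F z.1 z.2) -> compact C -> compact D ->
  (forall r s, ~ (C r /\ D s) -> F r s = 0) ->
  J (fun s => int (fun r => F r s)) = int (fun r => J (F r)).
Proof.
move=> cY hJ cF cC cD F0.
have sJ := supported_functional hJ cF cC cD F0; have [cJ _ _] := sJ.
have sI := supported_int cF cC cD F0.
have [M M0 hM] := functional_dist hJ cD.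
have sF r : supported (F r) D.
  by split=> //; [exact: (continuous_slices cF).1|move=> s Ds; apply: F0 => -[]].
have sF' s : supported (F^~ s) C.
  by split=> //; [exact: (continuous_slices cF).2|move=> r Ds; apply: F0 => -[]].
apply: (rnorm_eps_eq (M * m C + m C)) => e e0.
pose N1 (r : G) := [set r' | forall s, D s -> rnorm (F r' s - F r s) <= e].
have [P hP] := partition_exists hG (N := fun r => N1 r `&` gauge (fun r => J (F r)) e r) cC
  (fun r _ => filterI (tube_lemma r cF cD e0) (gauge_nbhs r cJ e0)).
have h1 := int_gauge mu_compact hG cY sJ (ltW e0) hP (fun r => @subIsetr _ _ _).
pose S (s : G) : K^o := RS P (F^~ s).
have h2 s : rnorm (int (F^~ s) - S s) <= e * m C.
  apply: (int_gauge mu_compact hG (@scalar_family_complete R k) (sF' s) (ltW e0) hP) => r r' [hr _].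
  rewrite /gauge /=; have [Ds|Ds] := pselect (D s); first exact: hr.
  by rewrite !F0 ?subrr ?rnorm0 ?ltW// => -[].
have [sS JS] : supported S D /\ J S = RS P (fun r => J (F r)).
  rewrite /S /riemann_sum; elim: P {hP h1 S h2} => [|p P [ih1 ih2]].
    split; last first.
      rewrite big_nil -(functional0 hJ); congr J; apply/funext => s; exact: big_nil.
    split=> //; last by move=> x _; rewrite big_nil.
    rewrite (_ : (fun s : G => _) = fun=> 0); first by move=> x; exact: cvg_cst.
    by apply/funext => s; exact: big_nil.
  have eqS : (fun s => \sum_(j <- p :: P) (m j.1)%:K *: F j.2 s) =
     (fun s => (m p.1)%:K * F p.2 s + \sum_(j <- P) (m j.1)%:K *: F j.2 s).
    by apply/funext => s; rewrite big_cons.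
  rewrite eqS big_cons; split; last first.
    rewrite (hJ.1 _ (F p.2)) ?ih2//; apply: (@supported_Cc R k G _ D) => //; exact: sF.
  apply: supportedD => //; have [cf _ f0] := sF p.2; split=> //; last by move=> x /f0 ->; rewrite mulr0.
  by move=> x; apply: (@cvgZ _ K^o _ _ _ (fun=> (m p.1)%:K)); [exact: cvg_cst|exact: cf].
apply: le_trans (rdist_triangle (J S) _ _) _.
rewrite mulrDl; apply: lerD.
  by rewrite -mulrA [m C * e]mulrC; apply: hM.
by rewrite JS rdistC mulrC.
Qed.

Definition translate (r : G) (f : G -> K) : G -> K := fun s => f (r^-1 * s)%g.

Lemma supported_translate r (f : G -> K^o) C : supported f C ->
  supported (translate r f : G -> K^o) (mulset [set r] C).
Proof.
move=> [cf cC f0]; split.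
- move=> x; apply: (@continuous_comp _ _ _ (fun s => (r^-1 * s)%g) f); [exact: continuous_lmul|exact: cf].
- by apply: compact_mulset => //; exact: compact_set1.
- move=> x nx; apply: f0 => h; apply: nx; exists (r, (r^-1 * x)%g) => //=.
  by rewrite mulgA mulgV mul1g.
Qed.

Lemma Cc_translate r f : Cc f -> Cc (translate r f).
Proof. by move=> /Cc_supported[C /(supported_translate r) /supported_Cc]; exact. Qed.

Lemma continuous_translate2 (f : G -> K^o) : continuous f ->
  continuous (fun z : G * G => f (z.1^-1 * z.2)%g).
Proof.
move=> cf z; apply: (@continuous_comp _ _ _ (fun z : G * G => (z.1^-1 * z.2)%g) f); last exact: cf.
apply: continuous_mulg; last by move=> x; exact: cvg_snd.
by apply: continuous_invg => x; exact: cvg_fst.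
Qed.

Section functional.
Context {Y : normedModType K}.
Variable J : (G -> K) -> Y.
Hypothesis hJ : Cc_functional J.

Lemma continuous_functional_translate f : Cc f -> continuous (fun r => J (translate r f)).
Proof.
move=> /Cc_supported[C sf]; have [cf cC f0] := sf; apply/continuous_rnormP => r e e0.
have [V cV Vr] := compact_nbhs r lcG.
apply: (functional_near (F := fun r => translate r f) (C := mulset V C) hJ _ _ Vr) => //.
- exact: continuous_translate2.
- exact: compact_mulset.
move=> r' Vr'; apply: supported_sub (supported_translate r' sf) (compact_mulset cV cC) _.
by move=> _ [[a b] /= [-> Cb] <-]; exists (r', b).
Qed.

Lemma convolution_joint f g C D : supported (f : G -> K^o) C -> supported (g : G -> K^o) D ->
  continuous (fun z : G * G => f z.1 * g (z.1^-1 * z.2)%g : K^o) /\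
  (forall r s, ~ (C r /\ mulset C D s) -> f r * g (r^-1 * s)%g = 0).
Proof.
move=> [cf _ f0] [cg _ g0]; split.
  move=> z; apply: (@cvgZ _ K^o _ _ _ (fun z => f z.1)); last exact: continuous_translate2.
  by apply: (@cvg_comp _ _ _ fst f _ (nbhs z.1)); [exact: cvg_fst|exact: cf].
move=> r s h; have [Cr|Cr] := pselect (C r); last by rewrite f0// mul0r.
rewrite g0 ?mulr0// => Ds; apply: h; split=> //; exists (r, (r^-1 * s)%g) => //=.
by rewrite mulgA mulgV mul1g.
Qed.

(** Fubini's theorem for [f r * g (r^-1 s)]. *)
Lemma functional_convolution f g : family_complete Y -> Cc f -> Cc g ->
  J (convolution mu f g) = int (fun r => f r *: J (translate r g)).
Proof.
move=> cY Cf Cg; have [C sf] := Cc_supported Cf; have [D sg] := Cc_supported Cg.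
have [_ cC _] := sf; have [_ cD _] := sg.
have [c0 z0] := convolution_joint sf sg.
apply: etrans (fubini cY hJ c0 cC (compact_mulset cC cD) z0) _.
congr bochner_integral; apply/funext => r.
have := hJ.1 (f r) _ _ (Cc_translate r Cg) Cc0.
rewrite (functional0 hJ) addr0 => <-; congr J; apply/funext => s.
by rewrite addr0.
Qed.

End functional.

Lemma Cc_convolution (f g : G -> K) : Cc f -> Cc g -> Cc (convolution mu f g).
Proof.
move=> Cf Cg; have [C sf] := Cc_supported Cf; have [D sg] := Cc_supported Cg.
have [_ cC _] := sf; have [_ cD _] := sg.
have [c0 z0] := convolution_joint sf sg.
exact: supported_Cc (supported_int c0 cC (compact_mulset cC cD) z0) hG.
Qed.

End functionals.

(** * Haar measure *)

Section haar.
Context {R : realType} {k : scalars} {G : topGroupType}.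
Variable mu : {measure set (borel G) -> \bar R}.
Local Notation K := (scalar_field R k).
Local Notation borel_set A := (measurable (A : set (borel G))).
Local Notation m A := (fine (mu A)).
Hypothesis hG : hausdorff_space G.
Hypothesis lcG : locally_compact [set: G].
Hypothesis haar : left_haar_measure mu.
Local Notation int g := (bochner_integral mu g).
Local Notation RS := (riemann_sum mu).

Lemma haar_compact (C : set G) : compact C -> (mu C < +oo)%E.
Proof. by have [[h _ _] _ _] := haar; exact: h. Qed.

Lemma haar_left (X : normedModType K) (r : G) (g : G -> X) C : family_complete X ->
  supported g C -> int (fun s => g (r * s)%g) = int g.
Proof.
move=> cX sg; have [_ _ hl] := haar.
have [||||A mA|_] := @int_homeo R k G mu haar_compact hG X (fun s => (r^-1 * s)%g) (fun s => (r * s)%g) 1 g C cX _ _ _ _ _ sg.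
- by move=> x; rewrite mulgA mulgV mul1g.
- by move=> x; rewrite mulgA mulVg mul1g.
- exact: continuous_lmul.
- exact: continuous_lmul.
- by rewrite mul1r hl.
by rewrite rmorph1 scale1r.
Qed.

Lemma haar_right (X : normedModType K) (Delta : G -> R) (r : G) (g : G -> X) C :
  modular_function mu Delta -> family_complete X ->
  supported g C -> int (fun s => g (s * r^-1)%g) = (Delta r)%:K *: int g.
Proof.
move=> hD cX sg.
have [||||A mA|_] := @int_homeo R k G mu haar_compact hG X (fun s => (s * r)%g) (fun s => (s * r^-1)%g) (Delta r) g C cX _ _ _ _ _ sg => //.
- by move=> x; rewrite -mulgA mulgV mulg1.
- by move=> x; rewrite -mulgA mulVg mulg1.
- exact: continuous_rmul.
- exact: continuous_rmul.
- have [Dr hDr] := hD r; rewrite hDr//.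
  have fineMl (y : \bar R) : (0 <= y)%E -> fine ((Delta r)%:E * y)%E = Delta r * fine y.
    by case: y => [a _ //|_|//]; rewrite gt0_muley ?mulr0.
  exact: fineMl.
Qed.

(** Otherwise finitely many null translates of [W] would cover any compact set,
    and inner regularity would make the measure of [G] zero. *)
Lemma haar_open_gt0 (W : set G) : open W -> W 1%g -> (0 < mu W)%E.
Proof.
move=> oW W1; have [[_ _ hin] h0 hl] := haar.
rewrite lt0e measure_ge0 andbT; apply/negP => /eqP W0.
have transl r : mu [set (r * s)%g | s in W] = 0%E by rewrite hl//; exact: open_borel.
have otr r : open [set (r * s)%g | s in W].
  have -> : [set (r * s)%g | s in W] = (fun s => (r^-1 * s)%g) @^-1` W.
    apply/seteqP; split=> [_ [s Ws <-] /=|s /= Ws]; first by rewrite mulgA mulVg mul1g.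
    by exists (r^-1 * s)%g => //; rewrite mulgA mulgV mul1g.
  by have /continuousP := @continuous_lmul G r^-1%g; apply.
move/negP: h0; apply; rewrite (hin setT openT); apply/eqP/le_anti/andP; split; last first.
  apply: ereal_sup_ubound; exists set0; last by rewrite measure0.
  by split=> //; exact: compact0.
apply: ge_ereal_sup => _ [C [cC _] <-].
have [D' _ hD'] : finite_subset_cover C (fun r => [set (r * s)%g | s in W]) C.
  move: (cC); rewrite compact_cover; apply; first by move=> i _; exact: otr.
  by move=> x Cx; exists x => //; exists 1%g => //; rewrite mulg1.
have {hD'} : forall x, C x -> exists2 r, r \in (finmap.enum_fset D') & [set (r * s)%g | s in W] x.
  by move=> x /hD'[r /= rD' Nx]; exists r.
move: (finmap.enum_fset D') (compact_borel hG cC) => l {D' cC}.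
elim: l C => [|r l ih] C mC hl'.
  by rewrite (_ : C = set0) ?measure0//; apply/seteqP; split=> // x /hl'[].
have mW := open_borel (otr r).
rewrite (measureDI mu mC mW) -[leRHS]adde0; apply: leeD.
  apply: ih; first exact: measurableD.
  move=> x [Cx nx]; have [s] := hl' x Cx; rewrite inE => /orP[/eqP->//|sl] h.
  by exists s.
by rewrite -(transl r); apply: le_measure; rewrite ?inE//; exact: measurableI.
Qed.

(** This makes the integral of a Urysohn function positive: each set of the
    partition that meets [W] has a tag at which [h] is at least [c]. *)
Lemma riemann_sum_ge (h : G -> R) (W : set G) (c : R) N C P : 0 <= c -> borel_set C -> (mu C < +oo)%E ->
  borel_set W -> (forall x, 0 <= h x) -> (forall r x, W x -> N r x -> c <= h r) ->
  tagged_partition N C P -> c * m (C `&` W) <= \sum_(p <- P) m p.1 * h p.2.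
Proof.
move=> c0 mC Cfin mW h0 hc; elim: P C mC Cfin => [|p P ih] C mC Cfin /=.
  by move=> ->; rewrite set0I measure0 mulr0 big_nil.
move=> [mp pC pN hP]; rewrite big_cons.
have mCW : borel_set (C `&` W) by exact: measurableI.
(* Where p.1 meets W, the gauge transfers the lower bound to the tag of p.1. *)
have CWfin : (mu (C `&` W) < +oo)%E by apply: (measure_finite_sub mCW mC).
rewrite (fine_measureDI mCW mp CWfin) mulrDr; apply: lerD.
  rewrite setIAC (setIidr pC).
  have [[x [px Wx]]|nx] := pselect (exists x, (p.1 `&` W) x).
    rewrite mulrC ler_pM ?fine_measure_ge0//; last exact: (hc _ _ Wx (pN _ px)).
    apply: fine_le; try by rewrite ge0_fin_numE//; apply: (measure_finite_sub _ mC) => //; [exact: measurableI|move=> y [/pC]].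
      by rewrite ge0_fin_numE//; apply: (measure_finite_sub _ mC).
    by apply: le_measure; rewrite ?inE//; exact: measurableI.
  rewrite (_ : p.1 `&` W = set0) ?measure0 ?mulr0 ?mulr_ge0 ?fine_measure_ge0//.
  by apply/seteqP; split=> // x hx; apply: nx; exists x.
rewrite setDE setIAC -setDE; apply: ih => //; first exact: measurableD.
by apply: (measure_finite_sub _ mC) => //; exact: measurableD.
Qed.

(** The densities, with respect to Haar measure, of probability measures carried
    by [B].  They form an approximate identity when [B] shrinks to the
    identity. *)
Definition mollifier (B : set G) (h : G -> R) :=
  [/\ forall s, 0 <= h s, exists C, supported (fun s => (h s)%:K : K^o) C,
      forall s, ~ B s -> h s = 0 & int (fun s => (h s)%:K : K^o) = 1].

(** A Urysohn function exceeds a positive constant on an open neighbourhood of the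
    identity, which has positive measure; so it can be normalised. *)
Lemma mollifier_exists (B : set G) : nbhs 1%g B -> exists h, mollifier B h.
Proof.
move=> B1; have [C cC C1] := compact_nbhs (1%g : G) lcG.
have cD : closed (~` (B `&` C)°) by apply: open_closedC; exact: open_interior.
have n1 : ~ (~` (B `&` C)°) 1%g.
  by move=> /(_ _); apply; apply: filterI.
have [f [cf f01 f0 f1]] :=
  (@uniform_separatorP G R _ _).1 (@locally_compact_completely_regular G R lcG hG _ _ cD n1).
pose h s := 1 - f s.
have f01' s : 0 <= f s <= 1 by have /= := f01 (f s) (ex_intro2 _ _ s Logic.I erefl); rewrite in_itv.
have h0 s : 0 <= h s by rewrite subr_ge0; have /andP[] := f01' s.
have hout s : ~ (B `&` C)° s -> h s = 0.
  move=> ns; rewrite /h (_ : f s = 1) ?subrr//; apply: (f1 (f s)).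
  by exists s.
have cK : continuous (fun s => (h s)%:K : K^o).
  apply/continuous_rnormP => s e e0.
  have := (@cvgr_dist_lt _ R^o _ (nbhs s) (nbhs_filter s) f (f s)) (cf s) e e0.
  apply: filterS => t /=; rewrite -rmorphB rnorm_of_real /h => ht.
  by rewrite (_ : 1 - f t - (1 - f s) = f s - f t)//; ring.
have sC : supported (fun s => (h s)%:K : K^o) C.
  split=> // s Cs; rewrite hout ?rmorph0// => /interior_subset[_ /Cs]//.
pose W := [set s | 1/2 < h s].
have oW : open W.
  rewrite openE => s /= Ws.
  have e0 : 0 < h s - 1/2 by rewrite subr_gt0.
  have := (continuous_rnormP _).1 cK s _ e0; apply: filterS => t /=.
  by rewrite -rmorphB rnorm_of_real ltr_norml /W /= => /andP[]; lra.
have W1 : W 1%g.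
  by rewrite /W /= /h (_ : f 1%g = 0) ?subr0; [lra|apply: (f0 (f 1%g)); exists 1%g].
have WC : C `&` W = W.
  apply: setIidr => s Ws; apply: contrapT => nC; move: Ws.
  by rewrite /W /= hout; [lra|move=> /interior_subset[]].
have mC := compact_borel hG cC; have Cfin := haar_compact cC.
have mW := open_borel oW.
have W0 : 0 < m W.
  have := haar_open_gt0 oW W1; rewrite -lte_fin fineK_measure//.
  by apply: (measure_finite_sub mW mC) => //; rewrite -WC => x [].
set c := int (fun s => (h s)%:K : K^o).
have cR : c = (scalar_Re c)%:K.
  have eqc : int ((fun z : K^o => (scalar_Re z)%:K : K^o) \o (fun s => (h s)%:K : K^o)) = (scalar_Re c)%:K.
    apply: (@int_semilinear R k G mu haar_compact hG _ _ (fun z : K^o => (scalar_Re z)%:K : K^o) 1 _ C) => //.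
    - exact: scalar_family_complete.
    - exact: scalar_family_complete.
    - by move=> x y; rewrite raddfD rmorphD.
    - by move=> a x; rewrite mulr_of_real_Re rmorphM.
    - by move=> x; rewrite rnorm_of_real mul1r; exact: Re_le_norm.
  rewrite -eqc; congr bochner_integral; apply/funext => s /=.
  by rewrite Re_of_real.
have c0 : 1/4 * m W <= scalar_Re c.
  apply/ler_addgt0Pr => d d0.
  have mC0 := fine_measure_ge0 mu C; have mC1 : 0 < m C + 1 by rewrite ltr_pwDr.
  have e0 : 0 < Num.min (1/4) (d / (m C + 1)) by rewrite lt_min; apply/andP; split; [lra|exact: divr_gt0].
  set e := Num.min _ _ in e0.
  have e4 : e <= 1/4 by rewrite ge_min lexx.
  have ed : e * m C <= d.
    have : e <= d / (m C + 1) by rewrite ge_min lexx orbT.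
    by rewrite ler_pdivlMr// => h1; have := ltW e0; nra.
  have [P hP] := partition_exists hG cC (fun r _ => gauge_nbhs r cK e0).
  have h1 := int_gauge haar_compact hG (@scalar_family_complete R k) sC (ltW e0) hP (fun r => @subset_refl _ _).
  have h2 : 1/4 * m W <= \sum_(p <- P) m p.1 * h p.2.
    rewrite -{1}WC; apply: (riemann_sum_ge _ mC Cfin mW h0 _ hP); first by lra.
    move=> r x; rewrite /W /gauge /= -rmorphB rnorm_of_real ler_norml => h3 /andP[_ h4]; lra.
  have h3 : RS P (fun s => (h s)%:K : K^o) = (\sum_(p <- P) m p.1 * h p.2)%:K.
    by rewrite /riemann_sum rmorph_sum; apply: eq_bigr => p _; rewrite rmorphM.
  move: h1; rewrite h3 -/c cR -rmorphB rnorm_of_real ler_norml => /andP[h4 h5].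
  rewrite Re_of_real; lra.
have c1 : 0 < scalar_Re c by apply: lt_le_trans c0; rewrite mulr_gt0//; lra.
exists (fun s => (scalar_Re c)^-1 * h s).
have eqh : (fun s => ((scalar_Re c)^-1 * h s)%:K : K^o) = (fun s => ((scalar_Re c)^-1)%:K *: ((h s)%:K : K^o)).
  by apply/funext => s; rewrite rmorphM.
split.
- by move=> s; rewrite mulr_ge0// invr_ge0 ltW.
- by exists C; rewrite eqh; exact: supported_scale sC.
- by move=> s Bs; rewrite hout ?mulr0// => /interior_subset[].
- rewrite eqh (intZ haar_compact hG _ (@scalar_family_complete R k) sC) -/c.
  rewrite {2}cR; apply: etrans (esym (rmorphM _ _ _)) _.
  by rewrite mulVf ?rmorph1// gt_eqF.
Qed.

Lemma mollifier_Cc B h : mollifier B h -> Cc (fun s => (h s)%:K : K).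
Proof. by move=> [_ [C sC] _ _]; exact: supported_Cc sC hG. Qed.

(** The average of [g] for a probability measure carried by a set on which [g] is
    nearly constant. *)
Lemma approximate_identity (X : normedModType K) (g : G -> X) (B : set G) (h : G -> R) (e : R) :
  family_complete X -> continuous g -> 0 <= e -> mollifier B h ->
  (forall s, B s -> rnorm (g s - g 1%g) <= e) ->
  rnorm (int (fun s => (h s)%:K *: g s) - g 1%g) <= e.
Proof.
move=> cX cg e0 [h0 [C sC] hB hI] hg.
have ccst (v : X) : continuous (fun _ : G => v) by move=> x; exact: cvg_cst.
have s1 := supportedZ sC cg.
have s2 := supportedZ sC (ccst (- g 1%g)).
have i2 : int (fun s => (h s)%:K *: (- g 1%g)) = - g 1%g.
  have := @int_linear_map R k G mu haar_compact hG K^o X (fun c : K^o => c *: (- g 1%g)) _ C (@scalar_family_complete R k) cX _ sC.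
  rewrite hI scale1r; apply.
  apply: (@bounded_operator_of_bound _ _ _ _ _ (rnorm (- g 1%g))).
    by move=> a u v; rewrite scalerDl scalerA.
  by move=> x; rewrite rnormZ mulrC.
rewrite -i2 -(intD haar_compact hG cX s1 s2).
have := @int_dominated R k G mu haar_compact hG X (fun s => (h s)%:K *: g s + (h s)%:K *: - g 1%g) h C e cX (supportedD s1 s2) sC.
rewrite hI (_ : scalar_Re 1 = 1) ?mulr1; last by rewrite -(rmorph1 (@scalar_of_real R k)) Re_of_real.
apply=> s; rewrite -scalerDr rnormZ_ge0// mulrC.
have [Bs|Bs] := pselect (B s); first by rewrite ler_wpM2r// hg.
by rewrite hB// !mulr0.
Qed.

End haar.

(** * Integrated forms and the crossed product *)

Lemma dense_lipschitz_eq (R : realType) (k : scalars) (E Y : normedModType (scalar_field R k))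
    (D : set E) (F F' : E -> Y) (M : R) : dense D ->
  (forall a b, rnorm (F a - F b) <= M * rnorm (a - b)) ->
  (forall a b, rnorm (F' a - F' b) <= M * rnorm (a - b)) ->
  (forall a, D a -> F a = F' a) -> forall a, F a = F' a.
Proof.
move=> /dense_rnormP dD hF hF' h a; apply: (rnorm_eps_eq (`|M| * 2)) => e e0.
have [b Db hb] := dD a e e0.
have M1 x : M * rnorm x <= `|M| * rnorm (x : E) by rewrite ler_wpM2r ?rnorm_ge0 ?ler_norm.
have h1 : rnorm (F a - F b) <= `|M| * e.
  apply: le_trans (hF _ _) _; apply: le_trans (M1 _) _.
  by rewrite ler_wpM2l// rdistC ltW.
have h2 : rnorm (F b - F' a) <= `|M| * e.
  rewrite h//; apply: le_trans (hF' _ _) _; apply: le_trans (M1 _) _.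
  by rewrite ler_wpM2l// ltW.
by apply: le_trans (rdist_triangle (F b) _ _) _; lra.
Qed.

Section integrated_form.
Context {R : realType} {k : scalars} {G : topGroupType}.
Variable mu : {measure set (borel G) -> \bar R}.
Local Notation K := (scalar_field R k).
Local Notation m A := (fine (mu A)).
Hypothesis hG : hausdorff_space G.
Hypothesis lcG : locally_compact [set: G].
Hypothesis haar : left_haar_measure mu.
Local Notation int g := (bochner_integral mu g).
Let mu_compact := haar_compact haar.
Variable nu : G -> R.
Hypothesis nu0 : forall r, 0 <= nu r.
Hypothesis nu_bounded : forall C : set G, compact C -> has_ubound (nu @` C).

Lemma nu_bound (C : set G) : compact C -> exists2 N : R, 0 <= N & forall s, C s -> nu s <= N.
Proof.
move=> /nu_bounded[N hN]; exists `|N| => // s Cs.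
by apply: le_trans (ler_norm N); apply: hN; exists s.
Qed.

Section one_representation.
Variable p : operator_family R k G.
Hypotheses (rep : group_representation p) (cont : strongly_continuous p) (bnd : bounded_by nu p).
Local Notation U := (op p).
Local Notation X := (space p).
Let cX : family_complete X := @banach_family_complete R k X.

Lemma rep_linear r : linear (U r). Proof. by have [/(_ r)[]] := rep. Qed.
Lemma rep1 x : U 1%g x = x. Proof. by have [_ -> _] := rep. Qed.
Lemma repM r s x : U (r * s)%g x = U r (U s x). Proof. by have [_ _ ->] := rep. Qed.
Lemma rep_bound r x : rnorm (U r x) <= nu r * rnorm x.
Proof.
have [/(_ r) br _ _] := rep; apply: le_trans (opnorm_bound _ br) _.
by rewrite ler_wpM2r ?rnorm_ge0//; exact: bnd.
Qed.

Lemma orbit_continuous x : continuous (fun r => U r x). Proof. exact: cont. Qed.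

Lemma orbit_supported f C x : supported (f : G -> K^o) C -> supported (fun s => f s *: U s x) C.
Proof. by move=> sf; apply: supportedZ sf _; exact: orbit_continuous. Qed.

Lemma integrated_bound (C : set G) (N e : R) (f : G -> K^o) x :
  0 <= N -> (forall s, C s -> nu s <= N) ->
  supported f C -> (forall s, rnorm (f s) <= e) ->
  rnorm (integrated mu p f x) <= N * m C * e * rnorm x.
Proof.
move=> N0 hN sf he; have e0 : 0 <= e := le_trans (rnorm_ge0 _) (he 1%g).
have -> : N * m C * e * rnorm x = e * N * rnorm x * m C by ring.
apply: (int_bound mu_compact hG cX (orbit_supported x sf)) => s.
rewrite rnormZ -mulrA; have [Cs|Cs] := pselect (C s).
  apply: ler_pM; rewrite ?rnorm_ge0//; apply: le_trans (rep_bound _ _) _.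
  by rewrite ler_wpM2r ?rnorm_ge0// hN.
have [_ _ f0] := sf; rewrite f0// rnorm0 mul0r mulr_ge0// mulr_ge0//.
exact: rnorm_ge0.
Qed.

Lemma integrated_functional x : Cc_functional (fun f => integrated mu p f x).
Proof.
split.
  move=> c f g Cf Cg; have [C /(orbit_supported x) sf /(orbit_supported x) sg] := Cc_supported2 Cf Cg.
  rewrite /integrated -(intZ mu_compact hG c cX sf).
  rewrite -(intD mu_compact hG cX (supported_scale c sf) sg).
  by congr bochner_integral; apply/funext => s; rewrite scalerDl scalerA.
move=> C cC; have [N N0 hN] := nu_bound cC.
exists (N * m C * rnorm x); first by rewrite !mulr_ge0// ?fine_measure_ge0// rnorm_ge0.
by move=> f e sf he; rewrite mulrAC; exact: integrated_bound.
Qed.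

Lemma integrated_linear f : Cc f -> linear (integrated mu p f).
Proof.
move=> /Cc_supported[C sf] c x y; rewrite /integrated.
have sx := orbit_supported x sf; have sy := orbit_supported y sf.
rewrite -(intZ mu_compact hG c cX sx) -(intD mu_compact hG cX (supported_scale c sx) sy).
congr bochner_integral; apply/funext => s.
by rewrite rep_linear scalerDr !scalerA mulrC.
Qed.

Lemma integrated_bounded f : Cc f -> bounded_operator (integrated mu p f).
Proof.
move=> Cf; have [C sf] := Cc_supported Cf; have [_ cC _] := sf.
have [N N0 hN] := nu_bound cC; have [e e0 he] := supported_bounded sf.
apply: (@bounded_operator_of_bound _ _ _ _ _ (N * m C * e)); first exact: integrated_linear.
by move=> x; exact: integrated_bound.
Qed.

Lemma integrated_translate r f x : Cc f ->
  integrated mu p (translate r f) x = U r (integrated mu p f x).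
Proof.
move=> /Cc_supported[C sf].
have br : bounded_operator (U r) by have [h _ _] := rep; exact: h.
rewrite /integrated -(int_linear_map mu_compact hG cX cX br (orbit_supported x sf)).
have s1 := supported_lip (fun x y => linear_mapD x y (rep_linear r)) (rep_bound r) (orbit_supported x sf).
rewrite -(haar_left hG haar r^-1%g cX s1); congr bochner_integral.
apply/funext => s /=; rewrite linear_mapZ//; last exact: rep_linear.
by rewrite -repM mulgA mulgV mul1g.
Qed.

(** By [functional_convolution], [convolution mu f g] acts as the integral of
    [f r] times the operator of [translate r g]. *)
Lemma integrated_convolution f g x : Cc f -> Cc g ->
  integrated mu p (convolution mu f g) x = integrated mu p f (integrated mu p g x).
Proof.
move=> Cf Cg.
rewrite (functional_convolution mu_compact hG (integrated_functional x) cX Cf Cg).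
by congr bochner_integral; apply/funext => r; rewrite integrated_translate.
Qed.

Lemma integrated_mollifier x e : 0 < e -> exists2 B, nbhs (1%g : G) B &
  forall h, mollifier (k := k) mu B h -> rnorm (integrated mu p (fun s => (h s)%:K) x - x) <= e.
Proof.
move=> e0; exists (gauge (fun s => U s x) e 1%g).
  by apply: gauge_nbhs => //; exact: orbit_continuous.
move=> h hB; rewrite -{2}(rep1 x).
by apply: (approximate_identity hG haar cX (@orbit_continuous x) (ltW e0) hB).
Qed.

End one_representation.

Lemma mollifier_sub B B' h : B `<=` B' -> mollifier (k := k) mu B h -> mollifier (k := k) mu B' h.
Proof. by move=> BB' [h0 hC hB hI]; split=> // s nB; apply: hB => /BB'. Qed.

Variable RR : operator_family R k G -> Prop.
Hypothesis RR_nonempty : exists p, RR p.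
Hypothesis RR_rep : forall p, RR p ->
  [/\ group_representation p, strongly_continuous p & bounded_by nu p].

Lemma seminorm_le (f : G -> K) (M : R) :
  (forall p, RR p -> opnorm (integrated mu p f) <= M) -> crossed_seminorm mu RR f <= M.
Proof.
move=> h; apply: ge_sup.
  by have [p Rp] := RR_nonempty; exists (opnorm (integrated mu p f)), p.
by move=> _ [p Rp ->]; exact: h.
Qed.

(** The supremum that defines the seminorm is finite, because the bound of an
    integrated form depends on the representation through [nu] only. *)
Lemma seminorm_ge (f : G -> K) p : Cc f -> RR p -> opnorm (integrated mu p f) <= crossed_seminorm mu RR f.
Proof.
move=> /Cc_supported[C sf] Rp; have [_ cC _] := sf.
apply: ub_le_sup; last by exists p.
have [N N0 hN] := nu_bound cC; have [e e0 he] := supported_bounded sf.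
exists (N * m C * e) => _ [p' /RR_rep[r1 r2 r3] ->].
apply: opnorm_le => [|x]; first by rewrite !mulr_ge0// fine_measure_ge0.
exact: (integrated_bound r1 r2 r3).
Qed.

Variable A : crossed_product mu RR.
Local Notation q := (cp_map A).
Let cA : family_complete A := @banach_family_complete R k A.

Lemma cp_map_bound f p x : Cc f -> RR p -> rnorm (integrated mu p f x) <= rnorm (q f) * rnorm x.
Proof.
move=> Cf Rp; have [r1 r2 r3] := RR_rep Rp.
apply: le_trans (opnorm_bound _ (integrated_bounded r1 r2 r3 Cf)) _.
by rewrite ler_wpM2r ?rnorm_ge0// cp_map_norm//; exact: seminorm_ge.
Qed.

Lemma cp_map_le f (M : R) : Cc f -> 0 <= M ->
  (forall p x, RR p -> rnorm (integrated mu p f x) <= M * rnorm x) -> rnorm (q f) <= M.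
Proof.
move=> Cf M0 h; rewrite cp_map_norm//; apply: seminorm_le => p Rp.
by apply: opnorm_le => // x; exact: h.
Qed.

Lemma cp_functional : Cc_functional q.
Proof.
split; first by move=> c f g Cf Cg; exact: cp_map_linear.
move=> C cC; have [N N0 hN] := nu_bound cC.
exists (N * m C); first by rewrite mulr_ge0// fine_measure_ge0.
move=> f e sf he; have e0 : 0 <= e := le_trans (rnorm_ge0 _) (he 1%g).
apply: cp_map_le; [exact: supported_Cc sf hG|by rewrite !mulr_ge0// fine_measure_ge0|].
by move=> p x /RR_rep[r1 r2 r3]; exact: (integrated_bound r1 r2 r3).
Qed.

Lemma cp_mapB f g : Cc f -> Cc g -> q (fun s => f s - g s) = q f - q g.
Proof.
move=> Cf Cg; have := cp_map_linear A (-1) Cg Cf; rewrite scaleN1r addrC => <-.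
by congr cp_map; apply/funext => s; rewrite mulN1r addrC.
Qed.

(** In each representation, translating [f] by [r] multiplies its operator by
    [U_r] on the left. *)
Lemma cp_map_translate r f : Cc f -> rnorm (q (translate r f)) <= nu r * rnorm (q f).
Proof.
move=> Cf; apply: cp_map_le; first exact: Cc_translate.
  by rewrite mulr_ge0// rnorm_ge0.
move=> p x Rp; have [r1 r2 r3] := RR_rep Rp; rewrite integrated_translate//.
apply: le_trans (rep_bound r1 r3 _ _) _; rewrite -mulrA ler_wpM2l//.
exact: cp_map_bound.
Qed.

Lemma cp_map_mollifier (B : set G) h (c : R) : mollifier (k := k) mu B h -> 0 <= c ->
  (forall s, B s -> nu s <= c) -> rnorm (q (fun s => (h s)%:K)) <= c.
Proof.
move=> hB c0 hc; have [h0 [C sC] hB0 hI] := hB.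
apply: cp_map_le => //; first exact: supported_Cc sC hG.
move=> p x Rp; have [r1 r2 r3] := RR_rep Rp.
have := @int_dominated R k G mu mu_compact hG (space p) (fun s => (h s)%:K *: op p s x) h C (c * rnorm x)
  (@banach_family_complete R k _) (orbit_supported r2 x sC) sC.
rewrite hI (_ : scalar_Re 1 = 1) ?mulr1; last by rewrite -(rmorph1 (@scalar_of_real R k)) Re_of_real.
apply=> s; rewrite rnormZ_ge0// mulrC; have [Bs|Bs] := pselect (B s).
  rewrite ler_wpM2r//; apply: le_trans (rep_bound r1 r3 _ _) _.
  by rewrite ler_wpM2r ?rnorm_ge0// hc.
by rewrite hB0// !mulr0.
Qed.

(** The product is an average of the [q (translate s g)], which depend
    continuously on [s]. *)
Lemma cp_map_mollifier_mul g e : Cc g -> 0 < e -> exists2 B, nbhs (1%g : G) B &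
  forall h, mollifier (k := k) mu B h -> rnorm (amul (q (fun s => (h s)%:K)) (q g) - q g) <= e.
Proof.
move=> Cg e0; have cq := continuous_functional_translate hG lcG cp_functional Cg.
exists (gauge (fun s => q (translate s g)) e 1%g); first exact: gauge_nbhs.
move=> h hB; rewrite -cp_map_mul//; last exact: mollifier_Cc hB.
rewrite (functional_convolution mu_compact hG cp_functional cA (mollifier_Cc hG hB) Cg).
have {2}-> : g = translate 1%g g by apply/funext => s; rewrite /translate invg1 mul1g.
by apply: (approximate_identity hG haar cA cq (ltW e0) hB).
Qed.

End integrated_form.

(** * From representations of the group to representations of the algebra *)

Lemma operator_family_eta (R : realType) (k : scalars) (I : Type) (p : operator_family R k I)
    (v : I -> space p -> space p) :
  (forall i x, v i x = op p i x) -> OperatorFamily v = p.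
Proof.
case: p v => X u v h; congr OperatorFamily.
by apply/funext => i; apply/funext => x; exact: h.
Qed.

Section algebra_rep.
Context {R : realType} {k : scalars} {A : banach_algebra R k}.
Local Notation K := (scalar_field R k).
Variable p : operator_family R k A.
Hypothesis rep : algebra_representation p.

Lemma arep_linear a : linear (op p a). Proof. by have [/(_ a)[]] := rep. Qed.
Lemma arep_lin c a b x : op p (c *: a + b) x = c *: op p a x + op p b x.
Proof. by have [_ h _] := rep; exact: h. Qed.
Lemma arep_linear_r x : linear (fun a => op p a x).
Proof. by move=> c a b; exact: arep_lin. Qed.
Lemma arepB a b x : op p (a - b) x = op p a x - op p b x.
Proof. exact: (linear_mapB _ _ (arep_linear_r x)). Qed.
Lemma arepM a b x : op p (amul a b) x = op p a (op p b x).
Proof. by have [_ _ ->] := rep. Qed.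

Hypothesis ctr : contractive p.

Lemma arep_bound a x : rnorm (op p a x) <= rnorm a * rnorm x.
Proof.
have [/(_ a) ba _ _] := rep; apply: le_trans (opnorm_bound _ ba) _.
by rewrite ler_wpM2r ?rnorm_ge0//; exact: ctr.
Qed.

Lemma arep_dist a b x : rnorm (op p a x - op p b x) <= rnorm x * rnorm (a - b).
Proof. by rewrite -arepB mulrC; exact: arep_bound. Qed.

End algebra_rep.

Section lspan.
Context {R : realType} {k : scalars}.
Local Notation K := (scalar_field R k).
Variable X : normedModType K.

Lemma lspan_sub (S : set X) : S `<=` lspan S.
Proof. exact: sub_gen_smallest. Qed.

Lemma lspan_min (S L : set X) : linear_subspace L -> S `<=` L -> lspan S `<=` L.
Proof. exact: smallest_sub. Qed.

Lemma closure_subspace (L : set X) : linear_subspace L -> linear_subspace (closure L).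
Proof.
move=> [L0 hL]; split; first exact: subset_closure.
move=> c x y /closure_rnormP hx /closure_rnormP hy; apply/closure_rnormP => e e0.
have c1 : 0 < rnorm (c : K^o) + 1 by rewrite ltr_pwDr// rnorm_ge0.
have e1 : 0 < e / 2 / (rnorm (c : K^o) + 1) by rewrite !divr_gt0.
have [x' Lx' hx'] := hx _ e1; have [y' Ly' hy'] := hy (e / 2) (divr_gt0 e0 (ltr0Sn _ 1)).
exists (c *: x' + y'); first exact: hL.
rewrite opprD addrACA -scalerBr; apply: le_lt_trans (rnormD _ _) _.
rewrite (splitr e); apply: ler_ltD => //.
rewrite rnormZ; move: hx'; rewrite ltr_pdivlMr// => /ltW; apply: le_trans.
by rewrite mulrC ler_wpM2l ?rnorm_ge0// lerDl.
Qed.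

End lspan.

Section crossed.
Context {R : realType} {k : scalars} {G : topGroupType}.
Variable mu : {measure set (borel G) -> \bar R}.
Local Notation K := (scalar_field R k).
Hypothesis hG : hausdorff_space G.
Hypothesis lcG : locally_compact [set: G].
Hypothesis haar : left_haar_measure mu.
Local Notation int g := (bochner_integral mu g).
Variable nu : G -> R.
Hypothesis nu0 : forall r, 0 <= nu r.
Hypothesis nu_bounded : forall C : set G, compact C -> has_ubound (nu @` C).
Variable RR : operator_family R k G -> Prop.
Hypothesis RR_nonempty : exists p, RR p.
Hypothesis RR_rep : forall p, RR p ->
  [/\ group_representation p, strongly_continuous p & bounded_by nu p].
Variable A : crossed_product mu RR.
Local Notation q := (cp_map A).

Lemma cp_approx (a : A) (e : R) : 0 < e -> exists2 f, Cc f & rnorm (q f - a) < e.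
Proof.
move=> e0; have [_ [f Cf <-] hf] := (dense_rnormP _).1 (@cp_map_dense _ _ _ _ _ A) a e e0.
by exists f.
Qed.

Lemma cp_map_dense_eq (Y : normedModType K) (F F' : A -> Y) (M : R) :
  (forall a b, rnorm (F a - F b) <= M * rnorm (a - b)) ->
  (forall a b, rnorm (F' a - F' b) <= M * rnorm (a - b)) ->
  (forall f, Cc f -> F (q f) = F' (q f)) -> forall a, F a = F' a.
Proof.
move=> hF hF' h; apply: (dense_lipschitz_eq (@cp_map_dense _ _ _ _ _ A) hF hF').
by move=> _ [f Cf <-]; exact: h.
Qed.

Definition crossed_rep_spec (p : operator_family R k G) (T : A -> space p -> space p) :=
  [/\ algebra_representation (OperatorFamily T), contractive (OperatorFamily T)
    & forall f, Cc f -> T (q f) = integrated mu p f].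

(** For each [x], the map that sends [q f] to [integrated mu p f x] is Lipschitz
    and extends to [A].  The algebraic identities hold on [Cc] and pass to the
    limit. *)
Lemma crossed_rep_spec_exists p : RR p -> exists T, crossed_rep_spec (p := p) T.
Proof.
move=> Rp; have [r1 r2 r3] := RR_rep Rp.
have ext x : exists T : A -> space p, [/\ forall f, Cc f -> T (q f) = integrated mu p f x
    & forall a b, rnorm (T a - T b) <= rnorm x * rnorm (a - b)].
  have [|T hT1 hT2] := @lipschitz_extension R k (G -> K) Cc A (space p) q (fun f => integrated mu p f x)
    (rnorm x) (@banach_family_complete R k _) (rnorm_ge0 x) (@cp_map_dense _ _ _ _ _ A); last by exists T.
  move=> f g Cf Cg; rewrite mulrC -(cp_mapB A Cf Cg).
  rewrite -(functionalB (integrated_functional hG haar nu_bounded r1 r2 r3 x) Cf Cg).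
  by apply: (cp_map_bound hG haar nu_bounded RR_rep A) => //; exact: CcB.
have [S hS] := choice ext; pose T a x := S x a; exists T.
have Tq f (Cf : Cc f) x : T (q f) x = integrated mu p f x by have [h _] := hS x; exact: h.
have Tlip x a b : rnorm (T a x - T b x) <= rnorm x * rnorm (a - b) by have [_ h] := hS x; exact: h.
have Tadd c a b x : T (c *: a + b) x = c *: T a x + T b x.
  move: b; apply: (@cp_map_dense_eq _ _ _ (rnorm x)).
  - by move=> b b'; apply: le_trans (Tlip _ _ _) _; rewrite opprD addrACA subrr add0r.
  - by move=> b b'; rewrite opprD addrACA subrr add0r.
  move=> g Cg; move: a; apply: (@cp_map_dense_eq _ _ _ (rnorm x * rnorm (c : K^o))).
  - move=> a a'; apply: le_trans (Tlip _ _ _) _.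
    by rewrite opprD addrACA subrr addr0 -scalerBr rnormZ mulrA.
  - move=> a a'; rewrite opprD addrACA subrr addr0 -scalerBr rnormZ.
    by rewrite mulrAC mulrC ler_wpM2r ?rnorm_ge0.
  move=> f Cf; rewrite -cp_map_linear// !Tq//; last exact: Cc_lin.
  by have [h1 _] := integrated_functional hG haar nu_bounded r1 r2 r3 x; exact: h1.
have T0 x : T 0 x = 0 by have := Tadd (-1) 0 0 x; rewrite !scaleN1r oppr0 addr0 addNr.
have Tbound a x : rnorm (T a x) <= rnorm a * rnorm x.
  by have := Tlip x a 0; rewrite T0 !subr0 mulrC.
have Tlin a : linear (T a).
  move=> c x y; move: a; apply: (@cp_map_dense_eq _ _ _ (rnorm (c : K^o) * rnorm x + rnorm y)).
  - move=> a b; apply: le_trans (Tlip _ _ _) _.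
    by rewrite ler_wpM2r ?rnorm_ge0// (le_trans (rnormD _ _))// rnormZ.
  - move=> a b; rewrite opprD addrACA -scalerBr; apply: le_trans (rnormD _ _) _.
    by rewrite mulrDl rnormZ -mulrA lerD// ler_wpM2l ?rnorm_ge0.
  by move=> f Cf; rewrite !Tq// integrated_linear.
have Tbo a : bounded_operator (T a) by apply: bounded_operator_of_bound (Tlin a) (Tbound a).
split.
- split=> // a b; apply/funext => x /=.
  move: a; apply: (@cp_map_dense_eq _ _ _ (rnorm x * rnorm b)).
  + move=> a a'; apply: le_trans (Tlip _ _ _) _; rewrite -mulrA ler_wpM2l ?rnorm_ge0//.
    rewrite -(linear_mapB _ _ (fun c u v => amul_linear_l b c u v)).
    by rewrite mulrC; exact: amul_norm.
  + move=> a a'; apply: le_trans (Tlip _ _ _) _; rewrite ler_wpM2r ?rnorm_ge0//.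
    by rewrite mulrC; exact: Tbound.
  move=> f Cf; move: b; apply: (@cp_map_dense_eq _ _ _ (rnorm x * rnorm (q f))).
  + move=> b b'; apply: le_trans (Tlip _ _ _) _; rewrite -mulrA ler_wpM2l ?rnorm_ge0//.
    by rewrite -(linear_mapB _ _ (amul_linear_r (q f))); exact: amul_norm.
  + move=> b b'; rewrite -linear_mapB//; apply: le_trans (Tbound _ _) _.
    by rewrite mulrC [leRHS]mulrAC ler_wpM2r ?rnorm_ge0// Tlip.
  move=> g Cg; rewrite -(cp_map_mul A Cf Cg) (Tq _ (Cc_convolution (haar_compact haar) hG Cf Cg)).
  rewrite (Tq g Cg).
  rewrite (Tq f Cf).
  have := (integrated_convolution hG haar nu_bounded r1 r2 r3 x Cf Cg).
  by [].
- by move=> a; apply: opnorm_le; [exact: rnorm_ge0|exact: Tbound].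
- by move=> f Cf; apply/funext => x; exact: Tq.
Qed.

Lemma crossed_rep_spec_unique p T T' : crossed_rep_spec (p := p) T -> crossed_rep_spec (p := p) T' -> T = T'.
Proof.
move=> [r1 c1 h1] [r2 c2 h2]; apply/funext => a; apply/funext => x; move: a.
apply: (@cp_map_dense_eq _ _ _ (rnorm x)).
- by move=> a b; exact: (arep_dist r1 c1).
- by move=> a b; exact: (arep_dist r2 c2).
by move=> f Cf; rewrite h1// h2.
Qed.

Lemma crossed_repP p : RR p -> crossed_rep_spec (op (crossed_rep A p) : A -> space p -> space p).
Proof. by move=> /crossed_rep_spec_exists[T hT]; exact: (xgetI _ hT). Qed.

Lemma crossed_repE p T : RR p -> crossed_rep_spec (p := p) T -> crossed_rep A p = OperatorFamily T.
Proof.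
move=> Rp hT; have := crossed_rep_spec_unique (crossed_repP Rp) hT => <-.
by case: p Rp T hT.
Qed.

(** The operator of [translate r h] is [U_r] times that of [h], which averages
    [U_s x] over [s] near the identity. *)
Lemma crossed_rep_orbit p x e (r : G) : RR p -> 0 < e -> exists2 B, nbhs (1%g : G) B &
  forall h, mollifier (k := k) mu B h ->
    rnorm (op (crossed_rep A p) (q (translate r (fun s => (h s)%:K))) x - op p r x) <= nu r * e.
Proof.
move=> Rp e0; have [r1 r2 r3] := RR_rep Rp; have [_ _ hT] := crossed_repP Rp.
have [B B1 hB] := integrated_mollifier hG haar r1 r2 x e0.
exists B => // h hh; have Ch := mollifier_Cc hG hh.
rewrite hT; last exact: Cc_translate.
rewrite (integrated_translate hG haar r1 r2 r3)// -linear_mapB; last exact: rep_linear.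
by apply: le_trans (rep_bound r1 r3 _ _) _; rewrite ler_wpM2l// hB.
Qed.

Lemma crossed_rep_nondegenerate p : RR p -> nondegenerate (crossed_rep A p).
Proof.
move=> Rp; have [r1 r2 r3] := RR_rep Rp; have [_ _ hT] := crossed_repP Rp.
apply/dense_rnormP => x e e0.
have [B B1 hB] := integrated_mollifier hG haar r1 r2 x (divr_gt0 e0 (ltr0Sn _ 1)).
have [h hh] := mollifier_exists (k := k) hG lcG haar B1.
exists (op (crossed_rep A p) (q (fun s => (h s)%:K)) x).
  by apply: lspan_sub; exists (q (fun s => (h s)%:K)), x.
rewrite hT; last exact: mollifier_Cc hh.
by apply: le_lt_trans (hB h hh) _; rewrite ltr_pdivrMr// ltr_pMr// ltr1n.
Qed.

(** Integrals stay in a closed subspace; conversely [U_r x] is a limit of vectors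
    to which elements of [A] have sent [x]. *)
Lemma crossed_rep_invariant p : RR p ->
  closed_invariant_subspace p = closed_invariant_subspace (crossed_rep A p).
Proof.
move=> Rp; have [r1 r2 r3] := RR_rep Rp; have [t1 t2 hT] := crossed_repP Rp.
apply/seteqP; split=> L [sL cL hL]; split=> //.
  move=> a x Lx; apply: (closed_rnorm (rnorm x)) => // e e0.
  have [f Cf hf] := cp_approx a e0.
  exists (op (crossed_rep A p) (q f) x).
    rewrite hT//; have [C sf] := Cc_supported Cf.
    apply: (int_closed (haar_compact haar) hG (@banach_family_complete R k _) sL cL (orbit_supported r2 x sf)).
    move=> s; rewrite -[_ *: _]addr0; apply: sL.2; [exact: hL|exact: sL.1].
  by apply: le_trans (arep_dist t1 t2 _ _ _) _; rewrite ler_wpM2l ?rnorm_ge0// ltW.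
move=> r x Lx; apply: (closed_rnorm (nu r)) => // e e0.
have [B B1 hB] := crossed_rep_orbit x r Rp e0.
have [h hh] := mollifier_exists (k := k) hG lcG haar B1.
by exists (op (crossed_rep A p) (q (translate r (fun s => (h s)%:K))) x); [exact: hL|exact: hB].
Qed.

(** Bounded operators commute with integrals; conversely both sides are limits
    for the same mollifiers. *)
Lemma crossed_rep_intertwiner p p' : RR p -> RR p' ->
  bounded_intertwiner p p' = bounded_intertwiner (crossed_rep A p) (crossed_rep A p').
Proof.
move=> Rp Rp'; have [r1 r2 r3] := RR_rep Rp; have [t1 t2 hT] := crossed_repP Rp.
have [r1' r2' r3'] := RR_rep Rp'; have [t1' t2' hT'] := crossed_repP Rp'.
apply/seteqP; split=> S [bS hS]; split=> //.
  have [M M0 hM] := bounded_operator_bound bS; have [lS _] := bS.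
  move=> a x; move: a.
  apply: (@cp_map_dense_eq _ _ _ (M * rnorm x + rnorm (S x))).
  - move=> a b; rewrite -(linear_mapB _ _ lS); apply: le_trans (hM _) _.
    apply: le_trans (ler_wpM2l M0 (arep_dist t1 t2 _ _ _)) _.
    by rewrite mulrA ler_wpM2r ?rnorm_ge0// lerDl rnorm_ge0.
  - move=> a b; apply: le_trans (arep_dist t1' t2' _ _ _) _.
    by rewrite ler_wpM2r ?rnorm_ge0// lerDr mulr_ge0// rnorm_ge0.
  move=> f Cf; rewrite hT// hT'//; have [C sf] := Cc_supported Cf.
  rewrite /integrated -(int_linear_map (haar_compact haar) hG (@banach_family_complete R k _) (@banach_family_complete R k _) bS (orbit_supported r2 x sf)).
  by congr bochner_integral; apply/funext => s /=; rewrite linear_mapZ// hS.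
have [M M0 hM] := bounded_operator_bound bS; have [lS _] := bS.
move=> r x; apply: (rnorm_eps_eq (M * nu r + nu r)) => e e0.
have [B B1 hB] := crossed_rep_orbit x r Rp e0.
have [B' B1' hB'] := crossed_rep_orbit (S x) r Rp' e0.
have [h hh] := mollifier_exists (k := k) hG lcG haar (filterI B1 B1').
have h1 := hB _ (mollifier_sub (@subIsetl _ _ _) hh).
have h2 := hB' _ (mollifier_sub (@subIsetr _ _ _) hh).
apply: le_trans (rdist_triangle (S (op (crossed_rep A p) (q (translate r (fun s => (h s)%:K))) x)) _ _) _.
rewrite -(linear_mapB _ _ lS) mulrDl; apply: lerD.
  by apply: le_trans (hM _) _; rewrite rdistC -mulrA ler_wpM2l.
by rewrite hS.
Qed.

Lemma crossed_rep_class p (XX : completeNormedModType K -> Prop) : RR p -> XX (space p) ->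
  nondegenerate_contractive_in XX (crossed_rep A p).
Proof.
move=> Rp Xp; have [t1 t2 _] := crossed_repP Rp.
by split=> //; exact: crossed_rep_nondegenerate.
Qed.

(** [U] is recovered from its integrated form: [U_r x] is the limit of
    [T (q (translate r h)) x] when [h] concentrates at the identity.  As this
    limit only mentions the integrated form, the latter determines the whole
    family, including its space. *)
Definition disintegrated (o : operator_family R k A) : operator_family R k G :=
  @OperatorFamily R k G (space o) (fun r x => xget 0 [set y : space o |
    forall e, 0 < e -> exists2 B, nbhs (1%g : G) B &
      forall h, mollifier (k := k) mu B h ->
        rnorm (op o (q (translate r (fun s => (h s)%:K))) x - y) <= nu r * e]).

Lemma crossed_repK p : RR p -> disintegrated (crossed_rep A p) = p.
Proof.
move=> Rp; apply: operator_family_eta => r x.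
have orb : [set y : space p |
    forall e, 0 < e -> exists2 B, nbhs (1%g : G) B &
      forall h, mollifier (k := k) mu B h ->
        rnorm (op (crossed_rep A p) (q (translate r (fun s => (h s)%:K))) x - y) <= nu r * e]
   (op p r x).
  by move=> e e0; exact: crossed_rep_orbit.
apply: (rnorm_eps_eq (nu r + nu r)) => e e0.
have [B B1 hB] := orb e e0; have [B' B1' hB'] := xgetI 0 orb e e0.
have [h hh] := mollifier_exists (k := k) hG lcG haar (filterI B1 B1').
have h1 := hB _ (mollifier_sub (@subIsetl _ _ _) hh).
have h2 := hB' _ (mollifier_sub (@subIsetr _ _ _) hh).
apply: le_trans (rdist_triangle (op (crossed_rep A p) (q (translate r (fun s => (h s)%:K))) x) _ _) _.
by rewrite mulrDl; apply: lerD; [rewrite rdistC|].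
Qed.

Lemma crossed_rep_inj p p' : RR p -> RR p' -> crossed_rep A p = crossed_rep A p' -> p = p'.
Proof. by move=> /crossed_repK{2}<- /crossed_repK{2}<- ->. Qed.

End crossed.

(** * From representations of the algebra to representations of the group *)

Section disintegration.
Context {R : realType} {k : scalars} {G : topGroupType}.
Variable mu : {measure set (borel G) -> \bar R}.
Local Notation K := (scalar_field R k).
Hypothesis hG : hausdorff_space G.
Hypothesis lcG : locally_compact [set: G].
Hypothesis haar : left_haar_measure mu.
Local Notation int g := (bochner_integral mu g).
Variable nu : G -> R.
Hypothesis nu0 : forall r, 0 <= nu r.
Hypothesis nu_bounded : forall C : set G, compact C -> has_ubound (nu @` C).
Hypothesis nu_near1 : forall e, 0 < e -> exists2 B, nbhs (1%g : G) B & forall s, B s -> nu s <= 1 + e.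
Variable RR : operator_family R k G -> Prop.
Hypothesis RR_nonempty : exists p, RR p.
Hypothesis RR_rep : forall p, RR p ->
  [/\ group_representation p, strongly_continuous p & bounded_by nu p].
Variable A : crossed_product mu RR.
Local Notation q := (cp_map A).
Variable P : operator_family R k A.
Hypotheses (rep : algebra_representation P) (ctr : contractive P) (ndg : nondegenerate P).
Local Notation X := (space P).
Local Notation T := (op P).
Let cX : family_complete X := @banach_family_complete R k X.

Local Notation CcT := {f : G -> K | Cc f}.

(** Formal sums of vectors [T (q f) x].  The group acts on formal sums, by [shift];
    [act_shift_bound] shows that this descends to the vectors that they
    represent. *)
Definition act (l : seq (CcT * X)) : X := \sum_(z <- l) T (q (sval z.1)) z.2.

Definition shift (r : G) (l : seq (CcT * X)) : seq (CcT * X) :=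
  [seq (exist _ (translate r (sval z.1)) (Cc_translate hG r (svalP z.1)), z.2) | z <- l].

Lemma act_cat l l' : act (l ++ l') = act l + act l'.
Proof. exact: big_cat. Qed.

Lemma act_scale c l : act [seq (z.1, c *: z.2) | z <- l] = c *: act l.
Proof.
rewrite /act big_map scaler_sumr; apply: eq_bigr => z _ /=.
by rewrite linear_mapZ//; exact: arep_linear.
Qed.

Lemma act_shift r l : act (shift r l) = \sum_(z <- l) T (q (translate r (sval z.1))) z.2.
Proof. by rewrite /act big_map. Qed.

Lemma act_subspace : linear_subspace (range act).
Proof.
split; first by exists [::] => //; exact: big_nil.
move=> c _ _ [l _ <-] [l' _ <-].
by exists ([seq (z.1, c *: z.2) | z <- l] ++ l') => //; rewrite act_cat act_scale.
Qed.

(** This is what non-degeneracy provides. *)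
Lemma act_dense : dense (range act).
Proof.
apply/dense_rnormP => x e e0; have e2 := divr_gt0 e0 (ltr0Sn R 1).
have [y ly hy] := (dense_rnormP _).1 ndg x (e / 2) e2.
have : closure (range act) y.
  move: y ly {hy}; apply: lspan_min; first exact/closure_subspace/act_subspace.
  move=> _ [a [y ->]]; apply/closure_rnormP => d d0.
  have y1 : 0 < rnorm y + 1 by rewrite ltr_pwDr// rnorm_ge0.
  have [f Cf hf] := cp_approx a (divr_gt0 d0 y1).
  exists (T (q f) y).
    by exists [:: (exist _ f Cf, y)] => //; rewrite /act big_seq1.
  apply: le_lt_trans (arep_dist rep ctr _ _ _) _.
  move: hf; rewrite ltr_pdivlMr// mulrDr mulr1 mulrC => h.
  have := rnorm_ge0 (q f - a); have := h; set u := rnorm y * _; move=> h1 h2.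
  case: (ltrgtP (rnorm (q f - a)) 0) h2 => // [h3 _|h3 _]; first by lra.
  by rewrite /u h3 mulr0.
move=> /closure_rnormP/(_ _ e2)[z rz hz]; exists z => //.
apply: le_lt_trans (rdist_triangle y _ _) _.
by rewrite (splitr e); apply: ltrD.
Qed.

Lemma translate_convolution r (f g : G -> K) : Cc f -> Cc g ->
  translate r (convolution mu f g) = convolution mu (translate r f) g.
Proof.
move=> Cf Cg; apply/funext => s; rewrite /translate /convolution.
have [C sf] := Cc_supported Cf; have [D sg] := Cc_supported Cg.
have [c0 z0] := convolution_joint sf sg.
have [_ cC _] := sf.
have sF : supported (fun t => f t * g (t^-1 * (r^-1 * s))%g : K^o) C.
  split=> //; first exact: (continuous_slices (F := fun t s => f t * g (t^-1 * s)%g : K^o) c0).2.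
  by move=> t Ct; apply: z0 => -[].
rewrite -(haar_left hG haar r^-1%g (@scalar_family_complete R k) sF).
by congr bochner_integral; apply/funext => t; rewrite invgM invgK mulgA mulgK.
Qed.

(** Up to an error, the shift of [act l] is the image of [act l] under the
    operator of a translated mollifier, whose norm is at most a little more than
    [nu r]. *)
Lemma act_shift_bound r l : rnorm (act (shift r l)) <= nu r * rnorm (act l).
Proof.
pose S := \sum_(z <- l) rnorm z.2.
have S0 : 0 <= S by apply: sumr_ge0 => z _; exact: rnorm_ge0.
apply/ler_addgt0Pr => d d0.
have D0 : 0 < nu r * (rnorm (act l) + S) + 1.
  by rewrite ltr_pwDr// mulr_ge0// addr_ge0// rnorm_ge0.
have e0 := divr_gt0 d0 D0; set e := d / _ in e0.
(* The errors add up to e * nu r * (rnorm (act l) + S) <= d. *)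
have [B1 hB1 nB1] := nu_near1 e0.
have [B2 hB2 nB2] : exists2 B, nbhs (1%g : G) B & forall h, mollifier (k := k) mu B h ->
    rnorm (act (shift r l) - T (q (translate r (fun s => (h s)%:K))) (act l)) <= nu r * e * S.
  rewrite /S; elim: l {S S0 D0 e hB1 nB1} (e) e0 => [|z l ih] e e0.
    exists setT; first exact: filterT.
    move=> h _; rewrite /act !big_nil (linear_map0 (arep_linear rep _)) ?subrr ?rnorm0 ?mulr0//.
  have [B hB nB] := ih e e0.
  have [B' hB' nB'] := cp_map_mollifier_mul hG lcG haar nu_bounded RR_nonempty RR_rep A (svalP z.1) e0.
  exists (B `&` B'); first exact: filterI.
  move=> h hh; have h1 := nB _ (mollifier_sub (@subIsetl _ _ _) hh).
  have h2 := nB' _ (mollifier_sub (@subIsetr _ _ _) hh).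
  have Ch := mollifier_Cc hG hh.
  rewrite /act /= !big_cons linear_mapD; last exact: (arep_linear rep).
  rewrite opprD addrACA; apply: le_trans (rnormD _ _) _; rewrite mulrDr; apply: lerD => //.
  rewrite -(arepM rep) /=; apply: le_trans (arep_dist rep ctr _ _ _) _.
  rewrite mulrC ler_wpM2r ?rnorm_ge0//.
  have Cfz := svalP z.1; have Cc1 := Cc_convolution (haar_compact haar) hG Ch Cfz.
  rewrite -(cp_map_mul A (Cc_translate hG r Ch) Cfz) -translate_convolution//.
  have -> : q (translate r (sval z.1)) - q (translate r (convolution mu (fun s => (h s)%:K) (sval z.1))) =
     q (translate r (fun s => sval z.1 s - convolution mu (fun s => (h s)%:K) (sval z.1) s)).
    by rewrite -(cp_mapB A (Cc_translate hG r Cfz) (Cc_translate hG r Cc1)).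
  apply: le_trans (cp_map_translate hG haar nu0 nu_bounded RR_nonempty RR_rep A r (CcB hG Cfz Cc1)) _.
  by rewrite ler_wpM2l// (cp_mapB A Cfz Cc1) rdistC cp_map_mul.
have [h hh] := mollifier_exists (k := k) hG lcG haar (filterI hB1 hB2).
have h1 := nB2 _ (mollifier_sub (@subIsetr _ _ _) hh).
have h2 : rnorm (q (fun s => (h s)%:K)) <= 1 + e.
  apply: (cp_map_mollifier hG haar RR_nonempty RR_rep A (mollifier_sub (@subIsetl _ _ _) hh)) => //.
  by rewrite addr_ge0// ltW.
have h3 : rnorm (T (q (translate r (fun s => (h s)%:K))) (act l)) <= nu r * (1 + e) * rnorm (act l).
  apply: le_trans (arep_bound rep ctr _ _) _; rewrite ler_wpM2r ?rnorm_ge0//.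
  apply: le_trans (cp_map_translate hG haar nu0 nu_bounded RR_nonempty RR_rep A r (mollifier_Cc hG hh)) _.
  by rewrite ler_wpM2l.
apply: le_trans (rnorm_tri _ (T (q (translate r (fun s => (h s)%:K))) (act l))) _.
apply: le_trans (lerD h1 h3) _.
have h4 : e * (nu r * (rnorm (act l) + S) + 1) = d by rewrite /e divfK// gt_eqF.
by rewrite -h4 mulrDr mulr1; have := ltW e0; lra.
Qed.

Lemma shift_exists : exists U : G -> X -> X, (forall r l, U r (act l) = act (shift r l)) /\
  forall r x y, rnorm (U r x - U r y) <= nu r * rnorm (x - y).
Proof.
have h r : exists V : X -> X, (forall l, V (act l) = act (shift r l)) /\
    forall x y, rnorm (V x - V y) <= nu r * rnorm (x - y).
  have [|V hV1 hV2] := @lipschitz_extension R k _ setT X X act (act \o shift r) (nu r) cX (nu0 r) act_dense.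
    move=> l l' _ _ /=; have := act_shift_bound r (l ++ [seq (z.1, (-1) *: z.2) | z <- l']).
    rewrite act_cat act_scale scaleN1r; congr (rnorm _ <= _).
    rewrite /shift map_cat act_cat; congr (_ + _).
    have <- : act [seq (z.1, -1 *: z.2) | z <- shift r l'] = - act (shift r l').
      by rewrite act_scale scaleN1r.
    by rewrite /shift -!map_comp.
  by exists V; split=> // l; exact: hV1.
have [U hU] := choice h; exists U; split=> r; first by have [h1 _] := hU r.
by have [_ h2] := hU r.
Qed.

Lemma act_functional x : Cc_functional (fun f => T (q f) x).
Proof.
have [h1 h2] := cp_functional hG haar nu_bounded RR_nonempty RR_rep A.
split; first by move=> c f g Cf Cg; rewrite cp_map_linear// (arep_lin rep).
move=> C cC; have [M M0 hM] := h2 C cC; exists (M * rnorm x); first by rewrite mulr_ge0// rnorm_ge0.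
move=> f e sf he; apply: le_trans (arep_bound rep ctr _ _) _.
by rewrite mulrAC ler_wpM2r ?rnorm_ge0// hM.
Qed.

(** The identities of a group representation hold for translations of functions,
    hence on the dense set of vectors [act l]. *)
Theorem disintegration : exists U : G -> X -> X,
  [/\ group_representation (OperatorFamily U), strongly_continuous (OperatorFamily U),
      bounded_by nu (OperatorFamily U)
    & forall f, Cc f -> T (q f) = integrated mu (OperatorFamily U) f].
Proof.
have [U [Ua Ul]] := shift_exists; exists U.
have Ulin r : linear (U r).
  move=> c x y; move: x; apply: (dense_lipschitz_eq act_dense (M := nu r * rnorm (c : K^o))).
  - move=> x x'; apply: le_trans (Ul _ _ _) _.
    by rewrite opprD addrACA subrr addr0 -scalerBr rnormZ mulrA.
  - move=> x x'; rewrite opprD addrACA subrr addr0 -scalerBr rnormZ.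
    by rewrite mulrAC [leRHS]mulrC ler_wpM2l ?rnorm_ge0.
  move=> _ [l _ <-]; move: y; apply: (dense_lipschitz_eq act_dense (M := nu r)).
  - by move=> y y'; apply: le_trans (Ul _ _ _) _; rewrite opprD addrACA subrr add0r.
  - by move=> y y'; rewrite opprD addrACA subrr add0r.
  move=> _ [l' _ <-]; rewrite -act_scale -act_cat !Ua /shift map_cat act_cat.
  by rewrite -act_scale -!map_comp.
have Ub r x : rnorm (U r x) <= nu r * rnorm x.
  by have := Ul r x 0; rewrite linear_map0// !subr0.
have grp : group_representation (OperatorFamily U).
  split.
  - by move=> r; exact: bounded_operator_of_bound (Ulin r) (Ub r).
  - apply/funext => x; move: x; apply: (dense_lipschitz_eq act_dense (M := nu 1%g + 1)).
    + by move=> x y; apply: le_trans (Ul _ _ _) _; rewrite ler_wpM2r ?rnorm_ge0// lerDl.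
    + by move=> x y; rewrite mulrDl mul1r lerDr mulr_ge0// rnorm_ge0.
    move=> _ [l _ <-]; rewrite /= Ua act_shift /act; apply: eq_bigr => z _.
    by congr (T (q _) _); apply/funext => s; rewrite /translate invg1 mul1g.
  - move=> r s; apply/funext => x; move: x; apply: (dense_lipschitz_eq act_dense (M := nu (r * s)%g + nu r * nu s)).
    + by move=> x y; apply: le_trans (Ul _ _ _) _; rewrite ler_wpM2r ?rnorm_ge0// lerDl mulr_ge0.
    + move=> x y; apply: le_trans (Ul _ _ _) _; apply: le_trans (ler_wpM2l (nu0 r) (Ul _ _ _)) _.
      by rewrite mulrA ler_wpM2r ?rnorm_ge0// lerDr.
    move=> _ [l _ <-]; rewrite /= !Ua !act_shift big_map; apply: eq_bigr => z _.
    by congr (T (q _) _); apply/funext => t; rewrite /= /translate invgM mulgA.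
have bnd : bounded_by nu (OperatorFamily U) by move=> r; apply: opnorm_le.
have cnt : strongly_continuous (OperatorFamily U).
  move=> x; apply/continuous_rnormP => r0 e e0.
  have [V cV V0] := compact_nbhs r0 lcG; have [N N0 hN] := nu_bound nu_bounded cV.
  have N1 : 0 < 2 * N + 1 by rewrite ltr_pwDr// mulr_ge0.
  have e1 : 0 < e / 2 / (2 * N + 1) by rewrite !divr_gt0.
  have [_ [l _ <-] hl] := (dense_rnormP _).1 act_dense x _ e1.
  have cl : continuous (fun r => U r (act l)).
    have -> : (fun r => U r (act l)) = (fun r => \sum_(z <- l) T (q (translate r (sval z.1))) z.2).
      by apply/funext => r; rewrite Ua act_shift.
    elim: l {hl} => [|z l ih].
      rewrite (_ : (fun r : G => _) = fun=> 0); first by move=> r; exact: cvg_cst.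
      by apply/funext => r; exact: big_nil.
    rewrite (_ : (fun r : G => _) = (fun r => T (q (translate r (sval z.1))) z.2 +
        \sum_(y <- l) T (q (translate r (sval y.1))) y.2)); last by apply/funext => r; exact: big_cons.
    move=> r; apply: cvgD; last exact: ih.
    exact: (continuous_functional_translate hG lcG (act_functional z.2) (svalP z.1)).
  have nr0 : Filter (nbhs r0) := nbhs_filter r0.
  have := @filterI _ _ nr0 _ _ V0 ((continuous_rnormP _).1 cl r0 (e / 2) (divr_gt0 e0 (ltr0Sn _ 1))).
  apply: (@filterS _ _ nr0) => r [Vr /= hr] /=.
  have b1 : rnorm (U r x - U r (act l)) <= N * rnorm (act l - x).
    by rewrite (rdistC (act l)); apply: le_trans (Ul _ _ _) _; rewrite ler_wpM2r ?rnorm_ge0// hN.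
  have b2 : rnorm (U r0 (act l) - U r0 x) <= N * rnorm (act l - x).
    by apply: le_trans (Ul _ _ _) _; rewrite ler_wpM2r ?rnorm_ge0// hN//; exact: nbhs_singleton.
  have b3 := rdist_triangle (U r (act l)) (U r x) (U r0 x).
  have b4 := rdist_triangle (U r0 (act l)) (U r (act l)) (U r0 x).
  move: hl; rewrite ltr_pdivlMr// => hl.
  have := rnorm_ge0 (act l - x); lra.
split=> // f Cf; apply/funext => x; move: x.
have If := integrated_linear hG haar grp cnt Cf.
have [M M0 hM] := bounded_operator_bound (integrated_bounded hG haar nu_bounded grp cnt bnd Cf).
apply: (dense_lipschitz_eq act_dense (M := rnorm (q f) + M)).
- move=> x y; rewrite -(linear_mapB _ _ (arep_linear rep _)); apply: le_trans (arep_bound rep ctr _ _) _.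
  by rewrite ler_wpM2r ?rnorm_ge0// lerDl.
- move=> x y; rewrite -(linear_mapB _ _ If); apply: le_trans (hM _) _.
  by rewrite ler_wpM2r ?rnorm_ge0// lerDr rnorm_ge0.
move=> _ [l _ <-]; rewrite {1 2}/act (linear_map_sum _ _ (arep_linear rep _)) (linear_map_sum _ _ If).
apply: eq_bigr => z _; have Cz := svalP z.1.
rewrite -(arepM rep) -(cp_map_mul A Cf Cz).
rewrite (functional_convolution (haar_compact haar) hG (act_functional z.2) cX Cf Cz).
congr bochner_integral; apply/funext => r; congr (_ *: _) => /=.
by have := Ua r [:: z]; rewrite act_shift /act !big_seq1.
Qed.

End disintegration.

(** * Unitary representations and the modular function *)

Section inner_product.
Context {R : realType} {k : scalars}.
Local Notation K := (scalar_field R k).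
Context {X : normedModType K}.
Variable ip : X -> X -> K.
Hypothesis hip : inner_product ip.
Local Notation cj := (@scalar_conj R k).

Lemma ip_lin c x y z : ip (c *: x + y) z = c * ip x z + ip y z.
Proof. by have [h _ _] := hip. Qed.
Lemma ip_sym x y : ip y x = cj (ip x y).
Proof. by have [_ h _] := hip. Qed.
Lemma ip_norm x : ip x x = (rnorm x ^+ 2)%:K.
Proof. by have [_ _ ->] := hip; rewrite norm_rnorm rmorphXn. Qed.
Lemma ip0l z : ip 0 z = 0.
Proof. by have := ip_lin (-1) 0 0 z; rewrite scaler0 addr0 mulN1r addNr. Qed.
Lemma ipDl x y z : ip (x + y) z = ip x z + ip y z.
Proof. by have := ip_lin 1 x y z; rewrite scale1r mul1r. Qed.
Lemma ipZl c x z : ip (c *: x) z = c * ip x z.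
Proof. by have := ip_lin c x 0 z; rewrite addr0 ip0l addr0. Qed.
Lemma ipBl x y z : ip (x - y) z = ip x z - ip y z.
Proof. by rewrite ipDl -scaleN1r ipZl mulN1r. Qed.
Lemma ipDr x y z : ip z (x + y) = ip z x + ip z y.
Proof. by rewrite ip_sym ipDl rmorphD /= -!ip_sym. Qed.
Lemma ipZr c x z : ip z (c *: x) = cj c * ip z x.
Proof. by rewrite ip_sym ipZl rmorphM /= -!ip_sym. Qed.
Lemma ipBr x y z : ip z (x - y) = ip z x - ip z y.
Proof. by rewrite ip_sym ipBl rmorphB /= -!ip_sym. Qed.

Lemma ip_eq0 z : (forall y, ip z y = 0) -> z = 0.
Proof.
move=> /(_ z)/(congr1 (@scalar_Re R k)); rewrite ip_norm Re_of_real raddf0.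
by move=> /eqP; rewrite sqrf_eq0 => /eqP/rnorm0_eq0.
Qed.

(** The Cauchy-Schwarz inequality, from the squared norm of the difference of [x]
    and its projection to the line of [y]. *)
Lemma ip_bound x y : rnorm (ip x y : K^o) <= rnorm x * rnorm y.
Proof.
have [->|y0] := eqVneq y 0.
  by rewrite ip_sym ip0l rmorph0 !rnorm0 mulr0.
have n0 : 0 < rnorm y.
  by rewrite lt_neqAle rnorm_ge0 andbT; apply: contra_neq y0 => /esym/rnorm0_eq0.
set w := ip x y; pose n := rnorm y ^+ 2; have n1 : 0 < n by rewrite exprn_gt0.
pose c := w * n^-1%:K.
have cc : cj c = cj w * n^-1%:K by rewrite /c (rmorphM (@scalar_conj R k)) /= conj_of_real.
have ww : w * cj w = (rnorm (w : K^o) ^+ 2)%:K.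
  by rewrite mul_conj -[`|w|]/(`|w : K^o|) norm_rnorm rmorphXn.
have : ip (x - c *: y) (x - c *: y) = (rnorm x ^+ 2 - rnorm (w : K^o) ^+ 2 / n)%:K.
  rewrite ipBl !ipBr !ipZl !ipZr !ip_norm -/n -/w (ip_sym x y) -/w.
  rewrite cc /c.
  have -> : (rnorm x ^+ 2 - rnorm (w : K^o) ^+ 2 / n)%:K = (rnorm x ^+ 2)%:K - w * cj w * n^-1%:K.
    by rewrite ww -rmorphM -rmorphB.
  have nn : n%:K * n^-1%:K = 1 :> K by rewrite -rmorphM mulfV ?rmorph1// gt_eqF.
  transitivity ((rnorm x ^+ 2)%:K - w * cj w * n^-1%:K + w * cj w * n^-1%:K * (n%:K * n^-1%:K - 1)); first by ring.
  by rewrite nn subrr mulr0 addr0.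
rewrite ip_norm => /(congr1 (@scalar_Re R k)); rewrite !Re_of_real => h.
have : 0 <= rnorm x ^+ 2 - rnorm (w : K^o) ^+ 2 / n by rewrite -h sqr_ge0.
rewrite subr_ge0 ler_pdivrMr// /n -exprMn.
by rewrite ler_sqr// nnegrE ?mulr_ge0// ?rnorm_ge0.
Qed.

End inner_product.

Section modular.
Context {R : realType} {k : scalars} {G : topGroupType}.
Variable mu : {measure set (borel G) -> \bar R}.
Local Notation K := (scalar_field R k).
Hypothesis hG : hausdorff_space G.
Hypothesis lcG : locally_compact [set: G].
Hypothesis haar : left_haar_measure mu.
Local Notation int g := (bochner_integral mu g).
Variable Delta : G -> R.
Hypothesis hD : modular_function mu Delta.
Let cK : family_complete (K^o : normedModType K) := @scalar_family_complete R k.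
Let mu_compact := haar_compact haar.

(** [Delta r] is the integral of a right translate by [r] of a function of
    integral 1. *)
Lemma modular_continuous : continuous (fun r => (Delta r)%:K : K^o).
Proof.
have [h [h0 [C sC] _ hI]] := mollifier_exists (k := k) hG lcG haar (@filterT _ (nbhs (1%g : G)) _).
have [ch cC z0] := sC.
have E r : (Delta r)%:K = int (fun s => (h (s * r^-1)%g)%:K : K^o).
  by rewrite (haar_right hG haar r hD cK sC) hI; apply/esym; exact: mulr1.
rewrite (_ : (fun r => _) = (fun r => int (fun s => (h (s * r^-1)%g)%:K : K^o))); last exact/funext.
apply/continuous_rnormP => r e e0; have [V cV Vr] := compact_nbhs r lcG.
apply: (functional_near hG (int_functional mu_compact hG) (F := fun r s => (h (s * r^-1)%g)%:K : K^o) (C := mulset C V) _ _ Vr) => //.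
- move=> z; apply: (@continuous_comp _ _ _ (fun z : G * G => (z.2 * z.1^-1)%g) (fun s => (h s)%:K : K^o)); last exact: ch.
  apply: continuous_mulg; first by move=> x; exact: cvg_snd.
  by apply: continuous_invg => x; exact: cvg_fst.
- exact: compact_mulset.
move=> r' Vr'; split; [|exact: compact_mulset|].
  move=> s; apply: (@continuous_comp _ _ _ (fun s : G => (s * r'^-1)%g) (fun s => (h s)%:K : K^o)); last exact: ch.
  exact: continuous_rmul.
move=> s ns; apply: z0 => Cs; apply: ns; exists ((s * r'^-1)%g, r') => //=.
by rewrite -mulgA mulVg mulg1.
Qed.

Lemma supported_invg (g : G -> K^o) C : supported g C ->
  supported (fun s => g s^-1%g) ((fun x => x^-1%g) @` C).
Proof.
move=> [cg cC g0]; split; last first.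
- by move=> s ns; apply: g0 => h; apply: ns; exists s^-1%g => //; rewrite invgK.
- exact: compact_invg.
by move=> s; apply: (@continuous_comp _ _ _ (fun s : G => s^-1%g) g); [exact: invg_continuous|exact: cg].
Qed.

(** Inversion carries the left Haar measure to [Delta (s^-1) ds].  For [f] of
    integral 1, both sides are the double integral of [g (t^-1) f (s t)]: over
    [s] first, right translation of [f] gives [Delta (t^-1)]; over [t] first,
    left translation gives the convolution of [f] and [g]. *)
Lemma haar_inversion (g : G -> K^o) D : supported g D ->
  int (fun s => (Delta s^-1%g)%:K * g s^-1%g : K^o) = int g.
Proof.
move=> sg; have [cg cD g0] := sg.
have [h hm] := mollifier_exists (k := k) hG lcG haar (@filterT _ (nbhs (1%g : G)) _).
have Ch := mollifier_Cc hG hm; have [h0 [C sC] _ hI] := hm; have [ch cC z0] := sC.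
pose f s : K^o := (h s)%:K.
(* The function whose two iterated integrals are compared. *)
pose F (s t : G) : K^o := g t^-1%g * f (s * t)%g.
have jF : continuous (fun z : G * G => F z.1 z.2).
  move=> z; apply: (@cvgZ _ K^o _ _ _ (fun z : G * G => g z.2^-1%g)).
    apply: (@continuous_comp _ _ _ (fun z : G * G => z.2^-1%g) g); last exact: cg.
    by apply: continuous_invg => x; exact: cvg_snd.
  apply: (@continuous_comp _ _ _ (fun z : G * G => (z.1 * z.2)%g) f); last exact: ch.
  exact: mulg_continuous.
have cCD := compact_mulset cC cD; have cDV := compact_invg cD.
have F0 s t : ~ (mulset C D s /\ [set x^-1%g | x in D] t) -> F s t = 0.
  move=> ns; rewrite /F; have [Dt|Dt] := pselect (D t^-1%g); last by rewrite g0// mul0r.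
  rewrite /f z0 ?mulr0// => Cst; apply: ns; split; last by exists t^-1%g => //; rewrite invgK.
  by exists ((s * t)%g, t^-1%g) => //=; rewrite mulgK.
transitivity (int (fun t => int (fun s => F s t)) : K^o).
  congr bochner_integral; apply/funext => t.
  rewrite -[RHS]/(int (fun s => g t^-1%g *: (f (s * t)%g : K^o)) : K^o).
  have sft : supported (fun s => f (s * t)%g) (mulset C [set t^-1%g]).
    split.
    - by move=> s; apply: (@continuous_comp _ _ _ (fun s : G => (s * t)%g) f); [exact: continuous_rmul|exact: ch].
    - exact: (compact_mulset cC (@compact_set1 _ t^-1%g)).
    - move=> s ns; apply: z0 => Cs; apply: ns; exists ((s * t)%g, t^-1%g) => //=.
      by rewrite mulgK.
  rewrite (intZ mu_compact hG _ cK sft).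
  have := haar_right hG haar t^-1%g hD cK sC; rewrite invgK -/f => ->.
  by rewrite hI mulrC; congr (_ * _); apply/esym; exact: mulr1.
rewrite (fubini mu_compact hG cK (int_functional mu_compact hG) jF cCD cDV F0).
transitivity (int (convolution mu (f : G -> K) (g : G -> K) : G -> K^o)).
  congr bochner_integral; apply/funext => s.
  have sFs : supported (F s) [set x^-1%g | x in D].
    by split=> //; [exact: (continuous_slices jF).1|move=> t Dt; apply: F0 => -[]].
  rewrite -(haar_left hG haar s^-1%g cK sFs) /convolution; congr bochner_integral.
  apply/funext => t; rewrite /F invgM invgK mulgA mulgV mul1g; exact: mulrC.
rewrite (functional_convolution mu_compact hG (int_functional mu_compact hG) cK Ch (supported_Cc sg hG)).
have It r : int (translate r (g : G -> K) : G -> K^o) = int g.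
  by rewrite -[RHS](haar_left hG haar r^-1%g cK sg).
have -> : (fun r : G => (f r : K) *: (int (translate r (g : G -> K) : G -> K^o) : K^o)) = (fun r => f r *: (int g : K^o)).
  by apply/funext => r; rewrite It.
have := @int_linear_map R k G mu mu_compact hG K^o K^o (fun c : K^o => c *: (int g : K^o)) _ C cK cK _ sC.
rewrite hI scale1r; apply.
apply: (@bounded_operator_of_bound _ _ _ _ _ (rnorm (int g : K^o))).
  by move=> a u v; rewrite scalerDl scalerA.
by move=> x; rewrite rnormZ mulrC.
Qed.

Lemma Cc_star_supported (f : G -> K^o) C : supported f C ->
  supported (Cc_star Delta (f : G -> K) : G -> K^o) ((fun x => x^-1%g) @` C).
Proof.
move=> sf; have [cf _ f0] := supported_invg sf; split.
- move=> s; apply: (@cvgZ _ K^o _ _ _ (fun s => (Delta s^-1%g)%:K)).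
    apply: (@continuous_comp _ _ _ (fun s : G => s^-1%g) (fun s => (Delta s)%:K : K^o)); first exact: invg_continuous.
    exact: modular_continuous.
  apply/continuous_rnormP: s => s e e0.
  have := (continuous_rnormP _).1 cf s e e0; apply: filterS => t /=.
  by rewrite -rmorphB rnorm_conj.
- by apply: compact_invg; have [] := sf.
- by move=> s ns; rewrite /Cc_star f0// rmorph0 mulr0.
Qed.

Lemma Cc_star_Cc f : Cc f -> Cc (Cc_star Delta (f : G -> K)).
Proof. by move=> /Cc_supported[C /Cc_star_supported /supported_Cc]; exact. Qed.

Section adjoint.
Variable p : operator_family R k G.
Hypotheses (rep : group_representation p) (cont : strongly_continuous p).
Variable ip : space p -> space p -> K.
Hypothesis hip : inner_product ip.
Hypothesis hU : forall r x y, ip (op p r x) (op p r y) = ip x y.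

(** This is [haar_inversion] for the function [f s * ip (U_s x) y]. *)
Lemma integrated_adjoint f x y : Cc f ->
  ip (integrated mu p f x) y = ip x (integrated mu p (Cc_star Delta f) y).
Proof.
move=> Cf; have [C sf] := Cc_supported Cf.
have cX : family_complete (space p) := @banach_family_complete R k _.
have sx := orbit_supported cont x sf.
have sy := orbit_supported cont y (Cc_star_supported sf).
have iplD : {morph (fun z => ip z y : K^o) : u v / u + v} by move=> u v; exact: ipDl.
have iplB u : rnorm (ip u y : K^o) <= rnorm y * rnorm u by rewrite mulrC; exact: ip_bound.
have iprD : {morph (fun z => ip x z : K^o) : u v / u + v} by move=> u v; exact: ipDr.
have iprB u : rnorm (ip x u : K^o) <= rnorm x * rnorm u by exact: ip_bound.
rewrite /integrated.
rewrite -(int_semilinear mu_compact hG cX cK iplD _ iplB sx); last by move=> a u; exact: ipZl.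
rewrite -(int_semilinear mu_compact hG cX cK iprD _ iprB sy); last first.
  by move=> a u; rewrite (ipZr hip) conj_of_real.
have sg := supported_lip iplD iplB sx.
rewrite -(haar_inversion sg); congr bochner_integral; apply/funext => s /=.
rewrite (ipZl hip) (ipZr hip) /Cc_star (rmorphM (@scalar_conj R k)) /= conj_of_real scalar_conjK mulrA.
congr (_ * _); rewrite -(hU s) -(repM rep) mulgV (rep1 rep) //.
Qed.

End adjoint.
End modular.

(** * The involution, and contractivity of involutive representations *)

Section square_root.
Context {R : realType} {k : scalars} (A : banach_algebra R k).
Local Notation K := (scalar_field R k).

Lemma amulBl (a b c : A) : amul (a - b) c = amul a c - amul b c.
Proof. exact: (linear_mapB _ _ (fun t u v => amul_linear_l c t u v)). Qed.
Lemma amulBr (a b c : A) : amul a (b - c) = amul a b - amul a c.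
Proof. exact: (linear_mapB _ _ (amul_linear_r a)). Qed.

(** [1 - u] is a square root of [1 - h], written without the unit: [u] is the
    fixed point of [u |-> (h + u^2) / 2], a contraction of the ball of radius
    [1 - d].  The same contraction property makes [u] self-adjoint. *)
Lemma sqrt_one_minus (star : A -> A) (h : A) (d : R) : 0 < d -> d <= 1 ->
  rnorm h <= 1 - d ^+ 2 ->
  (forall a b, star (a + b) = star a + star b) ->
  (forall (t : R) a, star (t%:K *: a) = t%:K *: star a) ->
  (forall a b, star (amul a b) = amul (star b) (star a)) ->
  (forall a, rnorm (star a) <= rnorm a) -> star h = h ->
  exists u, star u = u /\ h = u + u - amul u u.
Proof.
move=> d0 d1 hd sD sZ sM sN sh.
pose Phi u := (2^-1 : R)%:K *: (h + amul u u).
have two : 2^-1 + 2^-1 = 1 :> R by lra.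
have PhiB u v : Phi u - Phi v = (2^-1 : R)%:K *: (amul u (u - v) + amul (u - v) v).
  by rewrite /Phi -scalerBr amulBr amulBl opprD addrACA subrr add0r addrA subrK.
(* The radius satisfies ((1 - d^2) + (1 - d)^2) / 2 = 1 - d. *)
have ball_Phi u : rnorm u <= 1 - d -> rnorm (Phi u) <= 1 - d.
  move=> hu; rewrite /Phi rnormZ_ge0 ?invr_ge0// ler_pdivrMl//.
  apply: le_trans (rnormD _ _) _; apply: le_trans (lerD hd (amul_norm _ _)) _.
  have := rnorm_ge0 u; nra.
have Phi_contr u v : rnorm u <= 1 - d -> rnorm v <= 1 - d ->
    rnorm (Phi u - Phi v) <= (1 - d) * rnorm (u - v).
  move=> hu hv; rewrite PhiB rnormZ_ge0 ?invr_ge0// ler_pdivrMl//.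
  apply: le_trans (rnormD _ _) _; apply: le_trans (lerD (amul_norm _ _) (amul_norm _ _)) _.
  have := rnorm_ge0 (u - v); nra.
have d1' : 0 <= 1 - d by rewrite subr_ge0.
pose S (e : R) : set A := [set u | rnorm u <= 1 - d /\ rnorm (u - Phi u) <= d * e].
have Sne e : 0 < e -> S e !=set0.
  move=> e0; have it n : rnorm (iter n Phi 0) <= 1 - d /\
      rnorm (iter n Phi 0 - Phi (iter n Phi 0)) <= (1 - d) ^+ n.
    elim: n => [|n [h1 h2]] /=.
      rewrite rnorm0 expr0 sub0r rnormN; split=> //.
      by apply: le_trans (ball_Phi _ _) _; rewrite ?rnorm0// gerBl ltW.
    split; first exact: ball_Phi.
    apply: le_trans (Phi_contr _ _ h1 (ball_Phi _ h1)) _.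
    by rewrite exprS ler_wpM2l.
  have : (fun n => (1 - d) ^+ n) @ \oo --> (0 : R).
    by apply: cvg_expr; rewrite ger0_norm// gtrBl.
  move=> /(@cvgr_dist_lt _ R^o _ _ _ _ _)/(_ (d * e)) []; first exact: mulr_gt0.
  move=> N _ /(_ N (leqnn N)); rewrite /= sub0r normrN ger0_norm ?exprn_ge0// => hN.
  by exists (iter N Phi 0); have [h1 h2] := it N; split=> //; apply: le_trans h2 (ltW hN).
have [||w hw] := (@banach_family_complete R k A) S 1 ler01; first exact: Sne.
  move=> e e' a b e0 e0' [a1 a2] [b1 b2]; rewrite mul1r.
  have := rdist_triangle (Phi a) a b; have := rdist_triangle (Phi b) (Phi a) b.
  have := Phi_contr _ _ a1 b1; rewrite (rdistC (Phi b)) => h1 h2 h3.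
  rewrite -(ler_pM2l d0); lra.
have w1 : rnorm w <= 1 - d.
  apply/ler_addgt0Pr => e e0; have [a Sa] := Sne e e0; have [a1 _] := Sa.
  have := hw _ _ e0 Sa; rewrite mul1r rdistC => h1.
  have := rnorm_tri w a; lra.
have Phiw : w = Phi w.
  apply: (rnorm_eps_eq 2) => e e0; have [a Sa] := Sne e e0; have [a1 a2] := Sa.
  have h1 := hw _ _ e0 Sa; have h2 := Phi_contr _ _ a1 w1.
  have := rdist_triangle a w (Phi w); have := rdist_triangle (Phi a) a (Phi w).
  have h3 := ler_wpM2l d1' h1.
  rewrite (rdistC w a); lra.
exists w; split; last first.
  have -> : w + w = h + amul w w; last by rewrite addrK.
  by rewrite {1 2}Phiw /Phi -scalerDl -rmorphD two rmorph1 scale1r.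
have sw : star w = Phi (star w) by rewrite {1}Phiw /Phi sZ sD sh sM.
have sw1 : rnorm (star w) <= 1 - d by apply: le_trans (sN _) w1.
apply/eqP; rewrite -subr_eq0; apply/eqP/rnorm0_eq0/eqP.
rewrite eq_le rnorm_ge0 andbT -(pmulr_rle0 _ d0).
have := Phi_contr _ _ sw1 w1; rewrite -sw -Phiw; lra.
Qed.

End square_root.

Section star.
Context {R : realType} {k : scalars} {G : topGroupType}.
Variable mu : {measure set (borel G) -> \bar R}.
Local Notation K := (scalar_field R k).
Hypothesis hG : hausdorff_space G.
Hypothesis lcG : locally_compact [set: G].
Hypothesis haar : left_haar_measure mu.
Variable nu : G -> R.
Hypothesis nu0 : forall r, 0 <= nu r.
Hypothesis nu_bounded : forall C : set G, compact C -> has_ubound (nu @` C).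
Variable RR : operator_family R k G -> Prop.
Hypothesis RR_nonempty : exists p, RR p.
Hypothesis RR_rep : forall p, RR p ->
  [/\ group_representation p, strongly_continuous p & bounded_by nu p].
Variable A : crossed_product mu RR.
Local Notation q := (cp_map A).
Variable Delta : G -> R.
Hypothesis hD : modular_function mu Delta.
Hypothesis RR_unitary : forall p, RR p -> unitary p.
Local Notation star := (cp_star A Delta).

(** The squared norm of [z = U(f^* ) y] is [ip (U(f) z) y], which the
    Cauchy-Schwarz inequality bounds by [|q f| |z| |y|]. *)
Lemma cp_map_star_bound f : Cc f -> rnorm (q (Cc_star Delta f)) <= rnorm (q f).
Proof.
move=> Cf; apply: (cp_map_le RR_nonempty A).
- exact: (Cc_star_Cc hG lcG haar hD).
- exact: rnorm_ge0.
move=> p y Rp; have [r1 r2 r3] := RR_rep Rp; have [ip hip hU] := RR_unitary Rp.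
set z := integrated mu p (Cc_star Delta f) y.
have [->|z0] := eqVneq z 0; first by rewrite rnorm0 mulr_ge0// rnorm_ge0.
have nz : 0 < rnorm z.
  by rewrite lt_neqAle rnorm_ge0 andbT; apply: contra_neq z0 => /esym/rnorm0_eq0.
have zz : ip (integrated mu p f z) y = ip z z.
  exact: (integrated_adjoint hG lcG haar hD r1 r2 hip hU).
have h1 := ip_bound hip (integrated mu p f z) y.
rewrite zz (ip_norm hip) rnorm_of_real ger0_norm ?sqr_ge0// in h1.
have h2 := cp_map_bound hG haar nu_bounded RR_rep A z Cf Rp.
rewrite -(ler_pM2l nz) -expr2; apply: le_trans h1 _.
apply: le_trans (ler_wpM2r (rnorm_ge0 _) h2) _.
by rewrite -mulrA mulrCA.
Qed.

(** The involution of [Cc] is contractive, hence extends to a Lipschitz map; by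
    density, [cp_star] is this extension. *)
Lemma cp_star_lipschitz :
  (forall f, Cc f -> star (q f) = q (Cc_star Delta f)) /\
  forall a b, rnorm (star a - star b) <= rnorm (a - b).
Proof.
have [|S S1 S2] := @lipschitz_extension R k (G -> K) Cc A A q (fun f => q (Cc_star Delta f)) 1
  (@banach_family_complete R k A) ler01 (@cp_map_dense _ _ _ _ _ A).
  move=> f g Cf Cg; rewrite mul1r.
  have Cf' := Cc_star_Cc hG lcG haar hD Cf; have Cg' := Cc_star_Cc hG lcG haar hD Cg.
  rewrite -(cp_mapB A Cf Cg) -(cp_mapB A Cf' Cg').
  have -> : (fun s => Cc_star Delta f s - Cc_star Delta g s) = Cc_star Delta (fun s => f s - g s).
    by apply/funext => s; rewrite /Cc_star -mulrBr -rmorphB.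
  by apply: cp_map_star_bound; exact: CcB.
have cS : continuous S.
  apply/continuous_rnormP => a e e0; apply/nbhs_rnormP; exists e => // b hb /=.
  by apply: le_lt_trans (S2 _ _) _; rewrite mul1r.
have [c1 s1] : continuous star /\ forall f, Cc f -> star (q f) = q (Cc_star Delta f).
  have spec : [set F : A -> A | continuous F /\ forall f, Cc f -> F (q f) = q (Cc_star Delta f)] S.
    by split.
  exact: (xgetI (fun=> 0) spec).
have -> : star = S.
  apply/funext => a; apply: (rnorm_eps_eq 2) => e e0.
  have na : Filter (nbhs a) := nbhs_filter a.
  have := @filterI _ _ na _ _ ((continuous_rnormP _).1 c1 a e e0) ((continuous_rnormP _).1 cS a e e0).
  move=> /nbhs_rnormP[d d0 hd]; have [f Cf hf] := cp_approx a d0.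
  have [/= h1 h2] := hd _ hf; rewrite s1// in h1; rewrite S1// in h2.
  have := rdist_triangle (q (Cc_star Delta f)) (star a) (S a).
  rewrite (rdistC (star a) (q _)); lra.
by split=> // a b; rewrite -[leRHS]mul1r.
Qed.

Lemma cp_star_norm a : rnorm (star a) <= rnorm a.
Proof.
have [s1 s2] := cp_star_lipschitz; have := s2 a 0; rewrite subr0.
have -> : star 0 = 0; last by rewrite subr0.
have Cz := @Cc0 R k G hG.
have q0 : q (fun=> 0) = 0 by rewrite -(functional0 hG (cp_functional hG haar nu_bounded RR_nonempty RR_rep A)).
rewrite -q0 s1//; congr cp_map; apply/funext => s.
by rewrite /Cc_star rmorph0 mulr0.
Qed.

Lemma cp_star_adjoint p ip a x y : RR p -> inner_product ip ->
  (forall r x y, ip (op p r x) (op p r y) = ip x y) ->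
  ip (op (crossed_rep A p) a x) y = ip x (op (crossed_rep A p) (star a) y).
Proof.
move=> Rp hip hU; have [r1 r2 r3] := RR_rep Rp.
have [t1 t2 hT] := crossed_repP hG haar nu_bounded RR_rep A Rp.
have [s1 s2] := cp_star_lipschitz.
move: a; apply: (@cp_map_dense_eq R k G mu RR A (K^o : normedModType K) _ _ (rnorm x * rnorm y)).
- move=> a b; rewrite -(ipBl hip); apply: le_trans (ip_bound hip _ _) _.
  apply: le_trans (ler_wpM2r (rnorm_ge0 _) (arep_dist t1 t2 _ _ _)) _.
  by rewrite mulrAC.
- move=> a b; rewrite -(ipBr hip); apply: le_trans (ip_bound hip _ _) _.
  apply: le_trans (ler_wpM2l (rnorm_ge0 _) (arep_dist t1 t2 _ _ _)) _.
  by rewrite mulrA ler_wpM2l ?mulr_ge0 ?rnorm_ge0.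
move=> f Cf; rewrite s1// !hT//; last exact: (Cc_star_Cc hG lcG haar hD).
exact: (integrated_adjoint hG lcG haar hD r1 r2 hip hU).
Qed.

(** The integrated forms of the members of [RR] separate the points of [A],
    because the norm of [A] is the supremum of theirs. *)
Lemma cp_faithful (a b : A) :
  (forall p x, RR p -> op (crossed_rep A p) a x = op (crossed_rep A p) b x) -> a = b.
Proof.
move=> h; apply: (rnorm_eps_eq 2) => e e0; have [f Cf hf] := cp_approx (a - b) e0.
have : rnorm (q f) <= e.
  apply: (cp_map_le RR_nonempty A) => //; first exact: ltW.
  move=> p x Rp; have [t1 t2 hT] := crossed_repP hG haar nu_bounded RR_rep A Rp.
  rewrite -hT//; have := arep_dist t1 t2 (q f) (a - b) x.
  rewrite (arepB t1) h// subrr subr0 => h1; apply: le_trans h1 _.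
  by rewrite mulrC ler_wpM2r ?rnorm_ge0// ltW.
have := rnorm_tri (a - b) (q f); rewrite rdistC; lra.
Qed.

(** The laws of an involution on [A] thus follow from those of adjoints. *)
Lemma cp_star_unique a b :
  (forall p ip x y, RR p -> inner_product ip ->
     (forall r x y, ip (op p r x) (op p r y) = ip x y) ->
     ip (op (crossed_rep A p) a x) y = ip x (op (crossed_rep A p) b y)) ->
  star a = b.
Proof.
move=> h; apply: cp_faithful => p x Rp; have [ip hip hU] := RR_unitary Rp.
apply/eqP; rewrite -subr_eq0; apply/eqP/(ip_eq0 hip) => y.
rewrite (ip_sym hip) (ipBr hip) -(cp_star_adjoint _ _ _ Rp hip hU) -(h p)//.
by rewrite subrr rmorph0.
Qed.

Lemma cp_starK a : star (star a) = a.
Proof.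
apply: cp_star_unique => p ip x y Rp hip hU.
by rewrite (ip_sym hip) -(cp_star_adjoint _ _ _ Rp hip hU) -(ip_sym hip).
Qed.

Lemma cp_starM a b : star (amul a b) = amul (star b) (star a).
Proof.
apply: cp_star_unique => p ip x y Rp hip hU.
have [t1 t2 hT] := crossed_repP hG haar nu_bounded RR_rep A Rp.
by rewrite !(arepM t1) !(cp_star_adjoint _ _ _ Rp hip hU).
Qed.

Lemma cp_starD a b : star (a + b) = star a + star b.
Proof.
apply: cp_star_unique => p ip x y Rp hip hU.
have [t1 t2 hT] := crossed_repP hG haar nu_bounded RR_rep A Rp.
rewrite !(linear_mapD _ _ (arep_linear_r t1 _)) (ipDl hip) (ipDr hip).
by rewrite !(cp_star_adjoint _ _ _ Rp hip hU).
Qed.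

Lemma cp_starZ (t : R) a : star (t%:K *: a) = t%:K *: star a.
Proof.
apply: cp_star_unique => p ip x y Rp hip hU.
have [t1 t2 hT] := crossed_repP hG haar nu_bounded RR_rep A Rp.
rewrite !(linear_mapZ _ _ (arep_linear_r t1 _)) (ipZl hip) (ipZr hip) conj_of_real.
by rewrite (cp_star_adjoint _ _ _ Rp hip hU).
Qed.

(** If [t |a|^2 < 1] then [1 - t a^* a] is the square of a self-adjoint element,
    whence [t |T_a x|^2 <= |x|^2]. *)
Lemma involutive_contractive (P : operator_family R k A) :
  algebra_representation P -> involutive_representation star P -> contractive P.
Proof.
move=> rep [ip hip hst] a; apply: opnorm_le; first exact: rnorm_ge0.
move=> x; rewrite leNgt; apply/negP => hlt.
have key (t : R) : 0 <= t -> t * rnorm a ^+ 2 < 1 -> t * rnorm (op P a x) ^+ 2 <= rnorm x ^+ 2.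
  move=> t0 t1; pose h := t%:K *: amul (star a) a.
  have hn : rnorm h <= t * rnorm a ^+ 2.
    rewrite /h rnormZ_ge0// ler_wpM2l//; apply: le_trans (amul_norm _ _) _.
    by rewrite expr2 ler_wpM2r ?rnorm_ge0// cp_star_norm.
  have s0 : 0 < 1 - t * rnorm a ^+ 2 by rewrite subr_gt0.
  pose d := Num.sqrt (1 - t * rnorm a ^+ 2).
  have d2 : d ^+ 2 = 1 - t * rnorm a ^+ 2 by rewrite sqr_sqrtr// ltW.
  have [||||||||u [su hu]] := @sqrt_one_minus R k A star h d.
  - by rewrite sqrtr_gt0.
  - have t2 : 0 <= t * rnorm a ^+ 2 by rewrite mulr_ge0// sqr_ge0.
    by rewrite -sqrtr1 ler_wsqrtr//; lra.
  - by rewrite d2; lra.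
  - exact: cp_starD.
  - exact: cp_starZ.
  - exact: cp_starM.
  - exact: cp_star_norm.
  - by rewrite /h cp_starZ cp_starM cp_starK.
  pose y := x - op P u x.
  have e1 : ip y y = ip x x - ip (op P h x) x.
    rewrite hu (linear_mapB _ _ (arep_linear_r rep _)) (linear_mapD _ _ (arep_linear_r rep _)) (arepM rep).
    rewrite /y !(ipBl hip) !(ipBr hip) (ipDl hip).
    have e2 z : ip z (op P u x) = ip (op P u z) x by rewrite hst su.
    by rewrite /= !e2; ring.
  have e3 : ip (op P h x) x = (t * rnorm (op P a x) ^+ 2)%:K.
    rewrite /h (linear_mapZ _ _ (arep_linear_r rep _)) (ipZl hip) (arepM rep) hst cp_starK.
    by rewrite (ip_norm hip) -rmorphM.
  move: e1; rewrite e3 !(ip_norm hip) -rmorphB => /(congr1 (@scalar_Re R k)).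
  by rewrite !Re_of_real => e1; have := sqr_ge0 (rnorm y); lra.
have nx := rnorm_ge0 x; have na := rnorm_ge0 a.
set n := rnorm a in hlt key na; set r := rnorm x in hlt key nx; set v := rnorm (op P a x) in hlt key.
have v0 : 0 < v by apply: le_lt_trans hlt; exact: mulr_ge0.
have v2 : n ^+ 2 * r ^+ 2 < v ^+ 2.
  by rewrite -exprMn ltr_pXn2r// ?nnegrE ?mulr_ge0// ltW.
have n2 := sqr_ge0 n; have r2 := sqr_ge0 r.
have vp : 0 < v ^+ 2 by rewrite exprn_gt0.
(* With this e, the number t = (r^2 + e) / v^2 satisfies t n^2 < 1 and
   t v^2 > r^2, which contradicts [key]. *)
pose e := (v ^+ 2 - n ^+ 2 * r ^+ 2) / (n ^+ 2 + 1).
have N1 : 0 < n ^+ 2 + 1 by lra.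
have e0 : 0 < e by rewrite divr_gt0// subr_gt0.
have ee : e * (n ^+ 2 + 1) = v ^+ 2 - n ^+ 2 * r ^+ 2 by rewrite /e divfK// gt_eqF.
have k1 : 0 <= (r ^+ 2 + e) / v ^+ 2 by apply: divr_ge0; lra.
have k2 : (r ^+ 2 + e) / v ^+ 2 * n ^+ 2 < 1.
  by rewrite mulrAC ltr_pdivrMr// mul1r; lra.
have := key _ k1 k2; rewrite divfK ?gt_eqF//; lra.
Qed.

End star.

(** * The correspondence *)

(** Some [V] in [ZZ] has supremum below [1 + e]; the fixed compact set is what
    makes the suprema of [nu] finite. *)
Lemma nu_near_identity (R : realType) (G : topGroupType) (ZZ : set (set G)) (nu : G -> R) :
  (forall V, ZZ V -> nbhs (1%g : G) V) ->
  (forall B, nbhs (1%g : G) B -> exists2 V, ZZ V & V `<=` B) ->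
  (exists2 C : set G, compact C & forall V, ZZ V -> V `<=` C) ->
  (forall r, 0 <= nu r) ->
  (forall C : set G, compact C -> has_ubound (nu @` C)) ->
  inf [set sup (nu @` V) | V in ZZ] = 1 ->
  forall e, 0 < e -> exists2 B, nbhs (1%g : G) B & forall s, B s -> nu s <= 1 + e.
Proof.
move=> Znbhs Zbasis [C cC ZC] nu0 nub nuinf e e0.
have Zsup V s : ZZ V -> V s -> nu s <= sup (nu @` V).
  move=> ZV Vs; apply: ub_le_sup; last by exists s.
  have [N hN] := nub C cC; exists N => _ [t Vt <-]; apply: hN; exists t => //.
  exact: ZC Vt.
have hinf : has_inf [set sup (nu @` V) | V in ZZ].
  split.
    have nT : nbhs (1%g : G) setT by exact: filterT.
    by have [V ZV _] := Zbasis _ nT; exists (sup (nu @` V)), V.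
  exists 0 => _ [V ZV <-]; apply: le_trans (nu0 1%g) _.
  exact: (Zsup _ _ ZV (nbhs_singleton (Znbhs _ ZV))).
have [_ [V ZV <-]] := inf_adherent e0 hinf.
rewrite nuinf => hV; exists V; first exact: Znbhs.
by move=> s Vs; apply: le_trans (Zsup _ _ ZV Vs) (ltW hV).
Qed.

Section correspondence.
Context {R : realType} {k : scalars} {G : topGroupType}.
Variable mu : {measure set (borel G) -> \bar R}.
Local Notation K := (scalar_field R k).
Hypothesis hG : hausdorff_space G.
Hypothesis lcG : locally_compact [set: G].
Hypothesis haar : left_haar_measure mu.
Variable nu : G -> R.
Hypothesis nu0 : forall r, 0 <= nu r.
Hypothesis nu_bounded : forall C : set G, compact C -> has_ubound (nu @` C).
Hypothesis nu_near1 : forall e, 0 < e -> exists2 B, nbhs (1%g : G) B & forall s, B s -> nu s <= 1 + e.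
Variable RR : operator_family R k G -> Prop.
Hypothesis RR_nonempty : exists p, RR p.
Hypothesis RR_rep : forall p, RR p ->
  [/\ group_representation p, strongly_continuous p & bounded_by nu p].
Variable XX : completeNormedModType K -> Prop.
Hypothesis RR_contains : forall p, representations_in XX nu p -> RR p.
Variable A : crossed_product mu RR.

Lemma crossed_rep_surj P : nondegenerate_contractive_in XX P ->
  exists2 p, representations_in XX nu p & crossed_rep A p = P.
Proof.
move=> [XP rep ctr ndg].
have [U [grp cnt bnd hU]] := disintegration hG lcG haar nu0 nu_bounded nu_near1 RR_nonempty RR_rep rep ctr ndg.
have Up : representations_in XX nu (OperatorFamily U) by [].
exists (OperatorFamily U) => //.
have spec : crossed_rep_spec (A := A) (p := OperatorFamily U) (op P).
  by split; [exact: rep|exact: ctr|].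
rewrite (crossed_repE hG haar nu_bounded RR_rep (RR_contains Up) spec).
exact: operator_family_eta.
Qed.

Lemma crossed_rep_bij : class_bij (representations_in XX nu) (nondegenerate_contractive_in XX) (crossed_rep A).
Proof.
split.
- move=> p hp; have [Xp _ _ _] := hp.
  exact: (crossed_rep_class hG lcG haar nu_bounded RR_rep A (RR_contains hp) Xp).
- move=> p p' /RR_contains Rp /RR_contains Rp'.
  exact: (crossed_rep_inj hG lcG haar nu0 nu_bounded RR_rep Rp Rp').
- exact: crossed_rep_surj.
Qed.

(** An involutive representation is contractive, so it comes from a
    representation in [RR], which is unitary. *)
Lemma crossed_rep_unitary_bij (Delta : G -> R) : modular_function mu Delta ->
  (forall p, RR p -> unitary p) ->
  class_bij (fun p => representations_in XX nu p /\ unitary p)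
    (nondegenerate_involutive_in XX (cp_star A Delta)) (crossed_rep A).
Proof.
move=> hD RR_unitary; have [cls inj surj] := crossed_rep_bij; split.
- move=> p [hp _]; have Rp := RR_contains hp; have [Xp t1 _ t3] := cls p hp.
  split=> //; have [ip hip hU] := RR_unitary p Rp; exists ip => // a x y.
  exact: (cp_star_adjoint hG lcG haar nu_bounded RR_nonempty RR_rep hD RR_unitary).
- by move=> p p' [hp _] [hp' _]; exact: inj.
- move=> P [XP rep ndg inv].
  have ctr := involutive_contractive hG lcG haar nu_bounded RR_nonempty RR_rep hD RR_unitary rep inv.
  have [|p hp E] := surj P; first by [].
  by exists p => //; split=> //; exact/RR_unitary/RR_contains.
Qed.

End correspondence.

Theorem theorem9p7 (R : realType) (k : scalars) (G : topGroupType)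
    (G_locally_compact : locally_compact [set: G])
    (G_hausdorff : hausdorff_space G)
    (mu : {measure set (borel G) -> \bar R}) (mu_haar : left_haar_measure mu)
    (ZZ : set (set G))
    (ZZ_nbhs : forall V, ZZ V -> nbhs (1%g : G) V)
    (ZZ_basis : forall B, nbhs (1%g : G) B -> exists2 V, ZZ V & V `<=` B)
    (ZZ_compact : exists2 C : set G, compact C & forall V, ZZ V -> V `<=` C)
    (nu : G -> R)
    (nu_ge0 : forall r, 0 <= nu r)
    (nu_bounded : forall C : set G, compact C -> has_ubound (nu @` C))
    (nu_inf : inf [set sup (nu @` V) | V in ZZ] = 1)
    (RR : operator_family R k G -> Prop)
    (RR_nonempty : exists p, RR p)
    (RR_rep : forall p, RR p ->
      [/\ group_representation p, strongly_continuous p & bounded_by nu p])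
    (XX : completeNormedModType (scalar_field R k) -> Prop)
    (RR_contains : forall p, representations_in XX nu p -> RR p)
    (A : crossed_product mu RR) :
  [/\ class_bij (representations_in XX nu) (nondegenerate_contractive_in XX)
        (crossed_rep A),
      forall p, representations_in XX nu p ->
        closed_invariant_subspace p = closed_invariant_subspace (crossed_rep A p),
      forall p p', representations_in XX nu p -> representations_in XX nu p' ->
        bounded_intertwiner p p' =
        bounded_intertwiner (crossed_rep A p) (crossed_rep A p')
    & k = ComplexScalars -> (forall p, RR p -> unitary p) ->
      forall Delta : G -> R, modular_function mu Delta ->
        class_bij (fun p => representations_in XX nu p /\ unitary p)
          (nondegenerate_involutive_in XX (cp_star A Delta)) (crossed_rep A)].
Proof.
have nu1 := nu_near_identity ZZ_nbhs ZZ_basis ZZ_compact nu_ge0 nu_bounded nu_inf.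
split.
- exact: (crossed_rep_bij G_hausdorff G_locally_compact mu_haar nu_ge0 nu_bounded nu1 RR_nonempty RR_rep RR_contains).
- move=> p hp.
  exact: (crossed_rep_invariant G_hausdorff G_locally_compact mu_haar nu_ge0 nu_bounded RR_rep A (RR_contains _ hp)).
- move=> p p' hp hp'.
  exact: (crossed_rep_intertwiner G_hausdorff G_locally_compact mu_haar nu_ge0 nu_bounded RR_rep A (RR_contains _ hp) (RR_contains _ hp')).
- move=> _ RR_unitary Delta hD.
  exact: (crossed_rep_unitary_bij G_hausdorff G_locally_compact mu_haar nu_ge0 nu_bounded nu1 RR_nonempty RR_rep RR_contains A hD RR_unitary).
Qed.
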